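(* Let $\boldsymbol\Xi$ be a finite-dimensional smooth manifold, $\boldsymbol v=(v^1,\dots,v^d)\in C^\infty(\boldsymbol\Xi,\mathbb R^d)$ a smooth injective immersion, $V=C_{\mathrm c}^\infty(\boldsymbol\Xi)$, and let $M$ be a simply connected open subset of $V$. Let $c\in C^\infty(M)$ be real-valued. The following statements are equivalent: (i) $c$ possesses a flux for the kinetic equation $\frac{\partial f}{\partial t}+\boldsymbol v(\boldsymbol\xi)\cdot\nabla_{\boldsymbol x}f=Q[f]$; (ii) there exists a mapping $\mathcal A:M\to V^*$ such that for each $f\in M$ and $h_1,h_2\in V$, $$\partial^2c(f;h_1,h_2)=\langle\mathcal A(f),h_1h_2\rangle,$$ where $\partial^2c$ is the second-order Gateaux derivative of $c$.
   Context: $C_{\mathrm c}^\infty(\boldsymbol\Xi)$ is the space of real-valued smooth compactly supported functions on $\boldsymbol\Xi$ with its usual (test function) topology, and $V^*$ its topological dual. Simply connected includes path connected. $\partial c(f;h)$ denotes the first Gateaux derivative of $c$ at $f$ in direction $h$. Flux: $c\in C^\infty(M)$ possesses a flux for the kinetic equation if there is a smooth function $\boldsymbol F_c=(F_c^1,\dots,F_c^d)\in C^\infty(M,\mathbb R^d)$ such that $\partial F_c^j(f;h)=\partial c(f;v^jh)$ for each $f\in M$, $h\in V$ and $j=1,\dots,d$. (This does not involve the right-hand side $Q$.) *)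

(* Defs.v *)
From HB Require Import structures.
From mathcomp Require Import all_boot all_order all_algebra.
From mathcomp Require Import all_classical all_reals all_analysis.
From mathcomp Require Import lra.
Set Implicit Arguments.
Unset Strict Implicit.
Unset Printing Implicit Defensive.
Import Order.TTheory GRing.Theory Num.Theory.
Import numFieldNormedType.Exports.
Local Open Scope classical_set_scope.
Local Open Scope ring_scope.

Section EuclideanSmooth.
Context {R : realType} {n : nat}.
Implicit Types (f g : 'rV[R]_n -> R) (O : set 'rV[R]_n) (s : seq 'I_n).

Definition pderiv f s : 'rV[R]_n -> R :=
  foldl (fun g i x => 'D_(delta_mx 0 i) g x) f s.

Definition smooth_on O f : Prop := forall s x, O x ->
  {for x, continuous (pderiv f s)} /\
  forall i, derivable (pderiv f s) x (delta_mx 0 i).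

(* C^k regularity, used only to prove closure under sums and products. *)
Let smooth_at O f s := forall x, O x ->
  {for x, continuous (pderiv f s)} /\
  forall i, derivable (pderiv f s) x (delta_mx 0 i).

Let cn O k f := forall s, (size s <= k)%N -> smooth_at O f s.

Let cnS O k f : smooth_at O f [::] ->
  (forall i, cn O k (fun x => 'D_(delta_mx 0 i) f x)) -> cn O k.+1 f.
Proof. by move=> f0 fS [|i s] // ks; exact: fS. Qed.

Let cn_der O k f i : cn O k.+1 f -> cn O k (fun x => 'D_(delta_mx 0 i) f x).
Proof. by move=> fk s ks; exact: (fk (i :: s)). Qed.

Let cnW O k f : cn O k.+1 f -> cn O k f.
Proof. by move=> fk s ks; apply: fk; exact: leqW. Qed.

Lemma eq_pderiv O f g s : open O -> (forall x, O x -> f x = g x) ->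
  forall x, O x -> pderiv f s x = pderiv g s x.
Proof.
move=> oO; elim: s f g => [|i s IH] f g fg; first exact: fg.
apply: IH => x Ox; apply: near_eq_derive; near=> y; apply: fg.
by near: y; exact: open_nbhs_nbhs.
Unshelve. all: by end_near. Qed.

Let eq_cn O k f g : open O -> (forall x, O x -> f x = g x) ->
  cn O k f -> cn O k g.
Proof.
move=> oO fg sf s sk x Ox.
have E : {near x, pderiv f s =1 pderiv g s}.
  near=> y; apply: (eq_pderiv _ oO fg).
  by near: y; exact: open_nbhs_nbhs.
have [cf df] := sf s sk x Ox; split; last first.
  by move=> i; exact: near_eq_derivable E (df i).
move: cf; rewrite /prop_for /continuous_at (eq_pderiv s oO fg Ox) => cf.
exact: (cvg_trans (near_eq_cvg E) cf).
Unshelve. all: by end_near. Qed.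

Let cnD O k f g : open O ->
  cn O k f -> cn O k g -> cn O k (fun x => f x + g x).
Proof.
move=> oO; elim: k f g => [|k IH] f g cf cg.
  move=> [|//] _ x Ox; have [cfx df] := cf [::] isT x Ox.
  have [cgx dg] := cg [::] isT x Ox.
  by split=> [|i]; [exact: (cvgD cfx cgx) | exact: (derivableD (df i) (dg i))].
apply: cnS => [x Ox|i].
  have [cfx df] := cf [::] isT x Ox; have [cgx dg] := cg [::] isT x Ox.
  by split=> [|i]; [exact: (cvgD cfx cgx) | exact: (derivableD (df i) (dg i))].
have := IH _ _ (cn_der i cf) (cn_der i cg); apply: eq_cn => // x Ox.
rewrite [RHS](@deriveD _ _ _ f g)//.
  by have [_] := cf [::] isT x Ox; exact.
by have [_] := cg [::] isT x Ox; exact.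
Qed.

Let cnM O k f g : open O ->
  cn O k f -> cn O k g -> cn O k (fun x => f x * g x).
Proof.
move=> oO; elim: k f g => [|k IH] f g cf cg.
  move=> [|//] _ x Ox; have [cfx df] := cf [::] isT x Ox.
  have [cgx dg] := cg [::] isT x Ox.
  by split=> [|i]; [exact: (cvgM cfx cgx) | exact: (derivableM (df i) (dg i))].
apply: cnS => [x Ox|i].
  have [cfx df] := cf [::] isT x Ox; have [cgx dg] := cg [::] isT x Ox.
  by split=> [|i]; [exact: (cvgM cfx cgx) | exact: (derivableM (df i) (dg i))].
have := cnD oO (IH _ _ (cnW cf) (cn_der i cg)) (IH _ _ (cnW cg) (cn_der i cf)).
apply: eq_cn => // x Ox.
rewrite [RHS](@deriveM _ _ f g)//.
  by have [_] := cf [::] isT x Ox; exact.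
by have [_] := cg [::] isT x Ox; exact.
Qed.

Lemma smooth_onD O f g : open O ->
  smooth_on O f -> smooth_on O g -> smooth_on O (fun x => f x + g x).
Proof.
move=> oO sf sg s.
by apply: (@cnD O (size s)) => // t _; [exact: sf | exact: sg].
Qed.

Lemma smooth_onM O f g : open O ->
  smooth_on O f -> smooth_on O g -> smooth_on O (fun x => f x * g x).
Proof.
move=> oO sf sg s.
by apply: (@cnM O (size s)) => // t _; [exact: sf | exact: sg].
Qed.

Lemma smooth_on_cst O (a : R) : smooth_on O (fun=> a).
Proof.
suff pc s : exists b, pderiv (fun=> a) s = fun=> b.
  move=> s x Ox; have [b ->] := pc s.
  by split=> [|i]; [exact: cst_continuous | exact: derivable_cst].
elim: s a => [|i s IH] a; first by exists a.
have [b bE] := IH 0; exists b; rewrite -[RHS]bE; congr (pderiv _ s).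
by apply/funext => x; exact: derive_cst.
Qed.

Lemma pderivZ O (a : R) f s : open O -> smooth_on O f ->
  forall x, O x -> pderiv (fun x => a * f x) s x = a * pderiv f s x.
Proof.
move=> oO; elim: s f => [//|i s IH] f sf x Ox.
rewrite [RHS](_ : _ = a * pderiv (fun y => 'D_(delta_mx 0 i) f y) s x)//.
rewrite -IH//; last by move=> t; exact: (sf (i :: t)).
apply: (@eq_pderiv O (fun y => 'D_(delta_mx 0 i) (fun x => a * f x) y)) => //.
move=> y Oy; rewrite [LHS](@deriveZ _ _ _ f)//.
by have [_] := sf [::] y Oy; exact.
Qed.

End EuclideanSmooth.

(* [chart_map] and [chart_inv] are total functions; only their values on
   [chart_dom] and on its image are meaningful. *)
Record chart (R : realType) (n : nat) (X : topologicalType) := Chart {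
  chart_dom : set X;
  chart_map : X -> 'rV[R]_n;
  chart_inv : 'rV[R]_n -> X;
  chart_dom_open : open chart_dom;
  chart_img_open : open (chart_map @` chart_dom);
  chart_mapK : {in chart_dom, cancel chart_map chart_inv};
  chart_map_cont : {within chart_dom, continuous chart_map};
  chart_inv_cont : {within chart_map @` chart_dom, continuous chart_inv} }.

Definition chart_img {R : realType} {n : nat} {X : topologicalType}
  (phi : chart R n X) : set 'rV[R]_n := chart_map phi @` chart_dom phi.

Record manifold (R : realType) (n : nat) := Manifold {
  carrier :> topologicalType;
  atlas : set (chart R n carrier);
  manifold_hausdorff : hausdorff_space carrier;
  manifold_second_countable : @second_countable carrier;
  atlas_cover : forall x, exists2 phi, atlas phi & chart_dom phi x;
  atlas_compat : forall phi psi, atlas phi -> atlas psi -> forall j,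
    smooth_on (chart_map phi @` (chart_dom phi `&` chart_dom psi))
      (fun y => chart_map psi (chart_inv phi y) 0 j) }.

Section SmoothMaps.
Context {R : realType} {n : nat} {X : manifold R n}.

Definition smooth (f : X -> R) : Prop := forall phi, atlas phi ->
  smooth_on (chart_img phi) (f \o chart_inv phi).

Definition smooth_map d (v : X -> 'rV[R]_d) : Prop :=
  forall j, smooth (fun x => v x 0 j).

Definition immersion d (v : X -> 'rV[R]_d) : Prop :=
  forall phi x, atlas phi -> chart_dom phi x ->
    injective ('d (v \o chart_inv phi) (chart_map phi x) : _ -> _).

Definition tsupport (f : X -> R) : set X := closure [set x | f x != 0].

Lemma smoothD f g : smooth f -> smooth g -> smooth (fun x => f x + g x).
Proof.
by move=> sf sg phi aphi; apply: smooth_onD;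
  [exact: chart_img_open | exact: sf | exact: sg].
Qed.

Lemma smoothM f g : smooth f -> smooth g -> smooth (fun x => f x * g x).
Proof.
by move=> sf sg phi aphi; apply: smooth_onM;
  [exact: chart_img_open | exact: sf | exact: sg].
Qed.

Lemma smooth_cst a : smooth (fun=> a).
Proof. by move=> phi _; exact: smooth_on_cst. Qed.

End SmoothMaps.

Definition test_pred {R : realType} {n : nat} (X : manifold R n) :
  {pred X -> R} := fun f => `[< smooth f /\ compact (tsupport f) >].

Arguments test_pred {R n} X f : rename.

Record test_fun {R : realType} {n : nat} (X : manifold R n) :=
  TestFun { test_val :> X -> R; test_valP : test_val \in test_pred X }.

Section TestFunctions.
Context {R : realType} {n : nat} {X : manifold R n}.
Implicit Types f g : X -> R.

HB.instance Definition _ := [isSub for @test_val R n X].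
HB.instance Definition _ := [Choice of test_fun X by <:].

Let compact_tsupport f g : compact (tsupport g) ->
  (forall x, f x != 0 -> g x != 0) -> compact (tsupport f).
Proof.
move=> cg fg; apply: (subclosed_compact _ cg); first exact: closed_closure.
exact: closureS.
Qed.

Lemma test_predM f g : smooth f -> g \in test_pred X ->
  (fun x => f x * g x) \in test_pred X.
Proof.
move=> sf /asboolP[sg cg]; apply/asboolP; split; first exact: smoothM.
by apply: (compact_tsupport cg) => x; rewrite mulf_eq0 => /norP[].
Qed.

Lemma test_pred_submod : submod_closed (test_pred X).
Proof.
split=> [|a f g].
  apply/asboolP; split; first exact: smooth_cst.
  rewrite /tsupport (_ : [set _ | _] = set0) ?closure0; first exact: compact0.
  by apply/seteqP; split=> x //=; rewrite eqxx.
move=> /(test_predM (smooth_cst a))/asboolP[sf cf] /asboolP[sg cg].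
apply/asboolP; split; first exact: smoothD.
have cU := compactU cf cg.
apply: (subclosed_compact _ cU); first exact: closed_closure.
rewrite /tsupport -closureU; apply: closureS => x.
have [afx|] := eqVneq (a * f x) 0; last by left.
by move=> /= afg; right; move: (afg : a * f x + g x != 0); rewrite afx add0r.
Qed.

HB.instance Definition _ :=
  GRing.isSubmodClosed.Build R (X -> R) (test_pred X) test_pred_submod.
HB.instance Definition _ := [SubChoice_isSubLmodule of test_fun X by <:].

Definition smul (g : X -> R) (sg : smooth g) (h : test_fun X) : test_fun X :=
  TestFun (test_predM sg (test_valP h)).

Lemma test_smooth (h : test_fun X) : smooth h.
Proof. by have /asboolP[] := test_valP h. Qed.

Definition tmul (h1 h2 : test_fun X) : test_fun X := smul (test_smooth h1) h2.

End TestFunctions.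

Section TestTopology.
Context {R : realType} {n : nat} {X : manifold R n}.
Local Notation V := (test_fun X).
Implicit Types (f g h : V) (U W : set V) (K : set X).

(* [K]-neighbourhoods of 0 in the Frechet space of the test functions supported
   in [K]: its topology is that of uniform convergence of every partial
   derivative on every compact subset of every chart domain. *)
Definition nbhd0_on K W : Prop :=
  exists (I : finType) (phi : I -> chart R n X) (L : I -> set X)
    (s : I -> seq 'I_n) (e : R),
    [/\ 0 < e,
        forall i, [/\ atlas (phi i), compact (L i) & L i `<=` chart_dom (phi i)]
      & forall f, tsupport f `<=` K ->
          (forall i x, L i x ->
             `|pderiv (f \o chart_inv (phi i)) (s i) (chart_map (phi i) x)| < e)
          -> W f].

Definition absconvex W : Prop := forall (a b : R) f g,
  W f -> W g -> `|a| + `|b| <= 1 -> W (a *: f + b *: g).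

Definition test_nbhd0 W : Prop :=
  absconvex W /\ forall K, compact K -> nbhd0_on K W.

(* The finest locally convex topology for which the inclusions of the spaces of
   test functions supported in a fixed compact set are continuous. *)
Definition test_open U : Prop := forall f, U f ->
  exists2 W, test_nbhd0 W & forall g, W g -> U (f + g).

Lemma pderiv_test_scale (phi : chart R n X) (a : R) f s x :
  atlas phi -> chart_dom phi x ->
  pderiv ((a *: f) \o chart_inv phi) s (chart_map phi x) =
  a * pderiv (f \o chart_inv phi) s (chart_map phi x).
Proof.
move=> aphi xphi; apply: (@pderivZ _ _ (chart_img phi)).
- exact: chart_img_open.
- exact: (test_smooth f).
- by exists x.
Qed.

Lemma test_nbhd0_abs W a f : test_nbhd0 W -> `|a| <= 1 -> W f -> W (a *: f).
Proof.
move=> [cW _] a1 Wf; have := cW a 0 f f Wf Wf.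
by rewrite normr0 addr0 scale0r addr0; exact.
Qed.

Lemma test_nbhd0_0 W : test_nbhd0 W -> W 0.
Proof.
move=> WN; have [I [phi [L [s [e [e0 LP HW]]]]]] := WN.2 _ compact0.
apply: HW => [|i x Lx].
  rewrite /tsupport (_ : [set _ | _] = set0) ?closure0//.
  by apply/seteqP; split=> x //=; rewrite eqxx.
have [ai _ Li] := LP i.
by rewrite -(scale0r (0 : V)) pderiv_test_scale ?mul0r ?normr0//; exact: Li.
Qed.

Lemma test_nbhd0T : test_nbhd0 setT.
Proof.
split=> // K _; exists void, (of_void _),
  (fun=> set0), (fun=> [::]), 1.
by split=> // -[].
Qed.

Lemma test_nbhd0I W1 W2 : test_nbhd0 W1 -> test_nbhd0 W2 ->
  test_nbhd0 (W1 `&` W2).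
Proof.
move=> [c1 N1] [c2 N2]; split=> [a b f g [? ?] [? ?] ab|K cK].
  by split; [exact: c1 | exact: c2].
have [I1 [p1 [L1 [s1 [e1 [e10 LP1 HW1]]]]]] := N1 K cK.
have [I2 [p2 [L2 [s2 [e2 [e20 LP2 HW2]]]]]] := N2 K cK.
pose mk T (a : I1 -> T) (b : I2 -> T) i :=
  match i with inl i => a i | inr i => b i end.
exists (I1 + I2)%type, (mk _ p1 p2), (mk _ L1 L2), (mk _ s1 s2).
exists (Num.min e1 e2); split.
- by rewrite lt_min e10.
- by case.
- move=> f fK fe; split; [apply: HW1 | apply: HW2] => // i x Lx.
    by have := fe (inl i) x Lx; rewrite lt_min => /andP[].
  by have := fe (inr i) x Lx; rewrite lt_min => /andP[].
Qed.

Lemma test_nbhd0Z W (t : R) : 0 < t -> test_nbhd0 W ->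
  test_nbhd0 [set f | W (t *: f)].
Proof.
move=> t0 [cW NW]; split=> [a b f g /= Wf Wg ab|K cK].
  by rewrite scalerDr !scalerA (mulrC t a) (mulrC t b) -!scalerA; exact: cW.
have [I [phi [L [s [e [e0 LP HW]]]]]] := NW K cK.
exists I, phi, L, s, (e / t); split=> //; first exact: divr_gt0.
move=> f fK fe; apply: HW => [|i x Lx].
  apply: subset_trans fK; apply: closureS => x /=.
  by apply: contra_neq => fx0; rewrite -[LHS]/(t * f x) fx0 mulr0.
have [ai _ Li] := LP i.
rewrite pderiv_test_scale//; last exact: Li.
by rewrite normrM gtr0_norm// mulrC -ltr_pdivlMr//; exact: fe.
Qed.

Lemma test_nbhd0_absorbs W f : test_nbhd0 W -> exists2 t : R, 0 < t & W (t *: f).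
Proof.
move=> [cW NW]; have [sf cf] := asboolP _ (test_valP f).
have [I [phi [L [s [e [e0 LP HW]]]]]] := NW _ cf.
have /choice[M MP] : forall i, exists M : R, forall x, L i x ->
    `|pderiv (f \o chart_inv (phi i)) (s i) (chart_map (phi i) x)| <= M.
  move=> i; have [ai cL Ls] := LP i.
  pose F := pderiv (f \o chart_inv (phi i)) (s i) \o chart_map (phi i).
  have : compact (F @` L i).
    apply: continuous_compact => //; apply: within_continuous_comp.
      move=> _ /set_mem[x Lx <-].
      have Ix : chart_img (phi i) (chart_map (phi i) x) by exists x => //; exact: Ls.
      by have [] := sf _ ai (s i) _ Ix.
    exact: continuous_subspaceW Ls (@chart_map_cont _ _ _ (phi i)).
  move=> /compact_bounded[M [_ MF]]; exists (M + 1) => x Lx.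
  by apply: (MF (M + 1)); [rewrite ltrDl | exists x].
pose B := 1 + \sum_i `|M i|.
have B0 : 0 < B by rewrite ltr_wpDr// sumr_ge0.
exists (e / B); first exact: divr_gt0.
apply: HW => [|i x Lx].
  apply: closureS => x /=.
  by apply: contra_neq => fx0; rewrite -[LHS]/(_ * f x) fx0 mulr0.
have [ai _ Li] := LP i.
rewrite pderiv_test_scale//; last exact: Li.
rewrite normrM gtr0_norm ?divr_gt0// -mulrA gtr_pMr// mulrC ltr_pdivrMr// mul1r.
apply: le_lt_trans (MP i x Lx) _; apply: le_lt_trans (ler_norm _) _.
by rewrite /B (bigD1 i)//= addrCA ltrDl ltr_wpDr// sumr_ge0.
Qed.

Let test_openT : test_open setT.
Proof. by move=> f _; exists setT => //; exact: test_nbhd0T. Qed.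

Let test_openI : setI_closed test_open.
Proof.
move=> U1 U2 o1 o2 f [/o1[W1 N1 H1] /o2[W2 N2 H2]].
exists (W1 `&` W2); first exact: test_nbhd0I.
by move=> g [/H1 ? /H2].
Qed.

Let test_open_bigU (I : Type) (F : I -> set V) :
  (forall i, test_open (F i)) -> test_open (\bigcup_i F i).
Proof.
move=> oF f [i _ /(oF i)[W N H]].
by exists W => // g /H; exists i.
Qed.

HB.instance Definition _ :=
  isOpenTopological.Build V test_openT test_openI test_open_bigU.

Let core f W : set V := [set g | exists2 s : R, 1 < s & W (s *: (g - f))].

Let core_open f W : test_nbhd0 W -> test_open (core f W).
Proof.
move=> NW g [s s1 Wsg]; have s0 : 0 < s by lra.
pose r := (1 + s) / 2; pose q := 1 - r / s.
have rs1 : r / s < 1 by rewrite ltr_pdivrMr// /r; lra.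
have [r1 q0] : 1 < r /\ 0 < q by rewrite /r /q; lra.
have rs0 : 0 < r / s by rewrite divr_gt0//; lra.
exists [set h | W ((r / q) *: h)]; first by apply: test_nbhd0Z => //; rewrite divr_gt0//; lra.
move=> h /= Wh; exists r => //.
have -> : r *: (g + h - f) = (r / s) *: (s *: (g - f)) + q *: ((r / q) *: h).
  rewrite !scalerA divfK ?gt_eqF// (mulrC q) divfK ?gt_eqF//.
  by rewrite -scalerDr addrAC.
by apply: NW.1 => //; rewrite !gtr0_norm// /q; lra.
Qed.

Let core_id f W : test_nbhd0 W -> core f W f.
Proof.
move=> NW; exists 2; first by lra.
by rewrite subrr scaler0; exact: test_nbhd0_0.
Qed.

Let core_sub f g W : test_nbhd0 W -> core f W g -> W (g - f).
Proof.
move=> NW [s s1 Ws]; have s0 : 0 < s by lra.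
rewrite -[g - f]scale1r -(@mulVf _ s) ?gt_eqF// -scalerA.
apply: test_nbhd0_abs => //; rewrite gtr0_norm ?invr_gt0//.
by rewrite invf_le1// ltW.
Qed.

Lemma nbhs_testP f U :
  nbhs f U <-> exists2 W, test_nbhd0 W & forall g, W g -> U (f + g).
Proof.
rewrite nbhsE; split=> [[B [oB Bf] BU]|[W NW WU]].
  have [W NW WB] := (oB : test_open B) f Bf.
  by exists W => // g /WB /BU.
exists (core f W); first by split; [exact: core_open | exact: core_id].
by move=> g /(core_sub NW) /WU; rewrite addrC subrK.
Qed.

Let test_add_continuous : continuous (fun p : V * V => p.1 + p.2).
Proof.
move=> [f g] U /= /nbhs_testP[W NW WU].
have NW2 := test_nbhd0Z (ltr0n R 2) NW.
exists ([set f' | W (2 *: (f' - f))], [set g' | W (2 *: (g' - g))]).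
  split; apply/nbhs_testP; exists [set h | W (2 *: h)] => // h /=;
  by rewrite (addrC _ h) addrK.
move=> [f' g'] /= [Wf' Wg'].
have -> : f' + g' = (f + g) + (2^-1 *: (2 *: (f' - f)) + 2^-1 *: (2 *: (g' - g))).
  by rewrite !scalerA mulVf// !scale1r addrACA !(addrC f) !(addrC g) !subrK.
by apply/WU/NW.1 => //; rewrite ger0_norm//; lra.
Qed.

Let test_scale_continuous : continuous (fun z : R^o * V => z.1 *: z.2).
Proof.
move=> [a f] U /= /nbhs_testP[W NW WU].
have [t t0 Wtf] := test_nbhd0_absorbs f NW.
pose m := 2 * (`|a| + 1).
have m0 : 0 < m by rewrite mulr_gt0// ltr_wpDl.
exists ([set b : R^o | `|b - a| < Num.min 1 (t / 2)], [set g | W (m *: (g - f))]).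
  split => /=.
    apply/nbhs_ballP; exists (Num.min 1 (t / 2)) => /=.
      by rewrite lt_min ltr01 divr_gt0.
    by move=> b; rewrite /ball/= distrC.
  apply/nbhs_testP; exists [set h | W (m *: h)]; first exact: test_nbhd0Z.
  by move=> h /=; rewrite (addrC _ h) addrK.
move=> [b g] /= [+ Wg]; rewrite lt_min => /andP[ba1 bat].
have -> : b *: g =
    a *: f + ((b / m) *: (m *: (g - f)) + ((b - a) / t) *: (t *: f)).
  rewrite !scalerA !divfK ?gt_eqF// scalerBr scalerBl.
  by rewrite (addrA (b *: g - b *: f)) subrK addrCA subrr addr0.
apply/WU/NW.1 => //; rewrite !normrM !normfV (gtr0_norm m0) (gtr0_norm t0).
have b1 : `|b| <= `|a| + 1.
  have := ler_normD (b - a) a; rewrite subrK; lra.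
have : `|b| / m <= 1 / 2 by rewrite ler_pdivrMr// /m; lra.
have : `|b - a| / t <= 1 / 2 by rewrite ler_pdivrMr//; lra.
lra.
Qed.

Let test_locally_convex : exists2 B : set_system V,
  (forall b, b \in B -> convex_set b) & basis B.
Proof.
exists [set U : set V | open U /\ convex_set U]; first by move=> U /set_mem[].
split=> [U []//|f U /nbhs_testP[W NW WU]].
exists (core f W); last by move=> g /(core_sub NW) /WU; rewrite addrC subrK.
split; last exact: core_id.
split; first exact: core_open.
move=> g h l /set_mem[s s1 Ws] /set_mem[t t1 Wt]; apply/mem_set.
have [r [r1 Wrg Wrh]] : exists r, [/\ 1 < r, W (r *: (g - f)) & W (r *: (h - f))].
  have sc (a b : R) k : 1 < a -> a <= b -> W (b *: k) -> W (a *: k).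
    move=> a1 ab Wb; have b0 : 0 < b by lra.
    rewrite -[a](@divfK _ b) ?gt_eqF// -scalerA; apply: test_nbhd0_abs => //.
    by rewrite gtr0_norm ?divr_gt0 ?ler_pdivrMr//; lra.
  have [st|/ltW ts] := leP s t.
    by exists s; split=> //; exact: sc st Wt.
  by exists t; split=> //; exact: sc ts Ws.
exists r => //.
have [l0 l1] : (0 : R) <= l%:num /\ l%:num <= (1 : R) by split; rewrite ?ge0 ?le1.
set a : R := l%:num in l0 l1.
have -> : r *: (conv l g h - f) =
    a *: (r *: (g - f)) + (1 - a) *: (r *: (h - f)).
  rewrite !scalerA ![_ * r]mulrC -!scalerA -scalerDr; congr (_ *: _).
  rewrite !scalerBr addrACA -opprD -scalerDl (addrC a) subrK scale1r.
  by [].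
by apply: NW.1 => //; rewrite !ger0_norm//; lra.
Qed.

(* This factory only declares the uniform structure; the three instances after it
   supply the remaining mixins of [tvsType]. *)
HB.instance Definition _ := PreTopologicalLmod_isTvs.Build R V
  test_add_continuous test_scale_continuous test_locally_convex.
HB.instance Definition _ :=
  PreTopologicalNmodule_isTopologicalNmodule.Build V test_add_continuous.
HB.instance Definition _ :=
  TopologicalNmodule_isTopologicalLmodule.Build R V test_scale_continuous.
HB.instance Definition _ := Uniform_isTvs.Build R V test_locally_convex.

End TestTopology.

Section Calculus.
Context {R : realType} {V : tvsType R}.
Implicit Types (c : V -> R) (f h : V) (M : set V).

Definition dual : Type := {l : {linear V -> R^o} | continuous l}.

Definition pairing (l : dual) h : R := sval l h.

Definition gateaux c f h : R := derive1 (fun t : R => c (f + t *: h)) 0.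

(* [gateaux_n c [:: h1; ..; hk] f] is the k-th derivative of [c] at [f],
   differentiated in the direction [h1] first. *)
Definition gateaux_n c (hs : seq V) : V -> R :=
  foldl (fun u h f => gateaux u f h) c hs.

(* Smoothness on the open set [M] in the Michal-Bastiani sense: the iterated
   Gateaux derivatives of every order k exist on [M] and are jointly continuous
   on [M] times the k-th power of [V], here the row vectors ['rV[V]_k] with the
   product topology. Functions on [M] are represented by total functions: [M]
   being open, these derivatives at points of [M] only involve values on [M]. *)
Definition smooth_in M c : Prop := forall k : nat,
  (forall hs : k.-tuple V, forall f h, M f ->
     derivable (fun t : R => gateaux_n c hs (f + t *: h)) 0 1) /\
  forall p : V * ('rV[V]_k), M p.1 ->
    {for p, continuous
       (fun q : V * ('rV[V]_k) => gateaux_n c [seq q.2 0 i | i : 'I_k] q.1)}.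

Local Notation I01 := (`[0, 1]%classic : set R).

Definition path_connected M : Prop := forall f g, M f -> M g ->
  exists gamma : R -> V, [/\ {within I01, continuous gamma},
    forall t, I01 t -> M (gamma t), gamma 0 = f & gamma 1 = g].

Definition null_homotopic M (gamma : R -> V) : Prop :=
  exists H : R * R -> V,
    [/\ {within I01 `*` I01, continuous H},
        forall p, (I01 `*` I01) p -> M (H p),
        forall t, I01 t -> H (0, t) = gamma t,
        forall t, I01 t -> H (1, t) = gamma 0
      & forall s, I01 s -> H (s, 0) = gamma 0 /\ H (s, 1) = gamma 0].

Definition simply_connected M : Prop :=
  path_connected M /\
  forall gamma : R -> V, {within I01, continuous gamma} ->
    (forall t, I01 t -> M (gamma t)) -> gamma 0 = gamma 1 ->
    null_homotopic M gamma.

End Calculus.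
Arguments dual {R} V.

Section Flux.
Context {R : realType} {n d : nat} {X : manifold R n}.

(* Only the transport term of the kinetic equation, i.e. the velocity field
   [v], enters the definition; its right-hand side does not. *)
Definition possesses_flux (v : X -> 'rV[R]_d) (sv : smooth_map v)
  (M : set (test_fun X)) (c : test_fun X -> R) : Prop :=
  exists F : 'I_d -> test_fun X -> R,
    (forall j, smooth_in M (F j)) /\
    forall j f h, M f ->
      gateaux (F j) f h = gateaux c f (smul (sv j) h).

End Flux.

(* Main.v *)
From HB Require Import structures.
Require Import Defs.
From mathcomp Require Import all_boot all_order all_algebra.
From mathcomp Require Import all_classical all_reals all_analysis.
From mathcomp Require Import perm ring lra zify.
Set Implicit Arguments.
Unset Strict Implicit.
Unset Printing Implicit Defensive.
Import Order.TTheory GRing.Theory Num.Theory.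
Import numFieldNormedType.Exports.
Local Open Scope classical_set_scope.
Local Open Scope ring_scope.

(* If [F_j] is a flux, Schwarz's theorem for [F_j] and for [c] makes the
   symmetric bilinear form [B h k] = d^2 c(f; h, k) commute with multiplication
   by each [v^j], hence by every polynomial in [v], and by density of the
   polynomials (coordinatewise Bernstein approximation in C^m, [B] being
   separately continuous) by [Phi \o v] for every smooth [Phi] on R^d. As [v] is
   an injective immersion, every smooth function times a suitable bump is, on a
   compact set, of the form [Phi \o v] (inverse function theorem), so a
   compactness argument shows that [B] commutes with multiplication by every
   smooth function. Therefore [B h k] = [B chi (h k)] for any cutoff [chi] equal
   to 1 on the support of [h k], and [A f] := [B chi _].

   Conversely (ii) says that the 1-form [w f h] = dc(f; v^j h) is closed.
   Its segment integrals are a local primitive, and monodromy along paths glues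
   the local primitives on the simply connected [M]; the result is [F_j]. *)

(** * Smooth functions on R^n *)

(** An injective immersion need not be an embedding: the image of [v] may accumulate on itself, so a
    smooth function on the manifold, even multiplied by a bump, need not be a smooth function of
    [v]. A multiplier, however, matters only on the supports of the two arguments of [B], and on a
    compact [K] injectivity keeps the points outside a chart neighbourhood of [x0] at a positive
    distance from [v x0]. Hence commutation is stated for supports in [K], and the radius of the
    bump depends on [K]. The bumps are not normalised to a partition of unity: a sum of them that is
    positive on [K] is inverted on [K] instead. Continuity of [B] dictates the order of the
    derivatives to be approximated. Bernstein polynomials suit this, since their derivatives are
    again Bernstein polynomials, of forward differences. In the converse, paths and homotopies are
    merely continuous, so a form cannot be integrated along them; local primitives are continued
    instead. Beyond order 0, smoothness of [F_j] is inherited: its derivatives are those of [c] with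
    the first direction multiplied by [v^j]. *)

Section LineCalculus.
Context {R : realType}.

Lemma MVT01 (f df : R -> R) :
  (forall t : R, 0 <= t <= 1 -> is_derive t 1 f (df t)) ->
  exists2 c, 0 <= c <= 1 & f 1 - f 0 = df c.
Proof.
move=> fdf; have [||c c01 ->] := @MVT R f df 0 1 ltr01.
- by move=> x; rewrite in_itv /= => /andP[x0 x1]; apply: fdf; rewrite !ltW.
- apply: derivable_within_continuous => x; rewrite in_itv /= => x01.
  exact: (@ex_derive _ _ _ _ _ _ _ (fdf x x01)).
exists c; last by rewrite subr0 mulr1.
by move: c01; rewrite in_itv /= => /andP[? ?]; rewrite !ltW.
Qed.

Lemma derivable_line (V : normedModType R) (f : V -> R) x v (t : R) :
  derivable f (x + t *: v) v -> derivable (fun s : R => f (x + s *: v)) t 1.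
Proof.
rewrite /derivable => H; set g := (X in cvg (X @ _)).
suff -> : g = fun h => h^-1 *: ((f \o shift (x + t *: v)) (h *: v) - f (x + t *: v)) by [].
apply/funext => h; rewrite /g /= [h *: 1]mulr1 scalerDl.
by rewrite addrCA.
Qed.

Lemma derive_line (V : normedModType R) (f : V -> R) x v (t : R) :
  'D_1 (fun s : R => f (x + s *: v)) t = 'D_v f (x + t *: v).
Proof.
rewrite /derive; set g := (X in lim (X @ _) = _).
suff -> : g = fun h => h^-1 *: ((f \o shift (x + t *: v)) (h *: v) - f (x + t *: v)) by [].
apply/funext => h; rewrite /g /= [h *: 1]mulr1 scalerDl.
by rewrite addrCA.
Qed.

Lemma is_derive_line (V : normedModType R) (f : V -> R) x v (t : R) :
  derivable f (x + t *: v) v ->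
  is_derive t 1 (fun s : R => f (x + s *: v)) ('D_v f (x + t *: v)).
Proof.
by move=> df; split; [exact: derivable_line|exact: derive_line].
Qed.

Lemma MVT_line (V : normedModType R) (f : V -> R) x v :
  (forall t : R, 0 <= t <= 1 -> derivable f (x + t *: v) v) ->
  exists2 c, 0 <= c <= 1 & f (x + v) - f x = 'D_v f (x + c *: v).
Proof.
move=> df; have [t t01|c c01] := @MVT01 (fun s => f (x + s *: v))
    (fun s => 'D_v f (x + s *: v)).
  by apply: is_derive_line; exact: df.
by rewrite scale1r scale0r addr0 => E; exists c.
Qed.

End LineCalculus.

Section RowNorm.
Context {R : realType} {n : nat}.
Implicit Types x y : 'rV[R]_n.

Lemma rV_coord_le x i : `|x 0 i| <= `|x|.
Proof.
rewrite [leRHS]/Num.Def.normr/= mx_normrE.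
exact: (le_bigmax _ (fun ij : 'I_1 * 'I_n => `|x ij.1 ij.2|) (0, i)).
Qed.

Lemma rV_norm_le x e : 0 <= e -> (forall i, `|x 0 i| <= e) -> `|x| <= e.
Proof.
move=> e0 xe; rewrite [leLHS]/Num.Def.normr/= mx_normrE.
by apply: bigmax_le => // -[i j] _ /=; rewrite ord1.
Qed.

Lemma rV_norm_lt x e : 0 < e -> (forall i, `|x 0 i| < e) -> `|x| < e.
Proof.
move=> e0 xe; rewrite [ltLHS]/Num.Def.normr/= mx_normrE.
by apply: bigmax_lt => // -[i j] _ /=; rewrite ord1.
Qed.

End RowNorm.

Lemma cvg_sumr (R : numFieldType) (V : normedModType R) (T I : Type)
    (F : set_system T) {FF : Filter F} (r : seq I) (P : pred I)
    (f : I -> T -> V) (l : I -> V) :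
  (forall i, P i -> f i @ F --> l i) ->
  (fun x => \sum_(i <- r | P i) f i x) @ F --> \sum_(i <- r | P i) l i.
Proof.
move=> fl; elim: r => [|i r IH].
  rewrite big_nil; under eq_fun do rewrite big_nil; exact: cvg_cst.
rewrite big_cons; under eq_fun do rewrite big_cons.
by case: ifP => // Pi; apply: cvgD => //; exact: fl.
Qed.

Lemma differentiable_eps (R : numFieldType) (V W : normedModType R)
    (f : V -> W) (df : {linear V -> W}) (x : V) : continuous df ->
  (forall e : R, 0 < e -> exists2 d : R, 0 < d &
     forall h, `|h| < d -> `|f (x + h) - f x - df h| <= e * `|h|) ->
  differentiable f x /\ 'd f x = df :> (V -> W).
Proof.
move=> dfc fdf.
have E : f \o shift x = cst (f x) + df +o_ 0 id.
  apply/eqaddoP => e e0; have [d d0 Hd] := fdf e e0; near=> h.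
  rewrite -[X in `|X|]/(f (h + x) - (f x + df h)) opprD addrA (addrC h).
  apply: Hd; near: h; apply/nbhs_ballP; exists d => //= y.
  by rewrite -ball_normE/= sub0r normrN.
have dE := diff_unique dfc E.
by split => //; apply/diff_locallyP; rewrite dE.
Unshelve. all: by end_near. Qed.

Section C1.
Context {R : realType} {n : nat}.
Local Notation e_ i := (delta_mx 0 i : 'rV[R]_n).
Implicit Types (x y h : 'rV[R]_n) (f : 'rV[R]_n -> R).

(** Move from [x] to [x + h] one coordinate at a time: [hh k] keeps the first [k] coordinates of
    [h], and each of the [n] steps is a one-dimensional mean value theorem for a partial derivative
    close to its value at [x]. *)
Lemma C1_expansion f x (e : R) : 0 < e ->
  (forall i, \forall y \near x, derivable f y (e_ i)) ->
  (forall i, {for x, continuous (fun y => 'D_(e_ i) f y)}) ->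
  exists2 d, 0 < d & forall h, `|h| < d ->
    `|f (x + h) - f x - \sum_i h 0 i * 'D_(e_ i) f x| <= e * `|h|.
Proof.
move=> e0 df cf.
(* The [n] steps together cost [n e' <= e]; dividing by [n.+1] also covers [n = 0]. *)
pose e' := e / n.+1%:R.
have e'0 : 0 < e' by rewrite divr_gt0.
have near_x i : \forall y \near x, derivable f y (e_ i) /\
    `|'D_(e_ i) f x - 'D_(e_ i) f y| < e'.
  by apply: filterI; [exact: df | have /cvgrPdist_lt := cf i; apply].
have : nbhs x (fun y => forall i, derivable f y (e_ i) /\
    `|'D_(e_ i) f x - 'D_(e_ i) f y| < e') by exact: filter_forall _ near_x.
move=> /nbhs_ballP[d /= d0 Hd].
exists d => // h hd.
pose hh k : 'rV[R]_n := \row_j (if (j < k)%N then h 0 j else 0).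
have hh0 : hh 0%N = 0 by apply/rowP => j; rewrite !mxE.
have hhn : hh n = h by apply/rowP => j; rewrite !mxE ltn_ord.
have hhS (i : 'I_n) : hh i.+1 = hh i + h 0 i *: e_ i.
  apply/rowP => j; rewrite !mxE eqxx /= ltnS leq_eqVlt.
  have [->|ji] := eqVneq j i; first by rewrite eqxx ltnn add0r mulr1.
  by rewrite -val_eqE in ji; rewrite (negPf ji)/= mulr0 addr0.
have small (i : 'I_n) (t : R) : 0 <= t <= 1 -> ball x d (x + (hh i + t *: (h 0 i *: e_ i))).
  move=> /andP[t0 t1]; rewrite -ball_normE /= opprD addNKr normrN.
  apply: le_lt_trans hd; apply: rV_norm_le => // j; rewrite !mxE eqxx /=.
  apply: le_trans (rV_coord_le h j).
  have [->|ji] := eqVneq j i.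
    by rewrite ltnn add0r mulr1 normrM ger0_norm// ler_piMl.
  by rewrite !mulr0 addr0; case: ifP; rewrite ?normr0.
have step (i : 'I_n) :
    `|f (x + hh i.+1) - f (x + hh i) - h 0 i * 'D_(e_ i) f x| <= e' * `|h|.
  have [t t01|c c01 ] := @MVT01 _ (fun s : R => f (x + (hh i + s *: (h 0 i *: e_ i))))
      (fun s => h 0 i * 'D_(e_ i) f (x + (hh i + s *: (h 0 i *: e_ i)))).
    have [dft _] := Hd _ (small i t t01) i.
    set F := fun _ => _.
    have -> : F = (fun s : R => f (x + hh i + s *: e_ i)) \o (fun s : R => s * h 0 i).
      by apply/funext => s; rewrite /F/= scalerA addrA.
    have Hg : is_derive (t * h 0 i) 1 (fun s : R => f (x + hh i + s *: e_ i))
        ('D_(e_ i) f (x + hh i + (t * h 0 i) *: e_ i)).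
      by apply: is_derive_line; rewrite -addrA -scalerA.
    have Hm : is_derive t 1 (fun s : R => s * h 0 i) (h 0 i).
      have := is_deriveM (is_derive_id t 1) (is_derive_cst (h 0 i) t 1).
      by move/is_derive_eq; apply; rewrite scaler0 add0r /cst -[LHS]/(h 0 i * 1) mulr1.
    move: (@is_derive1_comp _ _ (fun s : R => s * h 0 i) _ _ _ Hg Hm).
    move=> /is_derive_eq; apply.
    by rewrite mulrC scalerA addrA.
  rewrite scale1r scale0r addr0 hhS => ->.
  rewrite -mulrBr normrM mulrC ler_pM// ?rV_coord_le//.
  by have [_] := Hd _ (small i c c01) i; rewrite distrC => /ltW.
have -> : f (x + h) - f x = \sum_(i < n) (f (x + hh i.+1) - f (x + hh i)).
  rewrite -(big_mkord xpredT (fun i => f (x + hh i.+1) - f (x + hh i))).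
  by rewrite telescope_sumr// hhn hh0 addr0.
rewrite -sumrB; apply: le_trans (ler_norm_sum _ _ _) _.
apply: (@le_trans _ _ (\sum_(i < n) e' * `|h|)); first by apply: ler_sum => i _; exact: step.
rewrite sumr_const card_ord -mulr_natl mulrA ler_wpM2r//.
by rewrite /e' mulrCA ger_pMr// ler_pdivrMr// mul1r ler_nat.
Qed.

Lemma C1_differentiable f x :
  (forall i, \forall y \near x, derivable f y (e_ i)) ->
  (forall i, {for x, continuous (fun y => 'D_(e_ i) f y)}) ->
  differentiable f x /\ forall h, 'd f x h = \sum_i h 0 i * 'D_(e_ i) f x.
Proof.
move=> df cf.
pose L h : R := \sum_i h 0 i * 'D_(e_ i) f x.
have Llin : linear L.
  move=> a h k; rewrite /L scaler_sumr -big_split /=; apply: eq_bigr => i _.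
  by rewrite !mxE mulrDl -mulrA.
pose LL : {linear 'rV[R]_n -> R} := HB.pack L (GRing.isLinear.Build _ _ _ _ L Llin).
have Lc : continuous LL.
  rewrite /LL/= /L => y; apply: (@cvg_sumr _ _ _ _ (nbhs y)) => i _; apply: cvgMl.
  exact: coord_continuous.
have [|? dE] := @differentiable_eps R 'rV[R]_n R f LL x Lc.
  by move=> e e0; exact: C1_expansion.
by split => // h; rewrite dE.
Qed.

End C1.

Section SmoothOn.
Context {R : realType} {n : nat}.
Local Notation e_ i := (delta_mx 0 i : 'rV[R]_n).
Implicit Types (x y h : 'rV[R]_n) (f g : 'rV[R]_n -> R) (O : set 'rV[R]_n).

Lemma near_smooth O f g s x : open O -> O x -> (forall y, O y -> f y = g y) ->
  {for x, continuous (pderiv f s)} /\ (forall i, derivable (pderiv f s) x (e_ i)) ->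
  {for x, continuous (pderiv g s)} /\ (forall i, derivable (pderiv g s) x (e_ i)).
Proof.
move=> oO Ox fg [cf df].
have E : {near x, pderiv f s =1 pderiv g s}.
  near=> y; apply: (eq_pderiv _ oO fg).
  by near: y; exact: open_nbhs_nbhs.
split; last by move=> i; exact: near_eq_derivable E (df i).
move: cf; rewrite /prop_for /continuous_at (eq_pderiv s oO fg Ox) => cf.
exact: (cvg_trans (near_eq_cvg E) cf).
Unshelve. all: by end_near. Qed.

Lemma smooth_on_eq O f g : open O -> (forall y, O y -> f y = g y) ->
  smooth_on O f -> smooth_on O g.
Proof. by move=> oO fg sf s x Ox; exact: near_smooth oO Ox fg (sf s x Ox). Qed.

Lemma smooth_on_local O f :
  (forall x, O x -> exists U, [/\ U x & smooth_on U f]) -> smooth_on O f.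
Proof. by move=> H s x /H[U [Ux sf]]; exact: sf. Qed.

Lemma smooth_on_subset U O f : U `<=` O -> smooth_on O f -> smooth_on U f.
Proof. by move=> UO sf s x /UO; exact: sf. Qed.

Lemma smooth_on_derive O f i : smooth_on O f -> smooth_on O ('D_(e_ i) f).
Proof. by move=> sf s; exact: (sf (i :: s)). Qed.

Lemma smooth_on_pderiv O f s : smooth_on O f -> smooth_on O (pderiv f s).
Proof. by elim: s f => [f sf|i s IH f sf]; [exact: sf | apply: IH; exact: smooth_on_derive]. Qed.

Lemma smooth_on_continuous O f x : smooth_on O f -> O x -> {for x, continuous f}.
Proof. by move=> sf Ox; have [] := sf [::] x Ox. Qed.

Lemma smooth_on_derivable O f x i :
  smooth_on O f -> O x -> derivable f x (e_ i).
Proof. by move=> sf Ox; have [_] := sf [::] x Ox; exact. Qed.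

(** Coinduction for smoothness: an iterated derivative never leaves the class [P], up to equality on
    [O], so first-order information about the whole class suffices. Several smoothness proofs below
    consist in finding such a class. *)
Lemma smooth_on_coind O (P : ('rV[R]_n -> R) -> Prop) : open O ->
  (forall f, P f -> (forall x, O x -> {for x, continuous f}) /\
    forall i, (forall x, O x -> derivable f x (e_ i)) /\
      exists2 g, P g & forall x, O x -> g x = 'D_(e_ i) f x) ->
  forall f, P f -> smooth_on O f.
Proof.
move=> oO HP f Pf s; elim: s f Pf => [|i s IH] f Pf x Ox.
  by have [cf df] := HP _ Pf; split => [|i]; [exact: cf | exact: (df i).1].
have [_ /(_ i)[_ [g Pg gf]]] := HP _ Pf.
exact: near_smooth oO Ox gf (IH g Pg x Ox).
Qed.

Lemma smooth_onN O f : open O -> smooth_on O f -> smooth_on O (fun x => - f x).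
Proof.
move=> oO sf; apply: (smooth_on_eq (f := fun x => -1 * f x) oO).
  by move=> y _; rewrite mulN1r.
by apply: smooth_onM oO _ sf; exact: smooth_on_cst.
Qed.

Lemma smooth_onB O f g : open O -> smooth_on O f -> smooth_on O g ->
  smooth_on O (fun x => f x - g x).
Proof. by move=> oO sf sg; exact: smooth_onD oO sf (smooth_onN oO sg). Qed.

Lemma smooth_on_sum O (I : Type) (r : seq I) (P : pred I) (F : I -> 'rV[R]_n -> R) :
  open O -> (forall i, P i -> smooth_on O (F i)) ->
  smooth_on O (fun x => \sum_(i <- r | P i) F i x).
Proof.
move=> oO sF; elim: r => [|i r IH].
  apply: (smooth_on_eq (f := fun=> 0) oO); last exact: smooth_on_cst.
  by move=> x _; rewrite big_nil.
case Pi : (P i).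
  apply: (smooth_on_eq (f := fun x => F i x + \sum_(j <- r | P j) F j x) oO).
    by move=> x _; rewrite big_cons Pi.
  exact: smooth_onD oO (sF i Pi) IH.
apply: (smooth_on_eq (f := fun x => \sum_(j <- r | P j) F j x) oO); last exact: IH.
by move=> x _; rewrite big_cons Pi.
Qed.

Lemma smooth_on_prod O (I : Type) (r : seq I) (P : pred I) (F : I -> 'rV[R]_n -> R) :
  open O -> (forall i, P i -> smooth_on O (F i)) ->
  smooth_on O (fun x => \prod_(i <- r | P i) F i x).
Proof.
move=> oO sF; elim: r => [|i r IH].
  apply: (smooth_on_eq (f := fun=> 1) oO); last exact: smooth_on_cst.
  by move=> x _; rewrite big_nil.
case Pi : (P i).
  apply: (smooth_on_eq (f := fun x => F i x * \prod_(j <- r | P j) F j x) oO).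
    by move=> x _; rewrite big_cons Pi.
  exact: smooth_onM oO (sF i Pi) IH.
apply: (smooth_on_eq (f := fun x => \prod_(j <- r | P j) F j x) oO); last exact: IH.
by move=> x _; rewrite big_cons Pi.
Qed.

Lemma is_derive_coord x v (j : 'I_n) :
  is_derive x v (fun y : 'rV[R]_n => y 0 j) (v 0 j).
Proof.
pose L y : R := y 0 j.
have Llin : linear L by move=> a h k; rewrite /L !mxE.
pose LL : {linear 'rV[R]_n -> R} := HB.pack L (GRing.isLinear.Build _ _ _ _ L Llin).
have dL : differentiable (LL : 'rV[R]_n -> R) x.
  by apply: linear_differentiable; exact: coord_continuous.
split; first exact: (diff_derivable (f := (LL : 'rV[R]_n -> R))).
rewrite -[LHS]/('D_v (LL : 'rV[R]_n -> R) x) deriveE// diff_lin//.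
exact: coord_continuous.
Qed.

Lemma smooth_on_coord O j : open O -> smooth_on O (fun x : 'rV[R]_n => x 0 j).
Proof.
move=> oO; apply: (smooth_on_coind (P := fun f => (f = fun x => x 0 j) \/
  exists a, f = cst a) oO); last by left.
move=> f [->|[a ->]]; split.
- by move=> x _; exact: coord_continuous.
- move=> i; split => [x _|].
    by have [] := is_derive_coord x (e_ i) j.
  exists (cst ((e_ i) 0 j)); first by right; exists ((e_ i) 0 j).
  by move=> x _; have [_ ->] := is_derive_coord x (e_ i) j.
- by move=> x _; exact: cst_continuous.
- move=> i; split => [x _|]; first exact: derivable_cst.
  exists (cst 0); first by right; exists 0.
  by move=> x _; rewrite derive_cst.
Qed.

Lemma smooth_on_differentiable O f x : open O -> smooth_on O f -> O x ->
  differentiable f x /\ forall h, 'd f x h = \sum_i h 0 i * 'D_(e_ i) f x.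
Proof.
move=> oO sf Ox; apply: C1_differentiable => i.
  near=> y; apply: (smooth_on_derivable (i := i) sf).
  by near: y; exact: open_nbhs_nbhs.
by apply: (smooth_on_continuous (smooth_on_derive i sf)).
Unshelve. all: by end_near. Qed.

Lemma smooth_onV O f : open O -> smooth_on O f -> (forall x, O x -> f x != 0) ->
  smooth_on O (fun x => (f x)^-1).
Proof.
move=> oO sf f0.
(* The quotients of smooth functions [g] by powers of [f] are closed under partial derivatives, by
   the quotient rule [H]. *)
pose P q := exists g k, smooth_on O g /\ q = fun x => g x * (f x)^-1 ^+ k.
apply: (smooth_on_eq (f := fun x => 1 * (f x)^-1 ^+ 1) oO).
  by move=> y _; rewrite mul1r expr1.
apply: (smooth_on_coind (P := P) oO); last first.
  by exists (fun=> 1), 1%N; split; [exact: smooth_on_cst|].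
move=> _ [g [k [sg ->]]].
have H x i : O x -> is_derive x (e_ i) (fun x => g x * (f x)^-1 ^+ k)
  (('D_(e_ i) g x * f x - k%:R * g x * 'D_(e_ i) f x) * (f x)^-1 ^+ k.+1).
  move=> Ox; have dg := derivableP (smooth_on_derivable (i := i) sg Ox).
  have df := derivableP (smooth_on_derivable (i := i) sf Ox).
  pose V := (fun x => (f x)^-1) : 'rV[R]_n -> R.
  have dV : is_derive x (e_ i) V (- (f x) ^- 2 *: 'D_(e_ i) f x).
    split; first by apply: derivableV; [exact: f0 | exact: smooth_on_derivable sf Ox].
    by rewrite /V deriveV ?f0//; exact: smooth_on_derivable sf Ox.
  have -> : (fun x => g x * (f x)^-1 ^+ k) = g * V ^+ k.
    by apply/funext => y; rewrite /V !fctE.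
  apply: is_derive_eq.
  rewrite exprfctE /V.
  have fx := f0 _ Ox.
  have scE (a b : R) : a *: b = a * b by [].
  rewrite !scE; case: k => [|k]; first by rewrite expr0 expr1 mulrBl mulfK//; ring.
  by rewrite /= !exprVn !exprS; field; rewrite expf_neq0// fx.
split.
  move=> x Ox; have cg := smooth_on_continuous sg Ox.
  have cf := smooth_on_continuous sf Ox.
  have cV : {for x, continuous (fun y => (f y)^-1)} by exact: (cvgV (f0 _ Ox) cf).
  have cVk : {for x, continuous (fun x => (f x)^-1 ^+ k)}.
    elim: (k) => [|k' IH].
      have -> : (fun y : 'rV[R]_n => (f y)^-1 ^+ 0) = cst 1.
        by apply/funext => y; rewrite expr0.
      exact: cst_continuous.
    have -> : (fun y => (f y)^-1 ^+ k'.+1) = (fun y => (f y)^-1 * (f y)^-1 ^+ k').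
      by apply/funext => y; rewrite exprS.
    exact: (cvgM cV IH).
  exact: cvgM cg cVk.
move=> i; split => [x Ox|].
  by have [] := H x i Ox.
exists (fun x => ('D_(e_ i) g x * f x - k%:R * g x * 'D_(e_ i) f x) * (f x)^-1 ^+ k.+1).
  exists (fun x => 'D_(e_ i) g x * f x - k%:R * g x * 'D_(e_ i) f x), k.+1; split; last by [].
  apply: (smooth_onB oO (smooth_onM oO (smooth_on_derive i sg) sf)).
  apply: (smooth_onM oO _ (smooth_on_derive i sf)).
  by apply: smooth_onM oO _ sg; exact: smooth_on_cst.
by move=> x Ox; have [_ ->] := H x i Ox.
Qed.

End SmoothOn.

(** * Chain rule and composition of smooth maps *)

Section Composition.
Context {R : realType} {n m : nat}.
Local Notation e_ i := (delta_mx 0 i : 'rV[R]_n).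
Local Notation d_ j := (delta_mx 0 j : 'rV[R]_m).
Implicit Types (x y : 'rV[R]_n) (Phi : 'rV[R]_m -> R) (u : 'rV[R]_n -> 'rV[R]_m)
  (O : set 'rV[R]_n).

(** The map [u] is only derivable in the direction [v], so the chain rule for differentials is
    applied to its restriction [g] to a line, where derivability gives differentiability. *)
Lemma is_derive_comp (O' : set 'rV[R]_m) Phi u x v : open O' -> smooth_on O' Phi -> O' (u x) ->
  (forall j, derivable (fun y => u y 0 j) x v) ->
  is_derive x v (Phi \o u)
    (\sum_j 'D_v (fun y => u y 0 j) x * 'D_(d_ j) Phi (u x)).
Proof.
move=> oO' sPhi Oux du.
have dux : derivable u x v by apply/derivable_mxP => i j; rewrite ord1; exact: du.
pose g (t : R) := u (t *: v + x).
have g0 : g 0 = u x by rewrite /g scale0r add0r.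
have dg1 : derivable g 0 1 := (derivable1P u x v).1 dux.
have dg : differentiable g 0 := (derivable1_diffP g 0).1 dg1.
have [dP dPE] := smooth_on_differentiable oO' sPhi Oux.
have dPg : differentiable Phi (g 0) by rewrite g0.
have dc := differentiable_comp dg dPg.
split; first by apply/derivable1P; apply/derivable1_diffP.
have lineE (W : normedModType R) (f : 'rV[R]_n -> W) :
    'D_v f x = 'D_1 (fun t : R => f (t *: v + x)) 0.
  rewrite /derive; set a := (X in lim (X @ _) = _); set b := (X in _ = lim (X @ _)).
  suff -> : a = b by [].
  by apply/funext => h; rewrite /a /b /= addr0 scale0r add0r [h *: 1]mulr1.
have -> : 'D_v (Phi \o u) x = 'D_1 (Phi \o g) 0 := lineE R (Phi \o u).
have gE : 'D_1 g 0 = 'D_v u x := esym (lineE _ u).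
rewrite (deriveE _ dc) (diff_comp dg dPg) /= -(deriveE _ dg) gE (derive_mx dux) g0 dPE.
by apply: eq_bigr => j _; rewrite mxE.
Qed.

Section SmoothComp.
Variables (O : set 'rV[R]_n) (O' : set 'rV[R]_m) (u : 'rV[R]_n -> 'rV[R]_m).
Hypotheses (oO : open O) (oO' : open O') (uO : forall x, O x -> O' (u x)).
Hypothesis su : forall j, smooth_on O (fun x => u x 0 j).

(* The smallest class containing the products of [Phi \o u] by a smooth function
   and closed under sums is also closed under partial derivatives. *)
Inductive comp_class : ('rV[R]_n -> R) -> Prop :=
| CompBase Phi g of smooth_on O' Phi & smooth_on O g :
    comp_class (fun x => Phi (u x) * g x)
| CompAdd a b of comp_class a & comp_class b : comp_class (fun x => a x + b x).

Lemma comp_class_sum (I : Type) (r : seq I) (F : I -> 'rV[R]_n -> R) :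
  (forall i, comp_class (F i)) -> comp_class (fun x => \sum_(i <- r) F i x).
Proof.
move=> CF; elim: r => [|i r IH].
  rewrite (_ : (fun _ => _) = fun x => cst 0 (u x) * cst 0 x).
    by apply: CompBase; exact: smooth_on_cst.
  by apply/funext => x; rewrite big_nil /cst mul0r.
rewrite (_ : (fun _ => _) = fun x => F i x + \sum_(i <- r) F i x).
  by apply: CompAdd.
by apply/funext => x; rewrite big_cons.
Qed.

Lemma smooth_on_continuous_comp x : O x -> {for x, continuous u}.
Proof.
move=> Ox; apply/(@cvgrPdist_le _ _ _ (nbhs x)) => e e0.
have H j : \forall y \near x, `|u x 0 j - u y 0 j| <= e.
  have /cvgrPdist_le := smooth_on_continuous (su j) Ox.
  by apply.
have := filter_forall (nbhs_filter x) H.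
apply: filterS => y K; apply: rV_norm_le; first exact: ltW.
by move=> j; rewrite !mxE; exact: K.
Qed.

Lemma smooth_on_comp Phi : smooth_on O' Phi -> smooth_on O (Phi \o u).
Proof.
move=> sPhi; apply: (smooth_on_eq (f := fun x => Phi (u x) * cst 1 x) oO).
  by move=> x _; rewrite /cst mulr1.
apply: (smooth_on_coind (P := comp_class) oO); last first.
  by apply: CompBase sPhi _; exact: smooth_on_cst.
move=> f; elim=> [{}Phi g {}sPhi sg|a b _ [ca da] _ [cb db]].
  split=> [x Ox|i].
    have cu := smooth_on_continuous_comp Ox.
    have cP := smooth_on_continuous sPhi (uO Ox).
    have cPu : {for x, continuous (Phi \o u)} by exact: continuous_comp.
    exact: cvgM cPu (smooth_on_continuous sg Ox).
  pose dF x := \sum_j 'D_(d_ j) Phi (u x) * ('D_(e_ i) (fun y => u y 0 j) x * g x)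
    + Phi (u x) * 'D_(e_ i) g x.
  have H x : O x -> is_derive x (e_ i) (fun x => Phi (u x) * g x) (dF x).
    move=> Ox; have dP := is_derive_comp oO' sPhi (uO Ox)
      (fun j => smooth_on_derivable (i := i) (su j) Ox).
    have dg := derivableP (smooth_on_derivable (i := i) sg Ox).
    have := is_deriveM dP dg; move/is_derive_eq; apply; rewrite /dF addrC.
    congr (_ + _); rewrite -[LHS]/(g x * _) mulr_sumr; apply: eq_bigr => j _.
    by rewrite mulrC mulrAC mulrC.
  split=> [x Ox|]; first by have [] := H x Ox.
  exists dF; last by move=> x /H[_ ->].
  apply: CompAdd; last first.
    exact: CompBase sPhi (smooth_on_derive i sg).
  apply: comp_class_sum => j.
  apply: (CompBase (smooth_on_derive j sPhi)
    (g := fun x => 'D_(e_ i) (fun y => u y 0 j) x * g x)).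
  exact: smooth_onM oO (smooth_on_derive i (su j)) sg.
split=> [x Ox|i]; first exact: cvgD (ca x Ox) (cb x Ox).
have [da1 [ga Pga gaE]] := da i; have [db1 [gb Pgb gbE]] := db i.
split=> [x Ox|]; first exact: (derivableD (da1 x Ox) (db1 x Ox)).
exists (fun x => ga x + gb x); first exact: CompAdd.
by move=> x Ox; rewrite gaE// gbE// -deriveD//; [exact: da1|exact: db1].
Qed.

End SmoothComp.
End Composition.

(** * Bounds on all derivatives up to a given order *)

Section DerivativeBounds.
Context {R : realType}.

Definition pbound n k (E : set 'rV[R]_n) f (a : R) :=
  forall s, (size s <= k)%N -> forall x, E x -> `|pderiv f s x| <= a.

Section Basic.
Context {n : nat}.
Local Notation e_ i := (delta_mx 0 i : 'rV[R]_n).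
Implicit Types (x y : 'rV[R]_n) (f g : 'rV[R]_n -> R) (E O : set 'rV[R]_n).

Lemma pboundS k E f a :
  (forall x, E x -> `|f x| <= a) -> (forall i, pbound k E ('D_(e_ i) f) a) ->
  pbound k.+1 E f a.
Proof. by move=> f0 fS [_|i s ks] x Ex; [exact: f0 | exact: fS]. Qed.

Lemma pbound_derive k E f a i : pbound k.+1 E f a -> pbound k E ('D_(e_ i) f) a.
Proof. by move=> fk s ks; exact: (fk (i :: s)). Qed.

Lemma pboundW k l E f a b : (l <= k)%N -> a <= b -> pbound k E f a -> pbound l E f b.
Proof.
move=> lk ab fk s sl x Ex; apply: le_trans ab; apply: fk => //.
exact: leq_trans sl lk.
Qed.

Lemma pbound_sub k E E' f a : E' `<=` E -> pbound k E f a -> pbound k E' f a.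
Proof. by move=> EE fk s sk x /EE; exact: fk. Qed.

Lemma eq_pbound O k E f g a : open O -> E `<=` O -> (forall x, O x -> f x = g x) ->
  pbound k E f a -> pbound k E g a.
Proof.
move=> oO EO fg fk s sk x Ex; rewrite -(eq_pderiv s oO fg (EO _ Ex)).
exact: fk.
Qed.

Lemma pboundD O k E f g a b : open O -> E `<=` O ->
  smooth_on O f -> smooth_on O g ->
  pbound k E f a -> pbound k E g b -> pbound k E (fun x => f x + g x) (a + b).
Proof.
move=> oO EO; elim: k f g => [|k IH] f g sf sg fa gb.
  move=> [|//] _ x Ex; apply: le_trans (ler_normD _ _) _.
  by apply: lerD; [exact: (fa [::]) | exact: (gb [::])].
apply: pboundS => [x Ex|i].
  apply: le_trans (ler_normD _ _) _.
  by apply: lerD; [exact: (fa [::]) | exact: (gb [::])].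
apply: (eq_pbound (f := fun x => 'D_(e_ i) f x + 'D_(e_ i) g x) oO EO).
  move=> x Ox; rewrite -(@deriveD _ _ _ f g)//.
    exact: smooth_on_derivable sf Ox.
  exact: smooth_on_derivable sg Ox.
apply: (IH _ _ (smooth_on_derive i sf) (smooth_on_derive i sg)).
  exact: pbound_derive.
exact: pbound_derive.
Qed.

Lemma pbound_sum O k E (I : Type) (r : seq I) (F : I -> 'rV[R]_n -> R) a :
  open O -> E `<=` O -> 0 <= a -> (forall i, smooth_on O (F i)) ->
  (forall i, pbound k E (F i) a) ->
  pbound k E (fun x => \sum_(i <- r) F i x) ((size r)%:R * a).
Proof.
move=> oO EO a0 sF Fa; elim: r => [|i r IH].
  rewrite (_ : (fun x => _) = cst 0); last by apply/funext => x; rewrite big_nil.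
  move=> s _ x Ex; rewrite mul0r.
  have E0 y : cst 0 y = 0 * cst 0 y :> R by rewrite mul0r.
  rewrite (eq_pderiv (g := fun y : 'rV[R]_n => 0 * cst 0 y) s oO (fun y _ => E0 y) (EO _ Ex)).
  by rewrite (pderivZ 0 s oO (@smooth_on_cst _ _ O 0) (EO _ Ex)) mul0r normr0.
rewrite (_ : (fun x => _) = fun x => F i x + \sum_(i <- r) F i x); last first.
  by apply/funext => x; rewrite big_cons.
rewrite /= -natr1 mulrDl mul1r addrC.
by apply: (pboundD oO EO (sF i) _ (Fa i) IH); apply: smooth_on_sum.
Qed.

Lemma pboundM O k E f g a b : open O -> E `<=` O -> 0 <= a -> 0 <= b ->
  smooth_on O f -> smooth_on O g ->
  pbound k E f a -> pbound k E g b -> pbound k E (fun x => f x * g x) (2 ^+ k * a * b).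
Proof.
move=> oO EO a0 b0; elim: k f g => [|k IH] f g sf sg fa gb.
  move=> [|//] _ x Ex; rewrite expr0 mul1r /= normrM.
  by apply: ler_pM => //; [exact: (fa [::]) | exact: (gb [::])].
apply: pboundS => [x Ex|i].
  rewrite normrM -mulrA; apply: (@le_trans _ _ (a * b)).
    by apply: ler_pM => //; [exact: (fa [::]) | exact: (gb [::])].
  by rewrite ler_peMl ?mulr_ge0// exprn_ege1// ler1n.
apply: (eq_pbound (f := fun x => f x * 'D_(e_ i) g x + g x * 'D_(e_ i) f x) oO EO).
  move=> x Ox; have df := smooth_on_derivable (i := i) sf Ox.
  have dg := smooth_on_derivable (i := i) sg Ox.
  exact: esym (deriveM df dg).
have -> : 2 ^+ k.+1 * a * b = 2 ^+ k * a * b + 2 ^+ k * b * a.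
  by rewrite exprS; ring.
have fak := pboundW (leqnSn k) (lexx a) fa.
have gbk := pboundW (leqnSn k) (lexx b) gb.
have sg' := smooth_on_derive i sg; have sf' := smooth_on_derive i sf.
apply: (pboundD oO EO); [exact: smooth_onM oO sf sg'|exact: smooth_onM oO sg sf'| |].
- exact: IH _ _ sf sg' fak (pbound_derive i gb).
have H := IH _ _ sf' sg (pbound_derive i fa) gbk.
rewrite mulrAC; apply: (eq_pbound oO EO _ H) => x _; exact: mulrC.
Qed.

End Basic.

(** The chain rule writes a first derivative of [Phi \o u] as a sum of [m] products, handled by
    [pboundM] and induction. The constant depends on [u] only through [A], and the estimate is
    linear in [e]: if [Phi] is small in C^k, so is [Phi \o u]. *)
Lemma pbound_comp n m k (A : R) : 0 <= A -> exists2 C, 0 <= C &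
  forall (O E : set 'rV[R]_n) (O' : set 'rV[R]_m) (u : 'rV[R]_n -> 'rV[R]_m) Phi e,
  open O -> open O' -> E `<=` O -> (forall x, O x -> O' (u x)) ->
  (forall j, smooth_on O (fun x => u x 0 j)) -> smooth_on O' Phi -> 0 <= e ->
  (forall j, pbound k E (fun x => u x 0 j) A) -> pbound k (u @` E) Phi e ->
  pbound k E (Phi \o u) (C * e).
Proof.
move=> A0; elim: k => [|k [C C0 IH]].
  exists 1 => // O E O' u Phi e oO oO' EO uO su sP e0 uA Pe [|//] _ x Ex.
  by rewrite mul1r; apply: (Pe [::]) => //; exists x.
exists (1 + m%:R * (2 ^+ k * (C * A))).
  by rewrite addr_ge0// !mulr_ge0// exprn_ge0.
move=> O E O' u Phi e oO oO' EO uO su sP e0 uA Pe.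
have T0 : 0 <= m%:R * (2 ^+ k * (C * A)) by rewrite !mulr_ge0// exprn_ge0.
apply: pboundS => [x Ex|i].
  apply: (@le_trans _ _ e); first by apply: (Pe [::]) => //; exists x.
  by rewrite mulrDl mul1r lerDl mulr_ge0.
apply: (eq_pbound (f := fun x => \sum_j
   'D_(delta_mx 0 i) (fun y => u y 0 j) x * 'D_(delta_mx 0 j) Phi (u x)) oO EO).
  move=> x Ox; have [_ ->//] := is_derive_comp oO' sP (uO x Ox)
    (fun j => smooth_on_derivable (i := i) (su j) Ox).
have sD j := smooth_on_derive i (su j).
have sPD (j : 'I_m) : smooth_on O ('D_(delta_mx 0 j) Phi \o u).
  exact: (smooth_on_comp oO oO' uO su (smooth_on_derive j sP)).
apply: (@pboundW _ k k _ _ ((size (index_enum 'I_m))%:R * (2 ^+ k * A * (C * e)))) => //.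
  rewrite -[index_enum _]enumT size_enum_ord mulrDl mul1r ler_wpDl// le_eqVlt; apply/orP; left; apply/eqP; ring.
apply: (@pbound_sum _ O _ _ _ _ (fun j x => 'D_(delta_mx 0 i) (fun y => u y 0 j) x *
  'D_(delta_mx 0 j) Phi (u x)) _ oO EO).
- by rewrite !mulr_ge0// exprn_ge0.
- by move=> j; exact: smooth_onM oO (sD j) (sPD j).
move=> j; apply: (pboundM oO EO A0 (mulr_ge0 C0 e0) (sD j) (sPD j)).
- exact: pbound_derive.
- apply: (IH _ _ _ _ _ _ oO oO' EO uO su (smooth_on_derive j sP)) => //.
    by move=> l; apply: pboundW (uA l).
  exact: pbound_derive.
Qed.

Lemma pbound_exists n (O E : set 'rV[R]_n) k f : E `<=` O -> compact E ->
  smooth_on O f -> exists2 a, 0 <= a & pbound k E f a.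
Proof.
move=> EO cE; elim: k f => [|k IH] f sf.
  have cf : {within E, continuous f}.
    apply: continuous_in_subspaceT => x /set_mem Ex.
    exact: smooth_on_continuous sf (EO _ Ex).
  have /compact_bounded[M [_ MF]] := continuous_compact cf cE.
  exists (`|M| + 1) => [|[|//] _ x Ex]; first by rewrite addr_ge0.
  apply: (MF (`|M| + 1)); last by exists x.
  by rewrite (le_lt_trans (ler_norm M))// ltrDl.
have [a0 a0_ge0 fa0] := IH f sf.
have /choice[a Ha] : forall i, exists a, 0 <= a /\ pbound k E ('D_(delta_mx 0 i) f) a.
  by move=> i; have [a ? ?] := IH _ (smooth_on_derive i sf); exists a.
have s0 : 0 <= \sum_i a i by apply: sumr_ge0 => i _; have [] := Ha i.
exists (a0 + \sum_i a i); first by rewrite addr_ge0.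
apply: pboundS => [x Ex|i].
  apply: (@le_trans _ _ a0); first exact: (fa0 [::]).
  by rewrite lerDl.
apply: pboundW (leqnn k) _ (Ha i).2.
rewrite (bigD1 i)//= addrCA lerDl addr_ge0// sumr_ge0// => j _.
by have [] := Ha j.
Qed.

End DerivativeBounds.

(** * Flat functions and bumps *)

Section Flat.
Context {R : realType}.
Implicit Types (p q : {poly R}) (t y h : R).

Lemma horner_le_expR q : exists2 C : R, 0 <= C &
  forall y, 0 <= y -> `|q.[y]| <= C * expR y.
Proof.
(* Each monomial satisfies y^i <= i! e^y for y >= 0, by the exponential series. *)
exists (\sum_(i < size q) `|q`_i| * i`!%:R) => [|y y0].
  by apply: sumr_ge0 => i _; rewrite mulr_ge0.
rewrite horner_coef; apply: le_trans (ler_norm_sum _ _ _) _.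
rewrite mulr_suml; apply: ler_sum => -[i /= _] _.
rewrite normrM -mulrA ler_wpM2l// ger0_norm ?exprn_ge0//.
case: i => [|i]; first by rewrite expr0 fact0 mul1r -expR0 ler_expR.
have f0 : 0 < (i.+1)`!%:R :> R by rewrite ltr0n fact_gt0.
rewrite mulrC -ler_pdivrMr//; apply: le_trans (expR_ge1Dxn i y0).
by rewrite lerDr.
Qed.

Definition flat_poly p t : R := if 0 < t then p.[t^-1] * expR (- t^-1) else 0.

(** With [y = t^-1], the exponential beats the polynomial [p * 'X^2]. The factor [t ^+ 2] makes the
    difference quotient at 0 tend to 0. *)
Lemma flat_poly_le p : exists2 C : R, 0 <= C &
  forall t, `|flat_poly p t| <= C * t ^+ 2.
Proof.
have [C C0 HC] := horner_le_expR (p * 'X^2).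
exists C => // t; rewrite /flat_poly; case: ifPn => [t0|_]; last first.
  by rewrite normr0 mulr_ge0// sqr_ge0.
have y0 : 0 < t^-1 by rewrite invr_gt0.
have := HC _ (ltW y0); rewrite hornerM hornerXn normrM (ger0_norm (sqr_ge0 t^-1)) => H.
rewrite normrM (ger0_norm (expR_ge0 _)) expRN ler_pdivrMr ?expR_gt0//.
rewrite mulrAC -ler_pdivrMr ?exprn_gt0//; by rewrite -exprVn.
Qed.

Lemma is_derive_flat_poly p t :
  is_derive t 1 (flat_poly p) (flat_poly ((p - p^`()) * 'X^2) t).
Proof.
have [t0|t0|->] := ltgtP t 0.
- have E : {near t, cst 0 =1 flat_poly p}.
    near=> s; rewrite /flat_poly; case: ifPn => // s0; exfalso.
    have : s < 0 by near: s; exact: lt_nbhsl.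
    by rewrite ltNge ltW.
  apply: (@near_eq_is_derive _ R R (cst 0) (flat_poly p) t 1 _ E).
  rewrite /flat_poly ltNge ltW//=.
  exact: is_derive_cst.
- have E : {near t, (fun s => p.[s^-1] * expR (- s^-1)) =1 flat_poly p}.
    near=> s; rewrite /flat_poly ifT//.
    by near: s; exact: lt_nbhsr.
  apply: (@near_eq_is_derive _ R R _ (flat_poly p) t 1 _ E); rewrite /flat_poly t0.
  have dV : is_derive t 1 (fun s => s^-1) (- t ^- 2).
    have := is_deriveV (lt0r_neq0 t0) (is_derive_id t 1).
    by move/is_derive_eq; apply; rewrite /= -[_ *: _]/(_ * _) mulr1.
  have dN : is_derive t 1 (fun s => - s^-1) (t ^- 2).
    by have := is_deriveN dV; move/is_derive_eq; apply; rewrite opprK.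
  have d1 := @is_derive1_comp _ _ (fun s => s^-1) _ _ _ (is_derive_poly p t^-1) dV.
  have d2 := @is_derive1_comp _ _ (fun s => - s^-1) _ _ _ (is_derive_expR (- t^-1)) dN.
  have := is_deriveM d1 d2; move/is_derive_eq; apply.
  have scE (a b : R) : a *: b = a * b by [].
  rewrite !scE /= hornerM hornerXn hornerD hornerN -exprVn; ring.
have [C C0 HC] := flat_poly_le p.
have L : (fun h => h^-1 *: ((flat_poly p \o shift 0) (h *: 1) - flat_poly p 0)) @ 0^' --> (0 : R).
  have C1 : 0 < C + 1 by rewrite ltr_wpDl.
  apply/cvgrPdist_le => e e0; have eC : 0 < e / (C + 1) by rewrite divr_gt0.
  near=> h.
  have h0 : h != 0 by near: h; exact: nbhs_dnbhs_neq.
  rewrite sub0r normrN /= addr0 [h *: 1]mulr1 {2}/flat_poly ltxx subr0.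
  rewrite -[_ *: _]/(_ * _) normrM normfV mulrC ler_pdivrMr ?normr_gt0//.
  apply: le_trans (HC h) _; rewrite -real_normK ?num_real// expr2 mulrA ler_wpM2r//.
  apply: (@le_trans _ _ ((C + 1) * `|h|)); first by rewrite ler_wpM2r// lerDl.
  rewrite mulrC -ler_pdivlMr//; near: h; exact: dnbhs0_le.
rewrite {2}/flat_poly ltxx.
by split; [apply/cvg_ex; exists 0; exact: L | exact: (cvg_lim _ L)].
Unshelve. all: by end_near. Qed.

Definition flat t : R := flat_poly 1 t.

Lemma flat_gt0 t : 0 < t -> 0 < flat t.
Proof. by move=> t0; rewrite /flat /flat_poly t0 hornerC mul1r expR_gt0. Qed.

Lemma flat_eq0 t : t <= 0 -> flat t = 0.
Proof. by rewrite /flat /flat_poly leNgt => /negPf ->. Qed.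

Lemma flat_ge0 t : 0 <= flat t.
Proof. by have [/flat_eq0 ->|/flat_gt0/ltW] := leP t 0. Qed.

Lemma smooth_flat1 : smooth_on setT (fun x : 'rV[R]_1 => flat (x 0 0)).
Proof.
have H p (x : 'rV[R]_1) : is_derive x (delta_mx 0 0) (fun x : 'rV[R]_1 => flat_poly p (x 0 0))
   (flat_poly ((p - p^`()) * 'X^2) (x 0 0)).
  have [df dE] := is_derive_flat_poly p (x 0 0).
  have Q : (fun h => h^-1 *: (((fun x : 'rV[R]_1 => flat_poly p (x 0 0)) \o shift x)
      (h *: delta_mx 0 0) - flat_poly p (x 0 0))) =
     (fun h => h^-1 *: ((flat_poly p \o shift (x 0 0)) (h *: 1) - flat_poly p (x 0 0))).
    by apply/funext => h; rewrite /= !mxE !eqxx mulr1 [h *: 1]mulr1.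
  by split; [rewrite /derivable Q | rewrite /derive Q].
apply: (smooth_on_coind (P := fun f => exists p, f = fun x : 'rV[R]_1 => flat_poly p (x 0 0)) openT).
  move=> _ [p ->]; split=> [x _|i].
    have c1 : {for x 0 0, continuous (flat_poly p)}.
      apply/differentiable_continuous/derivable1_diffP.
      by have [] := is_derive_flat_poly p (x 0 0).
    apply: (@continuous_comp _ _ _ (fun x : 'rV[R]_1 => x 0 0) (flat_poly p)) => //.
    exact: coord_continuous.
  rewrite ord1; split=> [x _|]; first by have [] := H p x.
  exists (fun x : 'rV[R]_1 => flat_poly ((p - p^`()) * 'X^2) (x 0 0)).
    by exists ((p - p^`()) * 'X^2).
  by move=> x _; have [_ ->] := H p x.
by exists 1.
Qed.

Lemma smooth_on_flat n (O : set 'rV[R]_n) f : open O -> smooth_on O f ->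
  smooth_on O (fun x => flat (f x)).
Proof.
move=> oO sf; pose u x : 'rV[R]_1 := \row_(j < 1) f x.
have su j : smooth_on O (fun x => u x 0 j).
  by apply: (smooth_on_eq oO _ sf) => x _; rewrite mxE.
have H := smooth_on_comp (u := u) oO openT (fun _ _ => I) su smooth_flat1.
by apply: (smooth_on_eq oO _ H) => x _; rewrite /= mxE.
Qed.

(** The norm of row vectors is the sup norm, so for [r > 0] this product is positive exactly on the
    open ball of radius [r] about [a]. *)
Definition cube_bump n (a : 'rV[R]_n) (r : R) (x : 'rV[R]_n) : R :=
  \prod_i flat (r ^+ 2 - (x 0 i - a 0 i) ^+ 2).

Lemma cube_bump_ge0 n (a : 'rV[R]_n) r x : 0 <= cube_bump a r x.
Proof. by apply: prodr_ge0 => i _; exact: flat_ge0. Qed.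

Lemma cube_bump_gt0 n (a : 'rV[R]_n) r x : `|x - a| < r -> 0 < cube_bump a r x.
Proof.
move=> xar; apply: prodr_gt0 => i _; apply: flat_gt0.
have r0 : 0 < r by exact: le_lt_trans xar.
rewrite subr_gt0 -real_normK ?num_real// ltr_pXn2r ?nnegrE// ?ltW//.
by apply: le_lt_trans xar; have := rV_coord_le (x - a) i; rewrite !mxE.
Qed.

Lemma cube_bump_eq0 n (a : 'rV[R]_n) r x : 0 < r -> r <= `|x - a| -> cube_bump a r x = 0.
Proof.
move=> r0 rxa; apply/eqP/negPn; apply/negP => b0.
have : `|x - a| < r; last by rewrite ltNge rxa.
apply: (rV_norm_lt r0) => i; rewrite ltNge; apply/negP => xai.
move: b0; rewrite /cube_bump (bigD1 i)//= flat_eq0 ?mul0r ?eqxx//.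
move: xai; rewrite !mxE => xai.
rewrite subr_le0 -[X in _ <= X]real_normK ?num_real//.
by apply: lerXn2r => //; rewrite nnegrE ?ltW.
Qed.

Lemma smooth_cube_bump n (a : 'rV[R]_n) r : smooth_on setT (cube_bump a r).
Proof.
apply: (smooth_on_prod (index_enum 'I_n) (P := xpredT)
  (F := fun i x => flat (r ^+ 2 - (x 0 i - a 0 i) ^+ 2)) openT) => i _.
apply: (smooth_on_flat openT (smooth_onB openT (smooth_on_cst _) _)).
have sx : smooth_on setT (fun x : 'rV[R]_n => x 0 i - a 0 i).
  exact: (smooth_onB openT (smooth_on_coord i openT) (smooth_on_cst _)).
apply: (smooth_on_eq openT _ (smooth_onM openT sx sx)) => x _.
by rewrite expr2.
Qed.

End Flat.

(** * Inverse function theorem *)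

Section InverseFunction.
Context {R : realType}.

Lemma rV_cball_compact n (a : 'rV[R]_n) r : compact [set x | `|a - x| <= r].
Proof.
have cl : closed [set x | `|a - x| <= r].
  have cf : continuous (fun x : 'rV[R]_n => `|a - x|).
    move=> x; apply: (@cvg_norm _ _ _ (nbhs x)).
    by apply: (@cvgB _ _ _ (nbhs x)); [exact: cst_continuous | exact: cvg_id].
  exact: ((continuous_closedP _).1 cf _ (@closed_le _ r)).
apply: bounded_closed_compact cl; exists (`|a| + r); split; first exact: num_real.
move=> M HM x /= xr; apply: le_trans (ltW HM).
have -> : x = a - (a - x) by rewrite opprB addrC subrK.
by apply: le_trans (ler_normB _ _) _; rewrite lerD2l.
Qed.

Lemma smooth_MVT n (O : set 'rV[R]_n) f x v : open O -> smooth_on O f ->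
  (forall t : R, 0 <= t <= 1 -> O (x + t *: v)) ->
  exists2 c, 0 <= c <= 1 &
    f (x + v) - f x = \sum_i v 0 i * 'D_(delta_mx 0 i) f (x + c *: v).
Proof.
move=> oO sf Oxv; have [t t01|c c01 cE] := @MVT_line R _ f x v.
  have [df _] := smooth_on_differentiable oO sf (Oxv t t01).
  exact: diff_derivable.
exists c => //; rewrite cE.
have [df dE] := smooth_on_differentiable oO sf (Oxv c c01).
by rewrite deriveE.
Qed.

Lemma smooth_on_det n (O : set 'rV[R]_n) k (A : 'rV[R]_n -> 'M[R]_k) : open O ->
  (forall i j, smooth_on O (fun x => A x i j)) -> smooth_on O (fun x => \det (A x)).
Proof.
move=> oO sA; rewrite /determinant.
apply: (smooth_on_sum (index_enum _) (P := xpredT)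
  (F := fun (s : 'S_k) x => (-1) ^+ s * \prod_i A x i (s i)) oO) => s _.
apply: (smooth_onM oO (smooth_on_cst _)).
by apply: (smooth_on_prod (index_enum _) (P := xpredT) (F := fun i x => A x i (s i)) oO).
Qed.

Lemma smooth_on_adj n (O : set 'rV[R]_n) k (A : 'rV[R]_n -> 'M[R]_k) i j : open O ->
  (forall i j, smooth_on O (fun x => A x i j)) -> smooth_on O (fun x => (\adj (A x)) i j).
Proof.
move=> oO sA.
apply: (smooth_on_eq (f := fun x => (-1) ^+ (j + i) * \det (row' j (col' i (A x)))) oO).
  by move=> x _; rewrite mxE.
apply: (smooth_onM oO (smooth_on_cst _)); apply: (smooth_on_det oO) => i' j'.
by apply: (smooth_on_eq oO _ (sA (lift j i') (lift i j'))) => x _; rewrite !mxE.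
Qed.

Lemma mulmx_rV_norm_le n m (A : 'M[R]_(n, m)) : exists2 K : R, 0 <= K &
  forall v : 'rV[R]_n, `|v *m A| <= K * `|v|.
Proof.
pose K : R := \sum_i \sum_j `|A i j|.
have K0 : 0 <= K by apply: sumr_ge0 => i _; apply: sumr_ge0.
exists K => // v; apply: rV_norm_le => [|j]; first by rewrite mulr_ge0.
rewrite mxE; apply: le_trans (ler_norm_sum _ _ _) _.
rewrite mulr_suml; apply: ler_sum => i _; rewrite normrM mulrC ler_pM ?rV_coord_le//.
by rewrite (bigD1 j)//= lerDl sumr_ge0.
Qed.

Section Local.
Variables (n : nat) (O : set 'rV[R]_n) (w : 'rV[R]_n -> 'rV[R]_n) (y0 : 'rV[R]_n).
Local Notation e_ i := (delta_mx 0 i : 'rV[R]_n).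
Hypotheses (oO : open O) (sw : forall j, smooth_on O (fun x => w x 0 j)) (Oy0 : O y0).
Hypothesis dw0 : forall i j, 'D_(e_ i) (fun x => w x 0 j) y0 = (i == j)%:R.

Let g y := w y - y.
Let J y := \matrix_(i, j) 'D_(e_ i) (fun x => w x 0 j) y.

Let sg j : smooth_on O (fun x => g x 0 j).
Proof.
apply: (smooth_on_eq (f := fun x => w x 0 j - x 0 j) oO).
  by move=> x _; rewrite !mxE.
exact: (smooth_onB oO (sw j) (smooth_on_coord j oO)).
Qed.

Let dg0 i j : 'D_(e_ i) (fun x => g x 0 j) y0 = 0.
Proof.
have -> : (fun x => g x 0 j) = (fun x => w x 0 j) - (fun x => x 0 j).
  by apply/funext => x; rewrite !mxE.
have dc := is_derive_coord y0 (e_ i) j.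
rewrite deriveB//; last exact: smooth_on_derivable (sw j) Oy0.
rewrite dw0; have [_ ->] := dc.
by rewrite !mxE eqxx /= eq_sym subrr.
Qed.

Let sJ i j : smooth_on O (fun y => J y i j).
Proof.
by apply: (smooth_on_eq oO _ (smooth_on_derive i (sw j))) => x _; rewrite mxE.
Qed.

Let small_ball : exists2 r, 0 < r & forall y, `|y0 - y| < r -> O y /\
  (\det (J y) != 0 /\ forall i j, `|'D_(e_ i) (fun x => g x 0 j) y| <= (2 * n.+1%:R)^-1).
Proof.
(* With [n] partial derivatives bounded by [c], the mean value theorem gives the Lipschitz constant
   [n * c <= 1 / 2]. *)
pose c : R := (2 * n.+1%:R)^-1.
have c0 : 0 < c by rewrite invr_gt0 mulr_gt0.
have HO : \forall y \near y0, O y by apply: open_nbhs_nbhs.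
have J0 : \det (J y0) = 1.
  have -> : J y0 = 1%:M by apply/matrixP => i j; rewrite !mxE dw0.
  exact: det1.
have HJ : \forall y \near y0, \det (J y) != 0.
  have := smooth_on_continuous (smooth_on_det oO sJ) Oy0.
  move=> /(@cvgrPdist_lt _ _ _ (nbhs y0)) /(_ 1 ltr01); rewrite J0.
  apply: filterS => y; apply: contraTN => /eqP ->.
  by rewrite subr0 normr1 ltxx.
have Hg (ij : 'I_n * 'I_n) : \forall y \near y0, `|'D_(e_ ij.1) (fun x => g x 0 ij.2) y| <= c.
  have := smooth_on_continuous (smooth_on_derive ij.1 (sg ij.2)) Oy0.
  move=> /(@cvgrPdist_lt _ _ _ (nbhs y0)) /(_ c c0); rewrite dg0.
  by apply: filterS => y; rewrite sub0r normrN => /ltW.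
have Hg' := filter_forall (nbhs_filter y0) Hg.
have : nbhs y0 (O `&` ([set y | \det (J y) != 0] `&`
   [set y | forall ij : 'I_n * 'I_n, `|'D_(e_ ij.1) (fun x => g x 0 ij.2) y| <= c])).
  by apply: filterI HO _; apply: filterI.
move=> /nbhs_ballP[r /= r0 Hr]; exists r => // y yr.
have [|Oy [Jy gy]] := Hr y; first by rewrite -ball_normE.
by split=> //; split => // i j; exact: (gy (i, j)).
Qed.

(** By [dw0] the derivative of [g = w - id] vanishes at [y0], so [w] is a 1/2-Lipschitz perturbation
    of the identity on a ball. This gives injectivity, the estimate [wlip] and, through a fixed
    point, openness of the image. The derivative of the inverse comes from the first-order expansion
    of [w]. *)
Lemma inverse_function : exists (N N' : set 'rV[R]_n) (th : 'rV[R]_n -> 'rV[R]_n),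
  [/\ open N, N y0 & N `<=` O] /\
  [/\ open N', forall y, N y -> N' (w y), forall z, N' z -> N (th z) /\ w (th z) = z,
      forall y, N y -> th (w y) = y & forall j, smooth_on N' (fun z => th z 0 j)].
Proof.
have [r r0 Hr] := small_ball.
pose N := [set y | `|y0 - y| < r]; pose N' := w @` N.
have NE : N = ball y0 r by rewrite -ball_normE.
have oN : open N by rewrite NE; exact: ball_open.
have Nline y y' (t : R) : N y -> N y' -> 0 <= t <= 1 -> N (y + t *: (y' - y)).
  move=> Ny Ny' /andP[t0 t1]; rewrite /N /=.
  have -> : y0 - (y + t *: (y' - y)) = (1 - t) *: (y0 - y) + t *: (y0 - y').
    by apply/rowP => i; rewrite !mxE; ring.
  apply: le_lt_trans (ler_normD _ _) _; rewrite !normrZ (ger0_norm t0) ger0_norm ?subr_ge0//.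
  have [->|t_neq1] := eqVneq t 1; first by rewrite subrr mul0r add0r mul1r.
  have t1' : 0 < 1 - t by rewrite subr_gt0 lt_neqAle t_neq1.
  rewrite (_ : r = (1 - t) * r + t * r); last by ring.
  by apply: ltr_leD; rewrite ?ltr_pM2l// ler_wpM2l// ltW.
have glip y y' : N y -> N y' -> `|g y' - g y| <= 2^-1 * `|y' - y|.
  move=> Ny Ny'; apply: rV_norm_le => [|j]; first by rewrite mulr_ge0.
  have [t t01|c c01 cE] := smooth_MVT (v := y' - y) (x := y) oO (sg j).
    by have [] := Hr _ (Nline _ _ _ Ny Ny' t01).
  move: cE; rewrite (addrC y) subrK => cE.
  have -> : (g y' - g y) 0 j = g y' 0 j - g y 0 j by rewrite [LHS]mxE [X in _ + X]mxE.
  rewrite cE; apply: le_trans (ler_norm_sum _ _ _) _.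
  apply: (@le_trans _ _ (\sum_(i < n) `|y' - y| * (2 * n.+1%:R)^-1)).
    apply: ler_sum => i _; rewrite normrM ler_pM// ?rV_coord_le//.
    by have [_ [_ ]] := Hr _ (Nline _ _ _ Ny Ny' c01); exact.
  rewrite sumr_const card_ord -[X in X <= _]mulr_natl mulrCA mulrC ler_wpM2r//.
  by rewrite invfM mulrCA ger_pMr// ?invr_gt0// ler_pdivrMr// mul1r ler_nat.
have wlip y y' : N y -> N y' -> `|y' - y| <= 2 * `|w y' - w y|.
  move=> Ny Ny'; have := glip y y' Ny Ny'.
  have -> : g y' - g y = (w y' - w y) - (y' - y) by rewrite /g; apply/rowP => i; rewrite !mxE; ring.
  have := lerB_dist (y' - y) (w y' - w y); rewrite (distrC (y' - y)).
  lra.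
have winj y y' : N y -> N y' -> w y = w y' -> y = y'.
  move=> Ny Ny' ww; apply/eqP; rewrite -subr_eq0 -normr_le0.
  by apply: le_trans (wlip _ _ Ny' Ny) _; rewrite ww subrr normr0 mulr0.
pose th z := xget y0 [set y | N y /\ w y = z].
have thP z : N' z -> N (th z) /\ w (th z) = z.
  by case=> y Ny wy; exact: (@xgetPex _ y0 [set y | N y /\ w y = z] (ex_intro _ y (conj Ny wy))).
have thK y : N y -> th (w y) = y.
  move=> Ny; have N'wy : N' (w y) by exists y.
  by have [Nt wt] := thP _ N'wy; exact: winj.
have oN' : open N'.
  rewrite openE => _ [y1 Ny1 <-].
  have : nbhs y1 N by apply: open_nbhs_nbhs.
  move=> /nbhs_ballP[rho /= rho0 Hrho].
  have [p p0 pN] : exists2 p : R, 0 < p & forall y, `|y1 - y| <= p -> N y.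
    exists (rho / 2); first by rewrite divr_gt0.
    move=> y yp; apply: Hrho; rewrite -ball_normE/=.
    by apply: le_lt_trans yp _; rewrite ltr_pdivrMr// ltr_pMr// ltr1n.
  apply/nbhs_ballP; exists (p / 2); first by rewrite /= divr_gt0.
  move=> z; rewrite -ball_normE /= => zp.
  pose K := [set y | `|y1 - y| <= p].
  (* A fixed point [q] of [f] solves [w q = z]. The distance [p / 2] from [w y1] to [z] and the
     variation of [g], at most [p / 2], keep [f] inside the compact ball [K]. As [f] is
     1/2-Lipschitz, applying it to a minimiser of [|f y - y|] forces the minimum to be 0. *)
  pose f y := z - g y.
  have fK y : K y -> K (f y).
    move=> Ky; rewrite /K /f /=.
    have -> : y1 - (z - g y) = (w y1 - z) + (g y - g y1).
      by rewrite /g; apply/rowP => i; rewrite !mxE; ring.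
    apply: le_trans (ler_normD _ _) _.
    have := glip _ _ Ny1 (pN _ Ky); rewrite (distrC y y1).
    have : `|y1 - y| <= p by []. lra.
  have cont : {within K, continuous (fun y => `|f y - y|)}.
    apply: continuous_in_subspaceT => y /set_mem Ky.
    have Oy : O y by have [] := Hr _ (pN _ Ky).
    have cg := smooth_on_continuous_comp sg Oy.
    have cf : {for y, continuous (fun y => f y - y)}.
      apply: (@cvgB _ _ _ (nbhs y)) => //.
      by apply: (@cvgB _ _ _ (nbhs y)) => //; exact: cst_continuous.
    exact: (@cvg_norm _ _ _ (nbhs y) _ _ _ cf).
  have K0 : K !=set0 by exists y1; rewrite /K /= subrr normr0 ltW.
  have [q /set_mem Kq qmin] := EVT_min_rV K0 (@rV_cball_compact n y1 p) cont.
  have := qmin (f q) (mem_set (fK _ Kq)).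
  have := glip _ _ (pN _ Kq) (pN _ (fK _ Kq)).
  have -> : f (f q) - f q = - (g (f q) - g q).
    by rewrite /f; apply/rowP => i; rewrite !mxE; ring.
  rewrite normrN => g1 g2.
  have : `|f q - q| <= 0 by lra.
  rewrite normr_le0 subr_eq0 => /eqP fq.
  exists q; first exact: pN.
  move: fq; rewrite /f /g => fq; rewrite -[RHS](subrK (w q - q)) fq.
  by rewrite addrC subrK.
have dth z i k : N' z -> is_derive z (e_ i) (fun z => th z 0 k) (invmx (J (th z)) i k).
  move=> N'z; have [Ny wy] := thP _ N'z; set y := th z in Ny wy *.
  have [Oy [Jy _]] := Hr _ Ny.
  set A := invmx (J y).
  have JA : J y *m A = 1%:M by rewrite mulmxV// unitmxE unitfE.
  have [K K0 HK] := mulmx_rV_norm_le A.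
  have L : (fun t : R => t^-1 *: (((fun z => th z 0 k) \o shift z) (t *: e_ i) - th z 0 k))
      @ 0^' --> A i k.
    apply/cvgrPdist_le => e e0.
    (* [K] bounds multiplication by the inverse Jacobian and [wlip] costs a factor 2, so the error
       is [K * eps * 2 * |t| <= e * |t|]. *)
    pose eps := e / (2 * K + 1).
    have K1 : 0 < 2 * K + 1 by lra.
    have eps0 : 0 < eps by rewrite divr_gt0.
    have Hj j : \forall h \near (0 : 'rV[R]_n),
        `|w (y + h) 0 j - w y 0 j - \sum_i h 0 i * J y i j| <= eps * `|h|.
      have [||d d0 Hd] := @C1_expansion _ _ (fun x => w x 0 j) y _ eps0.
      - move=> l; have : \forall x \near y, O x by apply: open_nbhs_nbhs.
        by apply: filterS => x Ox; exact: smooth_on_derivable (sw j) Ox.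
      - by move=> l; exact: smooth_on_continuous (smooth_on_derive l (sw j)) Oy.
      apply/nbhs_ballP; exists d => // h; rewrite -ball_normE /= sub0r normrN => hd.
      have := Hd h hd; congr (`|_ - _| <= _); apply: eq_bigr => l _.
      by rewrite mxE.
    have := filter_forall (nbhs_filter (0 : 'rV[R]_n)) Hj.
    move=> /nbhs_ballP[d /= d0 Hd].
    have N'near : \forall t \near (0 : R), N' (t *: e_ i + z).
      have ct : {for 0, continuous (fun t : R => t *: e_ i + z)}.
        apply: (@cvgD _ _ _ (nbhs (0 : R))); last exact: cst_continuous.
        by apply: (@cvgZr_tmp _ _ _ (nbhs (0 : R))); exact: cvg_id.
      apply: ct; rewrite /= scale0r add0r; exact: open_nbhs_nbhs.
    near=> t.
    have t0 : t != 0 by near: t; exact: nbhs_dnbhs_neq.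
    have N't : N' (t *: e_ i + z) by near: t; apply: nbhs_dnbhs.
    have td : `|t| < d / 2.
      by near: t; apply: dnbhs0_lt; rewrite divr_gt0.
    set y' := th (t *: e_ i + z).
    have [Ny' wy'] := thP _ N't; rewrite -/y' in Ny' wy'.
    pose h := y' - y.
    have nte : `|t *: e_ i| <= `|t|.
      rewrite normrZ ler_piMr//; apply: rV_norm_le => // j; rewrite mxE eqxx /=.
      by case: (j == i); rewrite ?normr1// normr0.
    have h2 : `|h| <= 2 * `|t|.
      apply: le_trans (wlip _ _ Ny Ny') _; rewrite wy' wy addrK.
      by rewrite ler_pM2l.
    have hd : ball (0 : 'rV[R]_n) d h.
      rewrite -ball_normE /= sub0r normrN; apply: le_lt_trans h2 _.
      by rewrite mulrC -ltr_pdivlMr.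
    have Hv : `|t *: e_ i - h *m J y| <= eps * `|h|.
      apply: rV_norm_le => [|j]; first by rewrite mulr_ge0// ltW.
      have := Hd h hd j; rewrite /h (addrC y) subrK wy' wy.
      by rewrite !mxE addrK.
    have := HK (t *: e_ i - h *m J y).
    rewrite mulmxBl -scalemxAl -mulmxA JA mulmx1 -rowE => Hw.
    have := rV_coord_le (t *: row i A - h) k; rewrite !mxE => Hk.
    rewrite /= -/y' -/y -[_ *: _]/(_ * _).
    have -> : A i k - t^-1 * (y' 0 k - y 0 k) = t^-1 * (t * A i k - (y' 0 k - y 0 k)).
      by field.
    rewrite normrM normfV mulrC ler_pdivrMr ?normr_gt0//.
    apply: le_trans Hk _; apply: le_trans Hw _.
    apply: (@le_trans _ _ (K * (eps * (2 * `|t|)))).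
      by rewrite ler_wpM2l//; apply: le_trans Hv _; rewrite ler_wpM2l// ltW.
    have -> : K * (eps * (2 * `|t|)) = (e * (2 * K) / (2 * K + 1)) * `|t|.
      by rewrite /eps; field; rewrite gt_eqF.
    by rewrite ler_wpM2r// ler_pdivrMr// ler_wpM2l ?ltW//; lra.
  by split; [apply/cvg_ex; exists (A i k); exact: L | exact: (cvg_lim _ L)].
have sNJ i k : smooth_on N (fun y => invmx (J y) i k).
  apply: (smooth_on_eq (f := fun y => (\det (J y))^-1 * (\adj (J y)) i k) oN).
    move=> y Ny; have [_ [Jy _]] := Hr _ Ny.
    by rewrite /invmx unitmxE unitfE Jy [RHS]mxE.
  have NO : N `<=` O by move=> y /Hr[].
  have sNJ0 i' j' : smooth_on N (fun y => J y i' j') := smooth_on_subset NO (sJ i' j').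
  apply: (smooth_onM oN); last exact: (smooth_on_adj i k oN sNJ0).
  apply: (smooth_onV oN (smooth_on_det oN sNJ0)).
  by move=> y /Hr[_ []].
exists N, N', th; split.
  by split => // [|y /Hr[]//]; rewrite /N /= subrr normr0.
split => // [y Ny|j]; first by exists y.
(* The functions [G \o th] with [G] smooth on [N] form a stable class: a partial derivative combines
   the derivatives of [G] with entries of the inverse Jacobian, all smooth on [N], and is again
   composed with [th]. *)
apply: (smooth_on_coind (P := fun f => exists2 G, smooth_on N G & f = G \o th) oN'); last first.
  by exists (fun y => y 0 j) => //; exact: smooth_on_coord.
move=> _ [G sG ->]; split=> [z N'z|i].
  have [Nz _] := thP _ N'z.
  apply: (@continuous_comp _ _ _ th G); last exact: smooth_on_continuous sG Nz.
  apply/(@cvgrPdist_le _ _ _ (nbhs z)) => e e0.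
  have HN : \forall z' \near z, N' z' by apply: open_nbhs_nbhs.
  near=> z'; have N'z' : N' z' by near: z'.
  have [Ny wy] := thP _ N'z; have [Ny' wy'] := thP _ N'z'.
  apply: le_trans (wlip _ _ Ny' Ny) _; rewrite wy wy'.
  rewrite mulrC -ler_pdivlMr//; near: z'.
  have e20 : 0 < e / 2 by rewrite divr_gt0.
  have /(@cvgrPdist_le _ _ _ (nbhs z)) := @cvg_id _ (nbhs z); exact.
have dG z : N' z -> is_derive z (e_ i) (G \o th)
    (\sum_l invmx (J (th z)) i l * 'D_(e_ l) G (th z)).
  move=> N'z; have [Nz _] := thP _ N'z.
  have := is_derive_comp oN sG Nz (fun l => @ex_derive _ _ _ _ _ _ _ (dth z i l N'z)).
  move/is_derive_eq; apply; apply: eq_bigr => l _.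
  by have [_ ->] := dth z i l N'z.
split=> [z /dG[]//|].
exists ((fun y => \sum_l invmx (J y) i l * 'D_(e_ l) G y) \o th); last first.
  by move=> z /dG[_ ->].
exists (fun y => \sum_l invmx (J y) i l * 'D_(e_ l) G y); last by [].
apply: (smooth_on_sum (index_enum _) (P := xpredT)
  (F := fun l y => invmx (J y) i l * 'D_(e_ l) G y) oN) => l _.
exact: (smooth_onM oN (sNJ i l) (smooth_on_derive l sG)).
Unshelve. all: by end_near. Qed.

End Local.
End InverseFunction.

(** * Symmetry of second derivatives *)

Section Schwarz.
Context {R : realType}.

(** The second difference of [g] over a square of side [h] is [h^2] times a value of [g12] and also
    [h^2] times a value of [g21], by two mean value theorems taken in either order. Working with two
    real variables serves partial and Gateaux derivatives alike. *)
Lemma schwarz2 (g g1 g2 g12 g21 : R -> R -> R) (d : R) : 0 < d ->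
  (forall s t, 0 <= s <= d -> 0 <= t <= d ->
     [/\ is_derive s 1 (g ^~ t) (g1 s t), is_derive t 1 (g1 s) (g12 s t),
         is_derive t 1 (g s) (g2 s t) & is_derive s 1 (g2 ^~ t) (g21 s t)]) ->
  (forall e, 0 < e -> exists2 r, 0 < r & forall s t, 0 <= s <= r -> 0 <= t <= r ->
     `|g12 s t - g12 0 0| <= e /\ `|g21 s t - g21 0 0| <= e) ->
  g12 0 0 = g21 0 0.
Proof.
move=> d0 dg cg; apply/eqP; rewrite -subr_eq0 -normr_le0; apply/ler_addgt0Pr => e e0.
have e20 : 0 < e / 2 by rewrite divr_gt0.
have [r r0 Hr] := cg _ e20.
pose h := Num.min d r.
have h0 : 0 < h by rewrite lt_min d0.
have hd : h <= d by rewrite ge_min lexx.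
have hr : h <= r by rewrite ge_min lexx orbT.
have scale (f f' : R -> R) : (forall s, 0 <= s <= h -> is_derive s 1 f (f' s)) ->
    exists2 c, 0 <= c <= h & f h - f 0 = h * f' c.
  move=> df; have [||c ch ->] := @MVT_segment R f f' 0 h (ltW h0).
  - move=> x; rewrite in_itv /= => /andP[x0 xh]; apply: df; rewrite !ltW//.
  - apply: derivable_within_continuous => x; rewrite in_itv /= => xh.
    exact: (@ex_derive _ _ _ _ _ _ _ (df x xh)).
  by exists c => //; rewrite subr0 mulrC.
have le_d s : 0 <= s <= h -> 0 <= s <= d by move=> /andP[-> /le_trans ->].
have le_r s : 0 <= s <= h -> 0 <= s <= r by move=> /andP[-> /le_trans ->].
have hh : 0 <= h <= h by rewrite lexx ltW.
have zz : 0 <= (0 : R) <= h by rewrite lexx ltW.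
have [s1 s1h E1] : exists2 c, 0 <= c <= h &
    (g h h - g h 0) - (g 0 h - g 0 0) = h * (g1 c h - g1 c 0).
  apply: (scale (fun s => g s h - g s 0) (fun s => g1 s h - g1 s 0)) => s sh.
  have [a _ _ _] := dg s h (le_d _ sh) (le_d _ hh).
  have [b _ _ _] := dg s 0 (le_d _ sh) (le_d _ zz).
  exact: is_deriveB.
have [t1 t1h E2] : exists2 c, 0 <= c <= h & g1 s1 h - g1 s1 0 = h * g12 s1 c.
  by apply: (scale (g1 s1) (g12 s1)) => t th; have [] := dg s1 t (le_d _ s1h) (le_d _ th).
have [t2 t2h E3] : exists2 c, 0 <= c <= h &
    (g h h - g 0 h) - (g h 0 - g 0 0) = h * (g2 h c - g2 0 c).
  apply: (scale (fun t => g h t - g 0 t) (fun t => g2 h t - g2 0 t)) => t th.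
  have [_ _ a _] := dg h t (le_d _ hh) (le_d _ th).
  have [_ _ b _] := dg 0 t (le_d _ zz) (le_d _ th).
  exact: is_deriveB.
have [s2 s2h E4] : exists2 c, 0 <= c <= h & g2 h t2 - g2 0 t2 = h * g21 c t2.
  by apply: (scale (g2 ^~ t2) (g21 ^~ t2)) => s sh; have [] := dg s t2 (le_d _ sh) (le_d _ t2h).
have : g12 s1 t1 = g21 s2 t2.
  apply: (mulfI (lt0r_neq0 h0)); apply: (mulfI (lt0r_neq0 h0)).
  rewrite -E2 -E4 -E1 -E3; ring.
have [H1 _] := Hr s1 t1 (le_r _ s1h) (le_r _ t1h).
have [_ H2] := Hr s2 t2 (le_r _ s2h) (le_r _ t2h).
move: H1 H2; rewrite !ler_norml => /andP[? ?] /andP[? ?] E; rewrite add0r; lra.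
Qed.

Lemma deriveC n (O : set 'rV[R]_n) f i j x : open O -> smooth_on O f -> O x ->
  'D_(delta_mx 0 i) ('D_(delta_mx 0 j) f) x = 'D_(delta_mx 0 j) ('D_(delta_mx 0 i) f) x.
Proof.
move=> oO sf Ox.
set ei := delta_mx 0 i; set ej := delta_mx 0 j.
have : nbhs x O by apply: open_nbhs_nbhs.
move=> /nbhs_ballP[d /= d0 Hd].
have small (r s t : R) : 0 <= s <= r -> 0 <= t <= r -> `|s *: ej + t *: ei| <= 2 * r.
  move=> /andP[s0 sr] /andP[t0 tr]; have r0 := le_trans s0 sr.
  apply: rV_norm_le => [|l]; first by rewrite mulr_ge0.
  rewrite !mxE !eqxx /= ger0_norm; last by rewrite addr_ge0// mulr_ge0.
  rewrite mulr_natl mulr2n; apply: lerD.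
    by apply: le_trans sr; rewrite ler_piMr//; case: (_ == _).
  by apply: le_trans tr; rewrite ler_piMr//; case: (_ == _).
pose P (s t : R) := x + (s *: ej + t *: ei).
have PO s t : 0 <= s <= d / 4 -> 0 <= t <= d / 4 -> O (P s t).
  move=> sd td; apply: Hd; rewrite -ball_normE /= /P opprD addNKr normrN.
  by apply: le_lt_trans (small _ _ _ sd td) _; lra.
have PEs s t : P s t = (x + t *: ei) + s *: ej by rewrite /P addrA addrAC.
have PEt s t : P s t = (x + s *: ej) + t *: ei by rewrite /P addrA.
have ds (u : 'rV[R]_n -> R) s t : smooth_on O u -> O (P s t) ->
    is_derive s 1 (fun s => u (P s t)) ('D_ej u (P s t)).
  move=> su Oxs.
  have -> : (fun s => u (P s t)) = (fun s : R => u ((x + t *: ei) + s *: ej)).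
    by apply/funext => a; rewrite PEs.
  rewrite PEs in Oxs *; apply: is_derive_line.
  exact: smooth_on_derivable su Oxs.
have dt (u : 'rV[R]_n -> R) s t : smooth_on O u -> O (P s t) ->
    is_derive t 1 (fun t => u (P s t)) ('D_ei u (P s t)).
  move=> su Oxs.
  have -> : (fun t => u (P s t)) = (fun t : R => u ((x + s *: ej) + t *: ei)).
    by apply/funext => a; rewrite PEt.
  rewrite PEt in Oxs *; apply: is_derive_line.
  exact: smooth_on_derivable su Oxs.
have P00 : P 0 0 = x by rewrite /P !scale0r !addr0.
have d40 : 0 < d / 4 by rewrite divr_gt0.
have := @schwarz2 (fun s t => f (P s t)) (fun s t => 'D_ej f (P s t))
  (fun s t => 'D_ei f (P s t)) (fun s t => 'D_ei ('D_ej f) (P s t))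
  (fun s t => 'D_ej ('D_ei f) (P s t)) _ d40.
rewrite P00; apply.
  move=> s t sd td; have OP := PO s t sd td.
  have sj := smooth_on_derive j sf; have si := smooth_on_derive i sf.
  split; [exact: (ds f s t sf OP)|exact: (dt ('D_ej f) s t sj OP)| |].
    exact: (dt f s t sf OP).
  exact: (ds ('D_ei f) s t si OP).
move=> e e0.
have c1 := smooth_on_continuous (smooth_on_derive i (smooth_on_derive j sf)) Ox.
have c2 := smooth_on_continuous (smooth_on_derive j (smooth_on_derive i sf)) Ox.
move: c1 => /(@cvgrPdist_le _ _ _ (nbhs x)) /(_ e e0) /nbhs_ballP[r1 /= r10 Hr1].
move: c2 => /(@cvgrPdist_le _ _ _ (nbhs x)) /(_ e e0) /nbhs_ballP[r2 /= r20 Hr2].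
have r0 : 0 < Num.min r1 r2 / 4 by rewrite divr_gt0// lt_min r10.
exists (Num.min r1 r2 / 4) => // s t sr tr.
have Pxr : `|x - P s t| < Num.min r1 r2.
  rewrite /P opprD addNKr normrN; apply: le_lt_trans (small _ _ _ sr tr) _.
  by lra.
split; rewrite distrC.
  by apply: Hr1; rewrite -ball_normE /=; apply: lt_le_trans Pxr _; rewrite ge_min lexx.
by apply: Hr2; rewrite -ball_normE /=; apply: lt_le_trans Pxr _; rewrite ge_min lexx orbT.
Qed.

Lemma pderiv_derive n f s k : smooth_on setT f ->
  pderiv ('D_(delta_mx 0 k : 'rV[R]_n) f) s = 'D_(delta_mx 0 k) (pderiv f s).
Proof.
elim: s f => [//|i s IH] f sf.
have E : 'D_(delta_mx 0 i) ('D_(delta_mx 0 k) f) = 'D_(delta_mx 0 k) ('D_(delta_mx 0 i) f).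
  by apply/funext => x; exact: deriveC openT sf I.
have := IH _ (smooth_on_derive i sf); rewrite -E; exact.
Qed.

End Schwarz.

(** * Bernstein approximation in C^m *)

Section Bernstein.
Context {R : realType}.
Implicit Types (f g : nat -> R) (y a c : R) (M N p : nat).

(* De Casteljau's recursion for sum_i 'C(M, i) y^i (1 - y)^(M - i) f i. *)
Fixpoint bern M f y : R :=
  if M is M'.+1 then (1 - y) * bern M' f y + y * bern M' (fun i => f i.+1) y
  else f 0%N.

(** The derivative in [y] of the Bernstein polynomial [bern M f]. *)
Definition dbern M f y : R :=
  if M is M'.+1 then M%:R * bern M' (fun i => f i.+1 - f i) y else 0.

Lemma bernD M f g y : bern M (fun i => f i + g i) y = bern M f y + bern M g y.
Proof. by elim: M f g => [//|M IH] f g /=; rewrite !IH; ring. Qed.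

Lemma bernZ M a f y : bern M (fun i => a * f i) y = a * bern M f y.
Proof. by elim: M f => [//|M IH] f /=; rewrite !IH; ring. Qed.

Lemma bernB M f g y : bern M (fun i => f i - g i) y = bern M f y - bern M g y.
Proof.
rewrite -[X in _ - X]mul1r -mulNr -bernZ -bernD; congr bern.
by apply/funext => i; rewrite mulN1r.
Qed.

Lemma eq_bern M f g y : (forall i, f i = g i) -> bern M f y = bern M g y.
Proof. by move=> /funext ->. Qed.

Lemma bern_cst M c y : bern M (fun=> c) y = c.
Proof. by elim: M => [//|M IH] /=; rewrite IH; ring. Qed.

Lemma bern_le M f g y : 0 <= y <= 1 -> (forall i, (i <= M)%N -> f i <= g i) ->
  bern M f y <= bern M g y.
Proof.
move=> /andP[y0 y1]; elim: M f g => [|M IH] f g fg /=; first exact: fg.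
apply: lerD; apply: ler_wpM2l; rewrite ?subr_ge0//; apply: IH => i iM; apply: fg => //.
exact: leqW.
Qed.

Lemma bern_norm_le M f g y : 0 <= y <= 1 -> (forall i, (i <= M)%N -> `|f i| <= g i) ->
  `|bern M f y| <= bern M g y.
Proof.
move=> y01 fg; rewrite ler_norml -[X in X <= _]mulN1r -bernZ.
by rewrite !bern_le// => i iM; have := fg i iM; rewrite ler_norml => /andP[]; rewrite ?mulN1r.
Qed.

(** Second moment about [-c] of the binomial law with mean [M y] and variance [M y (1 - y)]. The
    free shift [c] absorbs the index shift in de Casteljau's recursion. *)
Lemma bern_var M c y :
  bern M (fun i => (i%:R + c) ^+ 2) y = (M%:R * y + c) ^+ 2 + M%:R * y * (1 - y).
Proof.
elim: M c => [|M IH] c /=; first by rewrite !mul0r addr0 expr2.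
rewrite IH (@eq_bern _ _ (fun i => (i%:R + (c + 1)) ^+ 2)); last first.
  by move=> i; rewrite -natr1; ring.
by rewrite IH -natr1; ring.
Qed.

(** What the product rule gives when de Casteljau's recursion is differentiated. *)
Lemma dbern_rec M f y : dbern M.+1 f y =
  bern M (fun i => f i.+1) y - bern M f y +
  ((1 - y) * dbern M f y + y * dbern M (fun i => f i.+1) y).
Proof.
by rewrite -bernB /dbern; case: M => [|M] /=; rewrite -?natr1; ring.
Qed.

Section Coordinate.
Variables (n : nat) (k : 'I_n).
Local Notation e_ i := (delta_mx 0 i : 'rV[R]_n).
Implicit Types (x : 'rV[R]_n) (Phi : 'rV[R]_n -> R).

Definition setc x c : 'rV[R]_n := \row_j (if j == k then c else x 0 j).

(* Mesh and degree are separate parameters: a derivative in coordinate [k] lowers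
   the degree [M] but keeps the mesh 1/N. *)
Definition bernstein N M Phi x : R :=
  bern M (fun i => Phi (setc x (i%:R / N%:R))) (x 0 k).

Lemma is_derive_bern M (F dF : nat -> 'rV[R]_n -> R) x v :
  (forall i, is_derive x v (F i) (dF i x)) ->
  is_derive x v (fun x => bern M (fun i => F i x) (x 0 k))
    (bern M (fun i => dF i x) (x 0 k) + v 0 k * dbern M (fun i => F i x) (x 0 k)).
Proof.
elim: M F dF => [|M IH] F dF HF.
  by have := HF 0%N; move/is_derive_eq; apply; rewrite /= mulr0 addr0.
have dk := is_derive_coord x v k.
have d1k : is_derive x v (fun x => 1 - x 0 k) (- v 0 k).
  have := is_deriveB (is_derive_cst (1 : R) x v) dk.
  by move/is_derive_eq; apply; rewrite sub0r.
have H1 := is_deriveM d1k (IH F dF HF).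
have H2 := is_deriveM dk (IH (fun i => F i.+1) (fun i => dF i.+1) (fun i => HF i.+1)).
have := is_deriveD H1 H2; move/is_derive_eq; apply.
have scE (a b : R) : a *: b = a * b by [].
by rewrite !scE [in RHS]dbern_rec /=; ring.
Qed.

Lemma setc_shift x c i h : i != k -> setc (h *: e_ i + x) c = h *: e_ i + setc x c.
Proof.
move=> ik; apply/rowP => j; rewrite !mxE eqxx /=; case: (eqVneq j k) => [->|//].
by rewrite eq_sym (negPf ik) mulr0 add0r.
Qed.

Lemma setc_shift_id x c h : setc (h *: e_ k + x) c = setc x c.
Proof.
by apply/rowP => j; rewrite !mxE eqxx /=; case: (eqVneq j k) => [//|_]; rewrite mulr0 add0r.
Qed.

Lemma is_derive_setc Phi x c i : (forall z : 'rV[R]_n, derivable Phi z (e_ i)) ->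
  is_derive x (e_ i) (fun x => Phi (setc x c))
    (if i == k then 0 else 'D_(e_ i) Phi (setc x c)).
Proof.
move=> dP; have [->|ik] := eqVneq i k.
  have Q : (fun h => h^-1 *: (((fun x => Phi (setc x c)) \o shift x) (h *: e_ k)
      - Phi (setc x c))) = (fun=> 0).
    by apply/funext => h; rewrite /= setc_shift_id subrr scaler0.
  have L : (fun h : R => h^-1 *: (((fun x => Phi (setc x c)) \o shift x) (h *: e_ k)
      - Phi (setc x c))) @ 0^' --> (0 : R) by rewrite Q; exact: cvg_cst.
  by split; [apply/cvg_ex; exists 0; exact: L | exact: (cvg_lim _ L)].
have Q : (fun h => h^-1 *: (((fun x => Phi (setc x c)) \o shift x) (h *: e_ i)
      - Phi (setc x c))) =
   (fun h => h^-1 *: ((Phi \o shift (setc x c)) (h *: e_ i) - Phi (setc x c))).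
  by apply/funext => h; rewrite /= setc_shift.
by split; [rewrite /derivable Q; exact: dP | rewrite /derive Q].
Qed.

Lemma smooth_setc Phi c : smooth_on setT Phi -> smooth_on setT (fun x => Phi (setc x c)).
Proof.
move=> sP; apply: (smooth_on_comp (u := fun x => setc x c) openT openT (fun _ _ => I) _ sP).
move=> j; case: (eqVneq j k) => [->|jk].
  apply: (smooth_on_eq (f := fun=> c) openT); last exact: smooth_on_cst.
  by move=> x _; rewrite mxE eqxx.
apply: (smooth_on_eq (f := fun x => x 0 j) openT); last exact: (smooth_on_coord j (@openT _)).
by move=> x _; rewrite mxE (negPf jk).
Qed.

Lemma smooth_bern M (F : nat -> 'rV[R]_n -> R) : (forall i, smooth_on setT (F i)) ->
  smooth_on setT (fun x => bern M (fun i => F i x) (x 0 k)).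
Proof.
elim: M F => [|M IH] F sF; first exact: (sF 0%N).
have sk := smooth_on_coord k (@openT 'rV[R]_n).
apply: (smooth_onD openT).
  apply: (smooth_onM openT (smooth_onB openT (smooth_on_cst 1) sk)); exact: IH.
by apply: (smooth_onM openT sk); apply: (IH (fun i => F i.+1)) => i; exact: sF.
Qed.

Lemma smooth_bernstein N M Phi : smooth_on setT Phi -> smooth_on setT (bernstein N M Phi).
Proof. by move=> sP; apply: smooth_bern => i; exact: smooth_setc. Qed.

Lemma derive_bernstein N M Phi i : smooth_on setT Phi -> i != k ->
  'D_(e_ i) (bernstein N M Phi) = bernstein N M ('D_(e_ i) Phi).
Proof.
move=> sP ik; apply/funext => x.
have dP (z : 'rV[R]_n) : derivable Phi z (e_ i) by exact: smooth_on_derivable sP I.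
have [_ ->] := is_derive_bern M
  (dF := fun j x => if i == k then 0 else 'D_(e_ i) Phi (setc x (j%:R / N%:R)))
  (fun j => is_derive_setc x (j%:R / N%:R) dP).
by rewrite (negPf ik) mxE eq_sym (negPf ik) mul0r addr0.
Qed.

(** One degree is lost and values become forward differences, while the mesh stays [N^-1]; for
    [M.+1] close to [N] these are nearly difference quotients. *)
Lemma derive_bernstein_id N M Phi : smooth_on setT Phi -> (0 < N)%N ->
  'D_(e_ k) (bernstein N M.+1 Phi) =
  bernstein N M (fun x => M.+1%:R * (Phi (x + N%:R^-1 *: e_ k) - Phi x)).
Proof.
move=> sP N0; apply/funext => x.
have dP (z : 'rV[R]_n) : derivable Phi z (e_ k) by exact: smooth_on_derivable sP I.
have [_ ->] := is_derive_bern M.+1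
  (dF := fun j x => if k == k then 0 else 'D_(e_ k) Phi (setc x (j%:R / N%:R)))
  (fun j => is_derive_setc x (j%:R / N%:R) dP).
rewrite eqxx bern_cst add0r mxE !eqxx mul1r /dbern /bernstein bernZ; congr (_ * _).
apply: eq_bern => i; congr (Phi _ - _); apply/rowP => j; rewrite !mxE eqxx /=.
case: (eqVneq j k) => _; last by rewrite mulr0 addr0.
by rewrite /= mulr1 -natr1 mulrDl mul1r.
Qed.

(** Balls of every radius are used because the forward differences at a point of norm at most [r]
    involve points of norm up to [r + 1]. *)
Definition cvg_smooth (u : nat -> 'rV[R]_n -> R) Phi := forall s (r e : R), 0 < e ->
  exists N0, forall N, (N0 <= N)%N -> forall x, `|x| <= r ->
    `|pderiv (u N) s x - pderiv Phi s x| <= e.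

Lemma cvg_smooth_derive u Phi i : cvg_smooth u Phi ->
  cvg_smooth (fun N => 'D_(e_ i) (u N)) ('D_(e_ i) Phi).
Proof. by move=> uP s; exact: (uP (i :: s)). Qed.

Lemma pderiv_shift Phi (a : 'rV[R]_n) s x : smooth_on setT Phi ->
  pderiv (fun x => Phi (x + a)) s x = pderiv Phi s (x + a).
Proof.
elim: s Phi => [//|i s IH] Phi sP; rewrite /= -IH; last exact: smooth_on_derive.
congr (pderiv _ s); apply/funext => y; rewrite /derive.
suff -> : (fun h : R => h^-1 *: (((fun x => Phi (x + a)) \o shift y) (h *: e_ i) - Phi (y + a))) =
  (fun h : R => h^-1 *: ((Phi \o shift (y + a)) (h *: e_ i) - Phi (y + a))) by [].
by apply/funext => h; rewrite /= addrA.
Qed.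

Lemma smooth_shift Phi (a : 'rV[R]_n) : smooth_on setT Phi -> smooth_on setT (fun x => Phi (x + a)).
Proof.
move=> sP; apply: (smooth_on_comp (u := fun x => x + a) openT openT (fun _ _ => I) _ sP).
move=> j; apply: (smooth_on_eq (f := fun x => x 0 j + a 0 j) openT).
  by move=> x _; rewrite mxE.
exact: (smooth_onD openT (smooth_on_coord j (@openT _)) (smooth_on_cst _)).
Qed.

Lemma pderivB Phi Psi s x : smooth_on setT Phi -> smooth_on setT Psi ->
  pderiv (fun x => Phi x - Psi x) s x = pderiv Phi s x - pderiv Psi s x.
Proof.
elim: s Phi Psi => [//|i s IH] Phi Psi sP sQ /=.
rewrite -IH; [|exact: smooth_on_derive|exact: smooth_on_derive].
congr (pderiv _ s); apply/funext => y.
have dP := smooth_on_derivable (i := i) sP (I : setT y).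
have dQ := smooth_on_derivable (i := i) sQ (I : setT y).
exact: (deriveB dP dQ).
Qed.

Lemma smooth_bound Phi r : smooth_on setT Phi -> exists2 L : R, 0 <= L &
  forall x, `|x| <= r -> `|Phi x| <= L.
Proof.
move=> sP; have [L L0 HL] := @pbound_exists _ _ setT _ 0%N _
  (fun x _ => I) (@rV_cball_compact _ n 0 r) sP.
by exists L => // x xr; apply: (HL [::]) => //=; rewrite sub0r normrN.
Qed.

Lemma unif_cont Phi (r e : R) : smooth_on setT Phi -> 0 < e -> exists2 d : R, 0 < d &
  forall x (y : 'rV[R]_n), `|x| <= r -> `|y| <= r -> `|x - y| <= d -> `|Phi x - Phi y| <= e.
Proof.
move=> sP e0.
have /choice[L HL] : forall i, exists L : R, 0 <= L /\
    forall x, `|x| <= r -> `|'D_(e_ i) Phi x| <= L.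
  by move=> i; have [L ? ?] := @smooth_bound _ r (smooth_on_derive i sP); exists L.
have S0 : 0 <= \sum_i L i by apply: sumr_ge0 => i _; have [] := HL i.
have S1 : 0 < 1 + \sum_i L i by lra.
exists (e / (1 + \sum_i L i)); first by rewrite divr_gt0.
move=> x y xr yr xyd.
have [t _|c c01] := smooth_MVT (v := x - y) (x := y) openT sP; first by [].
rewrite (addrC y) subrK => ->; apply: le_trans (ler_norm_sum _ _ _) _.
have cr : `|y + c *: (x - y)| <= r.
  have -> : y + c *: (x - y) = (1 - c) *: y + c *: x.
    by apply/rowP => i; rewrite !mxE; ring.
  move: c01 => /andP[c0 c1].
  apply: le_trans (ler_normD _ _) _; rewrite !normrZ (ger0_norm c0) ger0_norm ?subr_ge0//.
  have -> : r = (1 - c) * r + c * r by ring.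
  by apply: lerD; rewrite ler_wpM2l// subr_ge0.
apply: (@le_trans _ _ (\sum_i `|x - y| * L i)).
  apply: ler_sum => i _; rewrite normrM ler_pM ?rV_coord_le//.
  by have [_] := HL i; exact.
rewrite -mulr_sumr; have Se : \sum_i L i <= 1 + \sum_i L i by lra.
apply: (@le_trans _ _ (e / (1 + \sum_i L i) * (1 + \sum_i L i))).
  by rewrite ler_pM.
by rewrite divfK ?gt_eqF.
Qed.

(** By the mean value theorem a difference with step [1 / N] is [1 / N] times a partial derivative
    at a nearby point, and [(N - p) / N] tends to 1. *)
Lemma cvg_smooth_diff u Phi p : (forall N, smooth_on setT (u N)) -> smooth_on setT Phi ->
  cvg_smooth u Phi ->
  cvg_smooth (fun N x => (N - p)%:R * (u N (x + N%:R^-1 *: e_ k) - u N x)) ('D_(e_ k) Phi).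
Proof.
move=> su sP uP s r e e0.
have sPs : smooth_on setT (pderiv ('D_(e_ k) Phi) s).
  exact: smooth_on_pderiv (smooth_on_derive k sP).
have [B B0 HB] := smooth_bound (r + 1) sPs.
have e40 : 0 < e / 4 by rewrite divr_gt0.
have [d d0 Hd] := unif_cont (r + 1) sPs e40.
have [N1 HN1] := uP (k :: s) (r + 1) _ e40.
(* [N2] makes the step [1 / N] at most the modulus [d]; [N3] makes [p B / N] at most [e / 4], where
   [p / N] is the relative loss from the factor [N - p] in place of [N]. *)
pose N2 := Num.bound (d^-1); pose N3 := Num.bound (p%:R * B / (e / 4)).
exists (p + N1 + N2 + N3 + 1)%N => N NN x xr.
have [pN hN1 hN2 hN3] : [/\ p <= N, N1 <= N, N2 <= N & N3 <= N]%N.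
  by clearbody N2 N3; move: NN; clear; split; lia.
have N0 : (0 < N)%N by apply: leq_trans NN; rewrite addn1.
have NR : (0 : R) < N%:R by rewrite ltr0n.
have sh := @smooth_shift _ (N%:R^-1 *: e_ k) (su N).
have sd : smooth_on setT (fun x => u N (x + N%:R^-1 *: e_ k) - u N x).
  exact: (smooth_onB openT sh (su N)).
rewrite (pderivZ (N - p)%:R s openT sd I) (pderivB s x sh (su N)) (pderiv_shift _ s x (su N)).
have [t _|c c01] := smooth_MVT (v := N%:R^-1 *: e_ k) (x := x) openT (smooth_on_pderiv s (su N)).
  by [].
rewrite (bigD1 k)//= big1 ?addr0; last first.
  by move=> j jk; rewrite !mxE eqxx (negPf jk)/= mulr0 mul0r.
set y := x + c *: _.
have -> : 'D_(e_ k) (pderiv (u N) s) y = pderiv ('D_(e_ k) (u N)) s y.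
  by rewrite (pderiv_derive s k (su N)).
rewrite !mxE !eqxx mulr1 => ->.
have xy : `|x - y| <= N%:R^-1.
  move: c01 => /andP[c0 c1].
  rewrite /y opprD addNKr normrN !normrZ ger0_norm// ger0_norm ?invr_ge0//.
  rewrite mulrCA ler_piMr ?invr_ge0//.
  apply: mulr_ile1 => //; apply: rV_norm_le => // j; rewrite mxE eqxx /=.
  by case: (j == k); rewrite ?normr1// normr0.
have N1inv : N%:R^-1 <= 1 :> R by rewrite invf_le1// ler1n.
have xr1 : `|x| <= r + 1 by rewrite ler_wpDr.
have yr : `|y| <= r + 1.
  have -> : y = x - (x - y) by rewrite opprB addrC subrK.
  apply: le_trans (ler_normB _ _) _; apply: lerD => //; exact: le_trans N1inv.
have Ninvd : N%:R^-1 <= d.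
  rewrite -[d]invrK lef_pV2 ?posrE ?invr_gt0//.
  apply: ltW; apply: lt_le_trans (archi_boundP _) _; first by rewrite invr_ge0 ltW.
  by rewrite ler_nat.
have H1 : `|pderiv ('D_(e_ k) (u N)) s y - pderiv ('D_(e_ k) Phi) s y| <= e / 4.
  exact: (HN1 N).
have H2 : `|pderiv ('D_(e_ k) Phi) s x - pderiv ('D_(e_ k) Phi) s y| <= e / 4.
  by apply: Hd => //; exact: le_trans Ninvd.
have H3 := HB y yr.
set U := pderiv _ s y in H1 *; set P := pderiv _ s y in H1 H2 H3 *; set Q := pderiv _ s x in H2 *.
pose q : R := p%:R / N%:R.
have q0 : 0 <= q by rewrite divr_ge0.
have q1 : q <= 1 by rewrite ler_pdivrMr// mul1r ler_nat.
have -> : (N - p)%:R * (N%:R^-1 * U) - Q = (1 - q) * (U - P) - q * P - (Q - P).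
  by rewrite natrB// /q; field; rewrite gt_eqF.
have qB : q * B <= e / 4.
  rewrite /q mulrAC ler_pdivrMr// [X in _ <= X]mulrC -ler_pdivrMr//.
  apply: ltW; apply: lt_le_trans (archi_boundP _) _.
    by rewrite divr_ge0 ?mulr_ge0// ltW.
  by rewrite ler_nat.
have K1 : `|(1 - q) * (U - P)| <= e / 4.
  by rewrite normrM ger0_norm ?subr_ge0// (le_trans _ H1)// ler_piMl// lerBlDr lerDl.
have K2 : `|q * P| <= e / 4.
  by rewrite normrM ger0_norm// (le_trans _ qB)// ler_wpM2l.
move: K1 K2 H2; rewrite !ler_norml => /andP[? ?] /andP[? ?] /andP[? ?]; lra.
Qed.

Definition unit_cube : set 'rV[R]_n := [set x | forall i, 0 <= x 0 i <= 1].

Lemma unit_cube_norm x : unit_cube x -> `|x| <= 1.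
Proof.
move=> Ex; apply: rV_norm_le => // i; have /andP[x0 x1] := Ex i.
by rewrite ger0_norm.
Qed.

(** Chebyshev's argument for Bernstein polynomials, with degree [N - p], mesh [1 / N] and a varying
    function [u N]. *)
Lemma bernstein_cvg0 u Phi p (e : R) : smooth_on setT Phi -> cvg_smooth u Phi -> 0 < e ->
  exists N0, forall N, (N0 <= N)%N -> forall x, unit_cube x ->
    `|bernstein N (N - p)%N (u N) x - Phi x| <= e.
Proof.
move=> sP uP e0.
have [L L0 HL] := smooth_bound 1 (smooth_on_derive k sP).
have e20 : 0 < e / 2 by rewrite divr_gt0.
have [N1 HN1] := uP [::] 1 _ e20.
(* The error splits into [e / 2] for the distance from [u N] to [Phi], [e / 4] for [L * eta], and
   [e / 4] for the variance term, which [A] and [N2] control. *)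
pose eta := e / (4 * (L + 1)).
have L1 : 0 < L + 1 by lra.
have eta0 : 0 < eta by rewrite divr_gt0// mulr_gt0.
pose A : R := (p%:R ^+ 2 + 1) / eta * (L + 1) / (e / 4).
have P0 : 0 <= p%:R ^+ 2 + 1 :> R by rewrite addr_ge0// sqr_ge0.
have A0 : 0 <= A.
  apply: divr_ge0; last by rewrite ltW// divr_gt0.
  by apply: mulr_ge0; [apply: divr_ge0; [exact: P0|exact: ltW]|exact: ltW].
pose N2 := Num.bound A; exists (p + N1 + N2 + 1)%N => N NN x Ex.
have [pN hN1 hN2] : [/\ p <= N, N1 <= N & N2 <= N]%N.
  by clearbody N2; move: NN; clear; split; lia.
have N0 : (0 < N)%N by apply: leq_trans NN; rewrite addn1.
have NR : (0 : R) < N%:R by rewrite ltr0n.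
have xk := Ex k.
have node i : (i <= N - p)%N -> unit_cube (setc x (i%:R / N%:R)).
  move=> iM j; rewrite mxE; case: ifP => // _.
  by rewrite divr_ge0//= ler_pdivrMr// mul1r ler_nat (leq_trans iM)// leq_subr.
have -> : bernstein N (N - p)%N (u N) x - Phi x =
    bern (N - p)%N (fun i => u N (setc x (i%:R / N%:R)) - Phi x) (x 0 k).
  by rewrite bernB bern_cst.
(* The inequality [|b| <= eta + b^2 / eta] trades the distance to the node for its square, whose
   mean [bern_var] computes. *)
have S1 i : (i <= N - p)%N -> `|u N (setc x (i%:R / N%:R)) - Phi x| <=
    e / 2 + L * (eta + eta^-1 * ((i%:R / N%:R - x 0 k) ^+ 2)).
  move=> iM; set z := setc x _.
  rewrite -(subrKA (Phi z)); apply: le_trans (ler_normD _ _) _; apply: lerD.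
    by apply: HN1 => //; exact: unit_cube_norm (node i iM).
  have [t _|c c01] := smooth_MVT (v := z - x) (x := x) openT sP; first by [].
  rewrite (addrC x) subrK => ->.
  rewrite (bigD1 k)//= big1 ?addr0; last first.
    by move=> j jk; rewrite !mxE (negPf jk) subrr mul0r.
  rewrite !mxE eqxx; set b := _ / _ - _.
  rewrite normrM mulrC; apply: ler_pM => //.
    apply: HL; have -> : x + c *: (z - x) = (1 - c) *: x + c *: z.
      by apply/rowP => j; rewrite !mxE; ring.
    move: c01 => /andP[c0 c1].
    apply: le_trans (ler_normD _ _) _; rewrite !normrZ (ger0_norm c0) ger0_norm ?subr_ge0//.
    apply: (@le_trans _ _ ((1 - c) * 1 + c * 1)); last by rewrite !mulr1 subrK.
    apply: lerD; apply: ler_wpM2l; rewrite ?subr_ge0//; apply: unit_cube_norm => //.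
    exact: node.
  have [be|be] := leP `|b| eta.
    by rewrite ler_wpDr// mulr_ge0 ?sqr_ge0// invr_ge0 ltW.
  apply: ler_wpDl; first exact: ltW.
  rewrite -real_normK ?num_real// expr2 mulrA ler_peMl// mulrC ler_pdivlMr// mul1r.
  exact: ltW.
apply: le_trans (bern_norm_le xk S1) _.
have -> : bern (N - p)%N (fun i => e / 2 + L * (eta + eta^-1 * ((i%:R / N%:R - x 0 k) ^+ 2))) (x 0 k)
    = e / 2 + L * (eta + eta^-1 * (N%:R ^- 2 *
      (((N - p)%:R * x 0 k - N%:R * x 0 k) ^+ 2 + (N - p)%:R * x 0 k * (1 - x 0 k)))).
  rewrite bernD bern_cst bernZ bernD bern_cst bernZ -bern_var -[in RHS]bernZ.
  congr (_ + _ * (_ + _ * _)); apply: eq_bern => i.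
  by field; rewrite gt_eqF.
have /andP[y0 y1] := xk; set y := x 0 k in y0 y1 *.
(* Squared bias plus variance: the mean node [(N - p) y / N] is off by [p y / N], and the variance
   is at most [1 / N]. *)
have V : N%:R ^- 2 * (((N - p)%:R * y - N%:R * y) ^+ 2 + (N - p)%:R * y * (1 - y))
    <= (p%:R ^+ 2 + 1) / N%:R.
  rewrite mulrC ler_pdivrMr ?exprn_gt0//.
  have -> : (p%:R ^+ 2 + 1) / N%:R * N%:R ^+ 2 = (p%:R ^+ 2 + 1) * N%:R :> R.
    by field; rewrite gt_eqF.
  rewrite mulrDl mul1r; apply: lerD.
    have -> : ((N - p)%:R * y - N%:R * y) ^+ 2 = p%:R ^+ 2 * y ^+ 2 by rewrite natrB//; ring.
    apply: ler_wpM2l; first exact: sqr_ge0.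
    by apply: (@le_trans _ _ 1); [rewrite expr_le1 | rewrite ler1n].
  rewrite -mulrA; apply: (@le_trans _ _ ((N - p)%:R * 1)).
    by apply: ler_wpM2l => //; apply: mulr_ile1 => //; lra.
  by rewrite mulr1 ler_nat leq_subr.
have W : L * (eta^-1 * ((p%:R ^+ 2 + 1) / N%:R)) <= e / 4.
  apply: (@le_trans _ _ ((L + 1) * (eta^-1 * ((p%:R ^+ 2 + 1) / N%:R)))).
    apply: ler_wpM2r; last by lra.
    by apply: mulr_ge0; [rewrite invr_ge0 ltW | apply: divr_ge0 => //; exact: ltW].
  have -> : (L + 1) * (eta^-1 * ((p%:R ^+ 2 + 1) / N%:R)) = A * (e / 4) / N%:R.
    by rewrite /A; field; rewrite !gt_eqF.
  have e40 : 0 < e / 4 by rewrite divr_gt0.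
  rewrite ler_pdivrMr// [X in _ <= X]mulrC; apply: ler_wpM2r; first exact: ltW.
  apply: ltW; apply: lt_le_trans (archi_boundP A0) _.
  by rewrite ler_nat.
have X : L * eta <= e / 4.
  have -> : e / 4 = (L + 1) * eta by rewrite /eta; field; rewrite gt_eqF.
  by rewrite ler_wpM2r ?ltW//; lra.
rewrite mulrDr.
have : L * (eta^-1 * (N%:R ^- 2 * (((N - p)%:R * y - N%:R * y) ^+ 2 + (N - p)%:R * y * (1 - y))))
    <= L * (eta^-1 * ((p%:R ^+ 2 + 1) / N%:R)).
  by rewrite !ler_wpM2l// invr_ge0 ltW.
lra.
Qed.

(** Induction on the list of derivatives. A derivative in coordinate [k] lowers the degree by one
    and replaces [u N] by scaled differences, so the statement must allow an offset [p] and a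
    convergent sequence [u]. *)
Lemma bernstein_cvg s p u Phi (e : R) : (forall N, smooth_on setT (u N)) ->
  smooth_on setT Phi -> cvg_smooth u Phi -> 0 < e ->
  exists N0, forall N, (N0 <= N)%N -> forall x, unit_cube x ->
    `|pderiv (bernstein N (N - p)%N (u N)) s x - pderiv Phi s x| <= e.
Proof.
elim: s p u Phi => [|i s IH] p u Phi su sP uP e0; first exact: bernstein_cvg0.
have [->|ik] := eqVneq i k; last first.
  have [N0 HN0] := IH p _ _ (fun N => smooth_on_derive i (su N)) (smooth_on_derive i sP)
    (cvg_smooth_derive i uP) e0.
  exists N0 => N /HN0 H x /H; rewrite -derive_bernstein//; exact.
have su' N : smooth_on setT (fun x => (N - p)%:R * (u N (x + N%:R^-1 *: e_ k) - u N x)).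
  apply: (smooth_onM openT (smooth_on_cst _)).
  exact: (smooth_onB openT (smooth_shift _ (su N)) (su N)).
have [N0 HN0] := IH p.+1 _ _ su' (smooth_on_derive k sP) (cvg_smooth_diff p su sP uP) e0.
exists (N0 + p + 1)%N => N NN x Ex.
have [NN0 NS N1] : [/\ N0 <= N, N - p = (N - p).-1.+1 & 0 < N]%N.
  by move: NN; clear; split; lia.
have := HN0 N NN0 x Ex; rewrite subnS.
by rewrite NS -derive_bernstein_id.
Qed.

Lemma bernstein_approx m Phi (e : R) : smooth_on setT Phi -> 0 < e ->
  exists N, pbound m unit_cube (fun x => Phi x - bernstein N N Phi x) e.
Proof.
move=> sP e0.
have cst_cvg : cvg_smooth (fun=> Phi) Phi.
  by move=> s r d d0; exists 0%N => N _ x _; rewrite subrr normr0 ltW.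
have /choice[N0 HN0] : forall s, exists N0, forall N, (N0 <= N)%N -> forall x, unit_cube x ->
    `|pderiv (bernstein N N Phi) s x - pderiv Phi s x| <= e.
  move=> s; have [N0 H] := @bernstein_cvg s 0%N _ _ _ (fun=> sP) sP cst_cvg e0.
  by exists N0 => N /H; rewrite subn0.
(* Only finitely many lists have length at most [m]; the sum of their thresholds dominates each of
   them. *)
exists (\sum_(l < m.+1) \sum_(t : l.-tuple 'I_n) N0 t)%N => s sm x Ex.
rewrite pderivB//; last exact: smooth_bernstein.
rewrite distrC; apply: HN0 => //.
rewrite -ltnS in sm; rewrite (bigD1 (Ordinal sm))//= (bigD1 (in_tuple s))//=.
by rewrite -addnA leq_addr.
Qed.

End Coordinate.
End Bernstein.

(** * Smooth and test functions on a manifold *)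

Section CompactPositive.
Context {R : realType} {T : topologicalType}.
Variables (P : (T -> R) -> Prop) (K : set T).
Hypotheses (cK : compact K) (P0 : P (fun=> 0)).
Hypothesis PD : forall f g, P f -> P g -> P (fun x => f x + g x).
Hypothesis P_ge0 : forall f x, P f -> 0 <= f x.
Hypothesis P_cont : forall f, P f -> continuous f.
Hypothesis P_gt0 : forall x, K x -> exists2 f, P f & 0 < f x.

(* Near-covering compactness for the filter of families of [P] dominating a
   given element of [P] turns pointwise positivity into positivity on [K]. *)
Lemma compact_pos : exists2 f, P f & forall x, K x -> 0 < f x.
Proof.
pose F : set_system (T -> R) :=
  [set S | exists2 f, P f & forall g, P g -> (forall x, f x <= g x) -> S g].
have FF : Filter F.
  split; first by exists (fun=> 0).
    move=> S1 S2 [f1 Pf1 H1] [f2 Pf2 H2]; exists (fun x => f1 x + f2 x); first exact: PD.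
    move=> g Pg fg; split; [apply: H1 => // x|apply: H2 => // x].
      by apply: le_trans (fg x); rewrite lerDl; exact: P_ge0.
    by apply: le_trans (fg x); rewrite lerDr; exact: P_ge0.
  by move=> S1 S2 S12 [f Pf H]; exists f => // g Pg fg; apply: S12; exact: H.
have [x Kx|f Pf Hf] := (compact_near_coveringP K).1 cK _ F (fun g x => 0 < g x) FF.
  have [f Pf fx] := P_gt0 Kx.
  exists ([set y | 0 < f y], [set g | P g /\ forall x, f x <= g x]).
    split; last by exists f.
    have H : nbhs (f x) [set t : R | 0 < t].
      by apply: open_nbhs_nbhs; split => //; exact: open_gt.
    exact: (P_cont Pf H).
  by move=> [y g] /= [fy [_ fg]]; exact: lt_le_trans (fg y).
by exists f => // x Kx; exact: Hf.
Qed.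

End CompactPositive.

Section ManifoldSmooth.
Context {R : realType} {n : nat} {X : manifold R n}.
Implicit Types (f g : X -> R) (phi psi : chart R n X) (x : X) (K : set X).

Lemma chart_invP phi y : chart_img phi y ->
  chart_dom phi (chart_inv phi y) /\ chart_map phi (chart_inv phi y) = y.
Proof. by case=> x Dx <-; rewrite chart_mapK ?inE. Qed.

Lemma chart_imgP phi x : chart_dom phi x -> chart_img phi (chart_map phi x).
Proof. by exists x. Qed.

Lemma chart_mapKP phi x : chart_dom phi x -> chart_inv phi (chart_map phi x) = x.
Proof. by move=> Dx; rewrite chart_mapK ?inE. Qed.

Lemma chart_map_continuous phi x : chart_dom phi x -> {for x, continuous (chart_map phi)}.
Proof.
move=> Dx; have := @chart_map_cont _ _ _ phi.
rewrite continuous_open_subspace; last exact: chart_dom_open.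
by apply; rewrite inE.
Qed.

Lemma chart_inv_continuous phi y : chart_img phi y -> {for y, continuous (chart_inv phi)}.
Proof.
move=> Iy; have := @chart_inv_cont _ _ _ phi.
rewrite continuous_open_subspace; last exact: chart_img_open.
by apply; rewrite inE.
Qed.

Lemma chart_inv_nbhs phi y U : chart_img phi y -> open U -> U (chart_inv phi y) ->
  exists O, [/\ open O, O y, O `<=` chart_img phi & forall z, O z -> U (chart_inv phi z)].
Proof.
move=> Iy oU Uy.
have N1 : nbhs y (chart_img phi) by apply: open_nbhs_nbhs; split => //; exact: chart_img_open.
have N2 : nbhs y (chart_inv phi @^-1` U).
  by apply: (chart_inv_continuous Iy); apply: open_nbhs_nbhs.
have N : nbhs y (chart_img phi `&` (chart_inv phi @^-1` U)) by exact: filterI.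
move: N; rewrite nbhsE; case=> O [oO Oy] H.
by exists O; split => // z /H[].
Qed.

Lemma smooth_continuous f : smooth f -> continuous f.
Proof.
move=> sf x; have [phi aphi Dx] := atlas_cover x.
have Ix := chart_imgP Dx.
have c1 := smooth_on_continuous (sf phi aphi) Ix.
have c2 : {for x, continuous ((f \o chart_inv phi) \o chart_map phi)}.
  by apply: continuous_comp => //; exact: chart_map_continuous.
have E : {near x, (f \o chart_inv phi) \o chart_map phi =1 f}.
  have N : nbhs x (chart_dom phi).
    by apply: open_nbhs_nbhs; split => //; exact: chart_dom_open.
  by apply: filterS N => y Dy /=; rewrite chart_mapKP.
move: c2; rewrite /prop_for /continuous_at /= chart_mapKP// => c2.
exact: (cvg_trans (near_eq_cvg E) c2).
Qed.

Lemma smooth_chartwise f :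
  (forall phi y, atlas phi -> chart_img phi y ->
   exists (O : set 'rV[R]_n) (g : 'rV[R]_n -> R), [/\ open O, O y, smooth_on O g &
     forall z, O z -> g z = f (chart_inv phi z)]) -> smooth f.
Proof.
move=> H phi aphi s y Iy; have [ O [g [oO Oy sg gf]]] := H _ _ aphi Iy.
exact: near_smooth oO Oy gf (sg s y Oy).
Qed.

Lemma smooth_comp m (v : X -> 'rV[R]_m) Phi : smooth_map v -> smooth_on setT Phi ->
  smooth (Phi \o v).
Proof.
move=> sv sP phi aphi.
exact: (smooth_on_comp (u := v \o chart_inv phi) (@chart_img_open _ _ _ phi) openT
  (fun _ _ => I) (fun j => sv j phi aphi) sP).
Qed.

Lemma smooth_flat f : smooth f -> smooth (fun x => flat (f x)).
Proof. by move=> sf phi aphi; exact: (smooth_on_flat (@chart_img_open _ _ _ phi) (sf phi aphi)). Qed.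

Lemma smoothV f : smooth f -> (forall x, f x != 0) -> smooth (fun x => (f x)^-1).
Proof.
move=> sf f0 phi aphi; apply: (@smooth_onV _ _ _ (f \o chart_inv phi)).
- exact: chart_img_open.
- exact: sf.
- by move=> x _; exact: f0.
Qed.

Lemma smoothB f g : smooth f -> smooth g -> smooth (fun x => f x - g x).
Proof.
by move=> sf sg phi aphi; exact: (smooth_onB (@chart_img_open _ _ _ phi) (sf phi aphi) (sg phi aphi)).
Qed.

(* [beta / (beta ^+ 2 + flat (m - beta))] is globally smooth and inverts [beta]
   where [m <= beta]. *)
Lemma smooth_inverse_on K beta : compact K -> smooth beta -> (forall x, K x -> 0 < beta x) ->
  exists2 r, smooth r & forall x, K x -> r x * beta x = 1.
Proof.
move=> cK sb b0.
have [m m0 bm] : exists2 m : R, 0 < m & forall x, K x -> m <= beta x.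
  have [/eqP->|/set0P K0] := boolP (K == set0).
    by exists 1 => // x [].
  have cb : {within K, continuous beta}.
    by apply: continuous_subspaceT; exact: smooth_continuous.
  have [c /set_mem Kc Hc] := compact_EVT_min K0 cK cb.
  by exists (beta c) => [|x Kx]; [exact: b0 | apply: Hc; rewrite inE].
pose D x := beta x * beta x + flat (m - beta x).
have sD : smooth D.
  apply: smoothD; first exact: smoothM.
  by apply: smooth_flat; apply: smoothB sb; exact: smooth_cst.
have D0 x : D x != 0.
  rewrite gt_eqF// /D; have [b|b] := ltP 0 (beta x).
    by rewrite ltr_wpDr ?flat_ge0// mulr_gt0.
  by rewrite ltr_wpDl ?flat_gt0 -?expr2 ?sqr_ge0//; lra.
exists (fun x => beta x * (D x)^-1); first exact: smoothM sb (smoothV sD D0).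
move=> x Kx; have bx := bm x Kx.
rewrite /D flat_eq0 ?addr0; last by lra.
by field; rewrite gt_eqF// (lt_le_trans m0).
Qed.

(** A cube bump in a chart, extended by zero. As the manifold is Hausdorff, the compact set [K']
    that carries it is closed, so the extension vanishes on an open set containing the complement of
    the chart domain and is smooth. *)
Lemma chart_bump x0 : exists2 b : test_fun X, forall x, 0 <= b x & 0 < b x0.
Proof.
have [phi aphi Dx0] := atlas_cover x0.
pose y0 := chart_map phi x0; have Iy0 : chart_img phi y0 by exact: chart_imgP.
have : nbhs y0 (chart_img phi).
  by apply: open_nbhs_nbhs; split => //; exact: chart_img_open.
move=> /nbhs_ballP[d /= d0 Hd].
pose r := d / 2; have r0 : 0 < r by rewrite divr_gt0.
pose Q := [set y | `|y0 - y| <= r].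
have QI : Q `<=` chart_img phi.
  move=> y Qy; apply: Hd; rewrite -ball_normE /=; apply: le_lt_trans Qy _.
  by rewrite /r ltr_pdivrMr// ltr_pMr// ltr1n.
pose K' := chart_inv phi @` Q.
have cK' : compact K'.
  apply: continuous_compact; last exact: rV_cball_compact.
  exact: continuous_subspaceW QI (@chart_inv_cont _ _ _ phi).
have clK' : closed K' by apply: compact_closed cK'; exact: manifold_hausdorff.
pose f x := if x \in chart_dom phi then cube_bump y0 r (chart_map phi x) else 0.
have fK x : f x != 0 -> K' x.
  rewrite /f; case: ifPn => [/set_mem Dx|_]; last by rewrite eqxx.
  move=> fx; exists (chart_map phi x); last exact: chart_mapKP.
  rewrite /Q /= leNgt; apply: contraNN fx => rx.
  by rewrite cube_bump_eq0// distrC ltW.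
have sf : smooth f.
  apply: smooth_chartwise => psi y apsi Iy.
  have [Dpsi yE] := chart_invP Iy.
  have [Dy|NDy] := pselect (chart_dom phi (chart_inv psi y)).
    have [ O [oO Oy OI OU]] := chart_inv_nbhs Iy (@chart_dom_open _ _ _ phi) Dy.
    exists O, (cube_bump y0 r \o (fun z => chart_map phi (chart_inv psi z))); split => //.
      have sc j : smooth_on O (fun z => chart_map phi (chart_inv psi z) 0 j).
        apply: smooth_on_subset (atlas_compat apsi aphi j) => z Oz.
        have [Dz zE] := chart_invP (OI z Oz).
        by exists (chart_inv psi z) => //; split => //; exact: OU.
      exact: (smooth_on_comp oO openT (fun _ _ => I) sc (@smooth_cube_bump _ _ y0 r)).
    by move=> z Oz; rewrite /f /= mem_set//; exact: OU.
  have oK : open (~` K') by rewrite openC.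
  have KNy : (~` K') (chart_inv psi y).
    by move=> [z Qz zE]; apply: NDy; rewrite -zE; have [] := chart_invP (QI z Qz).
  have [ O [oO Oy OI OU]] := chart_inv_nbhs Iy oK KNy.
  exists O, (fun=> 0); split => //; first exact: smooth_on_cst.
  move=> z /OU NK; apply/esym/eqP/negPn/negP => /fK; exact: NK.
have cf : compact (tsupport f).
  apply: (subclosed_compact _ cK'); first exact: closed_closure.
  rewrite (closure_id K').1//; apply: closureS => x; exact: fK.
have fV : f \in test_pred X by apply/asboolP.
exists (TestFun fV) => [x|] /=.
  by rewrite /f; case: ifP => // _; exact: cube_bump_ge0.
by rewrite /f mem_set// cube_bump_gt0// subrr normr0.
Qed.

(** A sum of bumps that is positive on [K] is multiplied by a smooth function inverting it on [K].
    As [compact_pos] deals with plain functions, the class records that a test function underlies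
    each member. *)
Lemma test_cutoff K : compact K -> exists chi : test_fun X, forall x, K x -> chi x = 1.
Proof.
move=> cK.
have [||||x Kx|f [sf [f0 [b bf]]] fK] := @compact_pos R X
  (fun f => smooth f /\ (forall x, 0 <= f x) /\ exists b : test_fun X, forall x, b x = f x) K cK.
- by split; [exact: smooth_cst|split => //; exists 0].
- move=> f g [sf [f0 [b bf]]] [sg [g0 [c cg]]]; split; first exact: smoothD.
  split=> [x|]; first by rewrite addr_ge0.
  by exists (b + c) => x; rewrite -bf -cg.
- by move=> f x [_ []].
- by move=> f [sf _]; exact: smooth_continuous.
- have [b b0 bx] := chart_bump x.
  by exists b => //; split; [exact: test_smooth | split => //; exists b].
have [r sr rf] := smooth_inverse_on cK sf fK.
by exists (smul sr b) => x Kx; rewrite /smul /= bf rf.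
Qed.

End ManifoldSmooth.

(** * Multiplication and the topology of test functions *)

Section TestSpace.
Context {R : realType} {n : nat} {X : manifold R n}.
Local Notation V := (test_fun X).
Implicit Types (f g : X -> R) (phi psi : chart R n X) (x : X) (K L : set X) (W : set V).

Lemma test_ext (a b : V) : (forall x, a x = b x) -> a = b.
Proof. by move=> ab; apply: val_inj; apply/funext. Qed.

Lemma test_supp (h : V) x : ~ tsupport h x -> h x = 0.
Proof.
move=> hx; apply/eqP/negPn/negP => h0; apply: hx; exact: subset_closure.
Qed.

Lemma test_compact (h : V) : compact (tsupport h).
Proof. by have /asboolP[] := test_valP h. Qed.

Lemma pderiv_cst0 (s : seq 'I_n) (y : 'rV[R]_n) : pderiv (fun=> 0 : R) s y = 0.
Proof.
elim: s y => [//|i s IH] y.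
rewrite -[LHS]/(pderiv ('D_(delta_mx 0 i) (cst (0 : R))) s y).
by rewrite (_ : 'D_(delta_mx 0 i) (cst (0 : R)) = fun=> 0)//; apply/funext => z; rewrite derive_cst.
Qed.

Lemma pderiv_out f phi s x : chart_dom phi x -> ~ tsupport f x ->
  pderiv (f \o chart_inv phi) s (chart_map phi x) = 0.
Proof.
move=> Dx fx; have Ix := chart_imgP Dx.
have oU : open (~` tsupport f) by rewrite openC; exact: closed_closure.
have Ux : (~` tsupport f) (chart_inv phi (chart_map phi x)) by rewrite chart_mapKP.
have [ O [oO Ox OI OU]] := chart_inv_nbhs Ix oU Ux.
rewrite (eq_pderiv (g := fun=> 0) s oO _ Ox) ?pderiv_cst0// => z /OU fz.
by apply/eqP/negPn/negP => f0; apply: fz; exact: subset_closure.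
Qed.

Lemma chart_compact phi L : compact L -> L `<=` chart_dom phi ->
  compact (chart_map phi @` L) /\ chart_map phi @` L `<=` chart_img phi.
Proof.
move=> cL LD; split; last by move=> _ [x Lx <-]; apply: chart_imgP; exact: LD.
apply: continuous_compact cL.
exact: continuous_subspaceW LD (@chart_map_cont _ _ _ phi).
Qed.

Lemma tsupport_smul g (sg : smooth g) (h : V) : tsupport (smul sg h) `<=` tsupport h.
Proof.
by apply: closureS => x /=; apply: contra_neq => hx; rewrite -[LHS]/(g x * h x) hx mulr0.
Qed.

(** The bridge from approximation on R^d to the test topology: on functions supported in
    [tsupport h], membership in [W] follows from bounds on finitely many derivatives over compact
    sets, and the chain and Leibniz rules derive these from a C^m bound on [Phi] over [E]. *)
Lemma test_nbhd0_mul_small d (u : X -> 'rV[R]_d) (su : smooth_map u) (h : V)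
    (E : set 'rV[R]_d) W : test_nbhd0 W -> (forall x, tsupport h x -> E (u x)) ->
  exists m (e : R), 0 < e /\ forall Phi (sP : smooth_on setT Phi), pbound m E Phi e ->
    W (smul (smooth_comp su sP) h).
Proof.
move=> [_ NW] uE; have [I [phi [L [s [e0 [e00 LP HW]]]]]] := NW _ (@test_compact h).
pose Q i := chart_map (phi i) @` (L i `&` tsupport h).
have QP i : compact (Q i) /\ Q i `<=` chart_img (phi i).
  have [_ cL LD] := LP i; apply: chart_compact.
    by apply: compact_closedI => //; exact: closed_closure.
  by move=> x [/LD].
pose m := \max_i size (s i).
have oI i := @chart_img_open _ _ _ (phi i).
have suj i j : smooth_on (chart_img (phi i)) (fun y => u (chart_inv (phi i) y) 0 j).
  by have [aphi _ _] := LP i; exact: su j (phi i) aphi.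
have sh i : smooth_on (chart_img (phi i)) (h \o chart_inv (phi i)).
  by have [aphi _ _] := LP i; exact: test_smooth h (phi i) aphi.
have /choice[A HA] : forall i, exists A : R, 0 <= A /\
    forall j, pbound m (Q i) (fun y => u (chart_inv (phi i) y) 0 j) A.
  move=> i; have /choice[a Ha] : forall j, exists a : R, 0 <= a /\
      pbound m (Q i) (fun y => u (chart_inv (phi i) y) 0 j) a.
    by move=> j; have [a ? ?] := pbound_exists m (QP i).2 (QP i).1 (suj i j); exists a.
  exists (\sum_j a j); split; first by apply: sumr_ge0 => j _; have [] := Ha j.
  move=> j; apply: pboundW (leqnn m) _ (Ha j).2.
  by rewrite (bigD1 j)//= lerDl sumr_ge0// => l _; have [] := Ha l.
have /choice[H HH] : forall i, exists H : R, 0 <= H /\ pbound m (Q i) (h \o chart_inv (phi i)) H.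
  by move=> i; have [a ? ?] := pbound_exists m (QP i).2 (QP i).1 (sh i); exists a.
have /choice[C HC] : forall i, exists C : R, 0 <= C /\
  forall (Phi : 'rV[R]_d -> R) e, smooth_on setT Phi -> 0 <= e ->
  pbound m E Phi e -> pbound m (Q i) (Phi \o (u \o chart_inv (phi i))) (C * e).
  move=> i; have [C C0 HC] := @pbound_comp R n d m (A i) (HA i).1.
  exists C; split => // Phi e sP ep Pe.
  apply: (HC _ _ _ _ _ _ (oI i) openT (QP i).2 (fun _ _ => Logic.I) (suj i) sP ep (HA i).2).
  apply: pbound_sub Pe => _ [_ [x [Lx hx] <-] <-].
  by have [_ _ LD] := LP i; rewrite /= chart_mapKP; [exact: uE | exact: LD].
(* The constants of the chain and product rules, added over the finitely many seminorms; dividing by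
   [1 + S] leaves every bound strictly below [e0]. *)
pose S := \sum_i 2 ^+ m * C i * H i.
have T0 i : 0 <= 2 ^+ m * C i * H i.
  by rewrite !mulr_ge0 ?exprn_ge0//; [have [] := HC i | have [] := HH i].
have S0 : 0 <= S by apply: sumr_ge0 => i _; exact: T0.
have S1 : 0 < 1 + S by lra.
have e10 : 0 < e0 / (1 + S) by rewrite divr_gt0.
exists m, (e0 / (1 + S)); split=> // Phi sP Pe.
apply: HW => [|i x Lx]; first exact: tsupport_smul.
have [_ _ LD] := LP i.
have [hx|hx] := pselect (tsupport h x); last first.
  rewrite pderiv_out ?normr0//; [exact: LD|].
  by move=> /tsupport_smul; exact.
have PU := (HC i).2 Phi _ sP (ltW e10) Pe.
have sPU := smooth_comp su sP; have [aphi _ _] := LP i.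
have Ci0 : 0 <= C i * (e0 / (1 + S)) by rewrite mulr_ge0 ?(ltW e10)//; have [] := HC i.
have := pboundM (oI i) (QP i).2 Ci0 (HH i).1 (sPU (phi i) aphi) (sh i) PU (HH i).2.
move=> /(_ (s i) (@leq_bigmax _ (fun i => size (s i)) i) (chart_map (phi i) x)) B.
apply: le_lt_trans (B _) _; first by exists x.
have -> : 2 ^+ m * (C i * (e0 / (1 + S))) * H i = e0 * ((2 ^+ m * C i * H i) / (1 + S)).
  by field; rewrite gt_eqF.
rewrite gtr_pMr// ltr_pdivrMr// mul1r /S (bigD1 i)//=.
have : 0 <= \sum_(j | j != i) 2 ^+ m * C j * H j by apply: sumr_ge0 => j _; exact: T0.
lra.
Qed.

Lemma test_nbhd0_smul g (sg : smooth g) W : test_nbhd0 W -> test_nbhd0 [set h | W (smul sg h)].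
Proof.
move=> [aW NW]; split=> [a b f h /= Wf Wh ab|K cK].
  have -> : smul sg (a *: f + b *: h) = a *: smul sg f + b *: smul sg h.
    apply: test_ext => x; rewrite -[LHS]/(g x * (a * f x + b * h x)).
    by rewrite -[RHS]/(a * (g x * f x) + b * (g x * h x)); ring.
  exact: aW.
have [I [phi [L [s [e0 [e00 LP HW]]]]]] := NW _ cK.
pose m := \max_i size (s i).
pose Q i := chart_map (phi i) @` L i.
have QP i : compact (Q i) /\ Q i `<=` chart_img (phi i).
  by have [_ cL LD] := LP i; exact: chart_compact.
have oI i := @chart_img_open _ _ _ (phi i).
have sgi i : smooth_on (chart_img (phi i)) (g \o chart_inv (phi i)).
  by have [aphi _ _] := LP i; exact: sg (phi i) aphi.
have /choice[G HG] : forall i, exists G : R, 0 <= G /\ pbound m (Q i) (g \o chart_inv (phi i)) G.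
  by move=> i; have [a ? ?] := pbound_exists m (QP i).2 (QP i).1 (sgi i); exists a.
pose S := \sum_i 2 ^+ m * G i.
have T0 i : 0 <= 2 ^+ m * G i by rewrite mulr_ge0 ?exprn_ge0//; have [] := HG i.
have S0 : 0 <= S by apply: sumr_ge0 => i _; exact: T0.
have S1 : 0 < 1 + S by lra.
have e10 : 0 < e0 / (1 + S) by rewrite divr_gt0.
(* By the Leibniz rule a derivative of the product involves all derivatives of the test function up
   to that order, so the new neighbourhood is indexed by every list of length at most [m]. *)
exists (I * m.-bseq 'I_n)%type, (fun it => phi it.1), (fun it => L it.1), (fun it : (I * m.-bseq 'I_n)%type => bseqval it.2),
  (e0 / (1 + S)); split=> // f fK fe.
apply: HW => [|i x Lx]; first exact: subset_trans (@tsupport_smul _ sg f) fK.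
have [aphi _ _] := LP i.
have Pf : pbound m (Q i) (f \o chart_inv (phi i)) (e0 / (1 + S)).
  move=> t tm _ [z Lz <-]; apply: ltW.
  exact: (fe (i, Bseq tm) z Lz).
have := pboundM (oI i) (QP i).2 (HG i).1 (ltW e10) (sgi i) (test_smooth f aphi) (HG i).2 Pf.
move=> /(_ (s i) (@leq_bigmax _ (fun i => size (s i)) i) (chart_map (phi i) x)) B.
apply: le_lt_trans (B _) _; first by exists x.
have -> : 2 ^+ m * G i * (e0 / (1 + S)) = e0 * ((2 ^+ m * G i) / (1 + S)).
  by field; rewrite gt_eqF.
rewrite gtr_pMr// ltr_pdivrMr// mul1r /S (bigD1 i)//=.
have : 0 <= \sum_(j | j != i) 2 ^+ m * G j by apply: sumr_ge0 => j _; exact: T0.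
lra.
Qed.

Lemma smul_continuous g (sg : smooth g) : continuous (smul sg : V -> V).
Proof.
move=> f U /nbhs_testP[W NW WU]; apply/nbhs_testP.
exists [set h | W (smul sg h)]; first exact: test_nbhd0_smul.
move=> h /= Wh; have -> : smul sg (f + h) = smul sg f + smul sg h.
  apply: test_ext => x; rewrite -[LHS]/(g x * (f x + h x)).
  by rewrite -[RHS]/(g x * f x + g x * h x) mulrDr.
exact: WU.
Qed.

Lemma nbhd0_onS K W W' : nbhd0_on K W ->
  (forall f : V, tsupport f `<=` K -> W f -> W' f) -> nbhd0_on K W'.
Proof.
move=> [I [phi [L [s [e [e0 LP HW]]]]]] WW'.
exists I, phi, L, s, e; split => // f fK fe; apply: WW' => //; exact: HW.
Qed.

Lemma test_nbhs0P W : nbhs (0 : V) W <-> exists2 W', test_nbhd0 W' & W' `<=` W.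
Proof.
split=> [/nbhs_testP[W' NW' H]|[W' NW' H]].
  by exists W' => // g /H; rewrite add0r.
by apply/nbhs_testP; exists W' => // g /H; rewrite add0r.
Qed.

Lemma linear_test_continuous (l : {linear V -> R^o}) :
  (forall e : R, 0 < e -> test_nbhd0 [set h | `|l h| < e]) -> continuous l.
Proof.
move=> Hl f; apply/(@cvgrPdist_lt _ _ _ (nbhs f)) => e e0.
apply/nbhs_testP; exists [set h | `|l h| < e]; first exact: Hl.
by move=> h /= hl; rewrite linearD opprD addNKr normrN.
Qed.

End TestSpace.

(** * Gateaux calculus *)

Section TvsCalculus.
Context {R : realType} {V : tvsType R}.
Implicit Types (u c : V -> R) (f h k : V) (M U : set V).

Lemma tvs_cvgD {T : Type} (F : set_system T) {FF : Filter F} (p q : T -> V) (a b : V) :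
  p @ F --> a -> q @ F --> b -> (fun t => p t + q t) @ F --> a + b.
Proof.
move=> pa qb; apply: (@cvg_comp _ _ _ (fun t => (p t, q t)) (fun z : V * V => z.1 + z.2)).
  exact: cvg_pair pa qb.
exact: (@add_continuous V (a, b)).
Qed.

Lemma tvs_cvgZ {T : Type} (F : set_system T) {FF : Filter F} (p : T -> R) (q : T -> V)
    (a : R) (b : V) :
  p @ F --> a -> q @ F --> b -> (fun t => p t *: q t) @ F --> a *: b.
Proof.
move=> pa qb; apply: (@cvg_comp _ _ _ (fun t => (p t : R^o, q t)) (fun z : R^o * V => z.1 *: z.2)).
  exact: (@cvg_pair _ R^o _ _ _ _ _ _ _ _ _ pa qb).
exact: (@scale_continuous R V (a : R^o, b)).
Qed.

Lemma line_continuous f h : continuous (fun t : R => f + t *: h).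
Proof.
move=> t; apply: (tvs_cvgD (F := nbhs t)); first exact: cst_continuous.
by apply: (tvs_cvgZ (F := nbhs t)); [exact: cvg_id | exact: cst_continuous].
Qed.

Lemma open_line M f h : open M -> M f -> exists2 d : R, 0 < d &
  forall t, `|t| < d -> M (f + t *: h).
Proof.
move=> oM Mf; have : nbhs (0 : R) [set t : R | M (f + t *: h)].
  apply: (@line_continuous f h 0); rewrite scale0r addr0; exact: open_nbhs_nbhs.
move=> /nbhs_ballP[d /= d0 Hd]; exists d => // t td; apply: Hd.
by rewrite -ball_normE /= sub0r normrN.
Qed.

Lemma near_line M f h : open M -> M f -> \forall t \near (0 : R), M (f + t *: h).
Proof.
move=> oM Mf; apply: (@line_continuous f h 0); rewrite scale0r addr0; exact: open_nbhs_nbhs.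
Qed.

Definition gderivable M u := forall f h, M f -> derivable (fun t : R => u (f + t *: h)) 0 1.

Lemma gateauxE u f h : gateaux u f h = 'D_1 (fun t : R => u (f + t *: h)) 0.
Proof. by rewrite /gateaux derive1E. Qed.

Lemma is_derive_gateaux M u f h (t : R) : gderivable M u -> M (f + t *: h) ->
  is_derive t 1 (fun s : R => u (f + s *: h)) (gateaux u (f + t *: h) h).
Proof.
move=> du Mt; have := du _ h Mt; rewrite gateauxE.
have Q : (fun a => a^-1 *: (((fun s : R => u (f + t *: h + s *: h)) \o shift 0) (a *: 1)
     - u (f + t *: h + 0 *: h))) =
  (fun a => a^-1 *: (((fun s : R => u (f + s *: h)) \o shift t) (a *: 1) - u (f + t *: h))).
  apply/funext => a; rewrite /= addr0 scale0r addr0 [a *: 1]mulr1 scalerDl.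
  by rewrite -addrA (addrC (t *: h)).
by rewrite /derivable Q => D; split => //; rewrite [in RHS]/derive Q.
Qed.

Lemma gateaux_near M u w f h : open M -> M f -> (forall g, M g -> u g = w g) ->
  gateaux u f h = gateaux w f h /\
  (derivable (fun t : R => u (f + t *: h)) 0 1 -> derivable (fun t : R => w (f + t *: h)) 0 1).
Proof.
move=> oM Mf uw.
have E : {near (0 : R), (fun t : R => u (f + t *: h)) =1 (fun t : R => w (f + t *: h))}.
  by have := near_line h oM Mf; apply: filterS => t; exact: uw.
split; last exact: near_eq_derivable.
by rewrite !gateauxE; exact: near_eq_derive.
Qed.

Lemma gateaux_cvgP u f h (l : R) :
  (fun t : R => t^-1 * (u (f + t *: h) - u f)) @ 0^' --> l <->
  derivable (fun t : R => u (f + t *: h)) 0 1 /\ gateaux u f h = l.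
Proof.
have Q : (fun t : R => t^-1 * (u (f + t *: h) - u f)) =
  (fun a => a^-1 *: (((fun s : R => u (f + s *: h)) \o shift 0) (a *: 1) - u (f + (0 : R) *: h))).
  by apply/funext => t; rewrite /= addr0 scale0r addr0 [t *: 1]mulr1.
rewrite gateauxE /derivable /derive Q; split=> [L|[D <-]].
  by split; [apply/cvg_ex; exists l; exact: L | exact: (cvg_lim _ L)].
exact: D.
Qed.

Lemma gateauxZ M u f h (a : R) : gderivable M u -> M f ->
  gateaux u f (a *: h) = a * gateaux u f h.
Proof.
move=> du Mf.
have d0 : is_derive (0 * a) 1 (fun s : R => u (f + s *: h)) (gateaux u f h).
  have := @is_derive_gateaux M u f h 0 du; rewrite mul0r scale0r addr0; exact.
have dm : is_derive (0 : R) 1 (fun s : R => s * a) a.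
  have := is_deriveM (is_derive_id (0 : R) 1) (is_derive_cst a (0 : R) 1).
  by move/is_derive_eq; apply; rewrite scaler0 add0r /cst -[LHS]/(a * 1) mulr1.
have [_ D] := @is_derive1_comp _ _ (fun s : R => s * a) _ _ _ d0 dm.
rewrite gateauxE mulrC -D.
suff -> : (fun t : R => u (f + t *: (a *: h))) = (fun s : R => u (f + s *: h)) \o (fun s : R => s * a) by [].
by apply/funext => t /=; rewrite scalerA.
Qed.

Lemma gateaux_MVT M u f h : gderivable M u -> (forall t : R, 0 <= t <= 1 -> M (f + t *: h)) ->
  exists2 t, 0 <= t <= 1 & u (f + h) - u f = gateaux u (f + t *: h) h.
Proof.
move=> du Mt; have [t t01|t t01 tE] := @MVT01 R (fun s => u (f + s *: h))
    (fun s => gateaux u (f + s *: h) h).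
  by apply: is_derive_gateaux du _; exact: Mt.
by exists t => //; rewrite -tE scale1r scale0r addr0.
Qed.

(** Additivity is not automatic for Gateaux derivatives. The increment along [h + k] is split at
    [f + t h]; by the mean value theorem its second part is a derivative in the direction [k] at a
    point tending to [f], where continuity applies. *)
Lemma gateauxD M u f h k : open M -> gderivable M u -> M f ->
  {for f, continuous (fun f => gateaux u f k)} ->
  gateaux u f (h + k) = gateaux u f h + gateaux u f k.
Proof.
move=> oM du Mf ck.
have q1 := (gateaux_cvgP u f h _).2 (conj (du f h Mf) erefl).
have [d d0 Hd] : exists2 d : R, 0 < d & forall s t : R, `|s| < d -> `|t| < d ->
    M (f + (s *: h + t *: k)).
  have : nbhs ((0, 0) : R * R) [set p : R * R | M (f + (p.1 *: h + p.2 *: k))].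
    have c : (fun p : R * R => f + (p.1 *: h + p.2 *: k)) @ nbhs ((0,0) : R * R) -->
        f + ((0 : R) *: h + (0 : R) *: k).
      apply: tvs_cvgD; first exact: cst_continuous.
      apply: tvs_cvgD; apply: tvs_cvgZ;
        [exact: cvg_fst|exact: cst_continuous|exact: cvg_snd|exact: cst_continuous].
    have Nf : nbhs (f + ((0 : R) *: h + (0 : R) *: k)) M.
      by rewrite !scale0r !addr0; exact: open_nbhs_nbhs.
    exact: (c _ Nf).
  move=> /nbhs_ballP[d /= d0 Hd]; exists d => // s t sd td; apply: (Hd (s, t)).
  by split; rewrite /= -ball_normE /= sub0r normrN.
have q2 : (fun t : R => t^-1 * (u (f + t *: (h + k)) - u (f + t *: h))) @ 0^' --> gateaux u f k.
  apply/cvgrPdist_le => e e0.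
  have : nbhs f [set g | `|gateaux u f k - gateaux u g k| <= e].
    by move: ck => /(@cvgrPdist_le _ _ _ (nbhs f)) /(_ e e0).
  move=> ckn.
  have : nbhs ((0, 0) : R * R) [set p : R * R |
      `|gateaux u f k - gateaux u (f + (p.1 *: h + p.2 *: k)) k| <= e].
    have c : (fun p : R * R => f + (p.1 *: h + p.2 *: k)) @ nbhs ((0,0) : R * R) -->
        f + ((0 : R) *: h + (0 : R) *: k).
      apply: tvs_cvgD; first exact: cst_continuous.
      apply: tvs_cvgD; apply: tvs_cvgZ;
        [exact: cvg_fst|exact: cst_continuous|exact: cvg_snd|exact: cst_continuous].
    have Nf : nbhs (f + ((0 : R) *: h + (0 : R) *: k)) [set g | `|gateaux u f k - gateaux u g k| <= e].
      by rewrite !scale0r !addr0.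
    exact: (c _ Nf).
  move=> /nbhs_ballP[d' /= d'0 Hd'].
  near=> t.
  have t0 : t != 0 by near: t; exact: nbhs_dnbhs_neq.
  have td : `|t| < Num.min d d' by near: t; apply: dnbhs0_lt; rewrite lt_min d0.
  have [td1 td2] : `|t| < d /\ `|t| < d' by move: td; rewrite lt_min => /andP[].
  have st (s : R) : 0 <= s <= 1 -> f + t *: h + s *: (t *: k) = f + (t *: h + (s * t) *: k).
    by rewrite scalerA addrA.
  have sd (s b : R) : 0 <= s <= 1 -> `|t| < b -> `|s * t| < b.
    by move=> /andP[s0 s1]; apply: le_lt_trans; rewrite normrM ger0_norm// ler_piMl.
  have [s s01|s s01] := @gateaux_MVT M u (f + t *: h) (t *: k) du.
    by rewrite st//; apply: Hd => //; exact: sd.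
  rewrite -addrA -scalerDr => ->; rewrite (gateauxZ k t du); last first.
    by rewrite st//; apply: Hd => //; exact: sd.
  rewrite mulKf// st//; apply: (Hd' (t, s * t)).
  by split; rewrite /= -ball_normE /= sub0r normrN//; exact: sd.
have q3 : (fun t : R => t^-1 * (u (f + t *: (h + k)) - u f)) @ 0^' --> gateaux u f k + gateaux u f h.
  have -> : (fun t : R => t^-1 * (u (f + t *: (h + k)) - u f)) =
    (fun t : R => t^-1 * (u (f + t *: (h + k)) - u (f + t *: h)) + t^-1 * (u (f + t *: h) - u f)).
    by apply/funext => t; rewrite -mulrDr subrKA.
  exact: cvgD q2 q1.
by have [_ ->] := (gateaux_cvgP u f (h + k) _).1 q3; rewrite addrC.
Unshelve. all: by end_near. Qed.

Lemma gateaux_sym M u f h k : open M -> M f -> gderivable M u ->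
  gderivable M (fun f => gateaux u f h) -> gderivable M (fun f => gateaux u f k) ->
  {for f, continuous (fun f => gateaux (fun f => gateaux u f h) f k)} ->
  {for f, continuous (fun f => gateaux (fun f => gateaux u f k) f h)} ->
  gateaux (fun f => gateaux u f h) f k = gateaux (fun f => gateaux u f k) f h.
Proof.
move=> oM Mf du duh duk chk ckh.
pose P (s t : R) := f + (s *: h + t *: k).
have P00 : P 0 0 = f by rewrite /P !scale0r !addr0.
have near_P (S : set V) : nbhs f S -> exists2 d : R, 0 < d & forall s t : R, `|s| <= d -> `|t| <= d ->
    S (P s t).
  move=> Sf; have : nbhs ((0, 0) : R * R) [set p : R * R | S (P p.1 p.2)].
    have c : (fun p : R * R => P p.1 p.2) @ nbhs ((0,0) : R * R) --> P 0 0.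
      apply: tvs_cvgD; first exact: cst_continuous.
      apply: tvs_cvgD; apply: tvs_cvgZ;
        [exact: cvg_fst|exact: cst_continuous|exact: cvg_snd|exact: cst_continuous].
    have Nf : nbhs (P 0 0) S by rewrite P00.
    exact: (c _ Nf).
  move=> /nbhs_ballP[d /= d0 Hd]; exists (d / 2); first by rewrite divr_gt0.
  have d2 : d / 2 < d by lra.
  move=> s t sd td; apply: (Hd (s, t)).
  by split; rewrite /= -ball_normE /= sub0r normrN; apply: le_lt_trans d2.
have [d d0 Hd] := near_P M (open_nbhs_nbhs (conj oM Mf)).
have nn (s b : R) : 0 <= s <= b -> `|s| <= b by move=> /andP[s0 sb]; rewrite ger0_norm.
have := @schwarz2 R (fun s t => u (P s t)) (fun s t => gateaux u (P s t) h)
  (fun s t => gateaux u (P s t) k) (fun s t => gateaux (fun f => gateaux u f h) (P s t) k)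
  (fun s t => gateaux (fun f => gateaux u f k) (P s t) h) d d0.
rewrite /= P00; apply.
  move=> s t /nn sd /nn td; have MP := Hd s t sd td.
  have PEs a b : P a b = (f + b *: k) + a *: h by rewrite /P addrA addrAC.
  have PEt a b : P a b = (f + a *: h) + b *: k by rewrite /P addrA.
  have ds w : gderivable M w -> is_derive s 1 (fun s => w (P s t)) (gateaux w (P s t) h).
    move=> dw; have -> : (fun s => w (P s t)) = (fun s : R => w ((f + t *: k) + s *: h)).
      by apply/funext => a; rewrite PEs.
    by rewrite PEs; apply: is_derive_gateaux dw _; rewrite -PEs.
  have dt w : gderivable M w -> is_derive t 1 (fun t => w (P s t)) (gateaux w (P s t) k).
    move=> dw; have -> : (fun t => w (P s t)) = (fun t : R => w ((f + s *: h) + t *: k)).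
      by apply/funext => a; rewrite PEt.
    by rewrite PEt; apply: is_derive_gateaux dw _; rewrite -PEt.
  split; [exact: (ds u du) | exact: (dt _ duh) | exact: (dt u du) | exact: (ds _ duk)].
move=> e e0.
have N1 : nbhs f [set g | `|gateaux (fun f => gateaux u f h) f k - gateaux (fun f => gateaux u f h) g k| <= e].
  by move: chk => /(@cvgrPdist_le _ _ _ (nbhs f)) /(_ e e0).
have N2 : nbhs f [set g | `|gateaux (fun f => gateaux u f k) f h - gateaux (fun f => gateaux u f k) g h| <= e].
  by move: ckh => /(@cvgrPdist_le _ _ _ (nbhs f)) /(_ e e0).
have [r r0 Hr] := near_P _ (filterI N1 N2).
exists r => // s t /nn sr /nn tr; have [H1 H2] := Hr s t sr tr.
by split; rewrite distrC; [exact: H1 | exact: H2].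
Qed.

Lemma rV_cvg {T : Type} (F : set_system T) {FF : Filter F} m (p : T -> 'rV[V]_m) (l : 'rV[V]_m) :
  (forall i, (fun t => p t 0 i) @ F --> l 0 i) -> p @ F --> l.
Proof.
move=> pl A [Q Ql QA].
have H i : \forall t \near F, Q 0 i (p t 0 i) by apply: (pl i); exact: Ql.
have := filter_forall FF H; apply: filterS => t Ht; apply: QA => i j.
by rewrite ord1; exact: Ht.
Qed.

Lemma coord_cvg m (p : 'rV[V]_m) i : (fun q : 'rV[V]_m => q 0 i) @ nbhs p --> p 0 i.
Proof.
move=> A Ap; exists (fun _ j => if j == i then A else setT) => [a j|q /(_ 0 i)].
  rewrite ord1; case: eqVneq => [->//|_]; exact: filterT.
by rewrite eqxx.
Qed.

Section SmoothIn.
Variables (M : set V) (c : V -> R).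
Hypotheses (oM : open M) (sc : smooth_in M c).

Lemma smooth_in_gderivable (hs : seq V) : gderivable M (gateaux_n c hs).
Proof. by move=> f h Mf; have [/(_ (in_tuple hs) f h Mf)] := sc (size hs). Qed.

(* Joint continuity of the iterated derivatives, stated for directions that
   are continuous functions of a parameter. *)
Lemma smooth_in_cvg {T : Type} (F : set_system T) {FF : Filter F} (p : T -> V) (f : V)
    (hs : seq (T -> V)) (ks : seq V) : M f -> p @ F --> f -> size hs = size ks ->
  (forall i, (i < size ks)%N -> (fun t => nth 0 [seq (g t : V) | g <- hs] i) @ F --> nth 0 ks i) ->
  (fun t => gateaux_n c [seq (g t : V) | g <- hs] (p t)) @ F --> gateaux_n c ks f.
Proof.
move=> Mf pf hk Hh; set m := size ks.
pose row (l : seq V) : 'rV[V]_m := \row_(i < m) nth 0 l i.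
have rowE l : size l = m -> [seq (row l) 0 i | i : 'I_m] = l.
  move=> lm; apply: (@eq_from_nth _ 0); first by rewrite size_map size_enum_ord.
  move=> i; rewrite size_map size_enum_ord => im.
  rewrite (nth_map (Ordinal im)) ?size_enum_ord// mxE.
  by rewrite nth_enum_ord.
have [_ cm] := sc m.
have := cm (f, row ks) Mf; rewrite /prop_for /continuous_at /= rowE// => C.
have E : (fun t => gateaux_n c [seq (g t : V) | g <- hs] (p t)) =
  (fun q : V * 'rV[V]_m => gateaux_n c [seq q.2 0 i | i : 'I_m] q.1) \o
  (fun t => (p t, row [seq (g t : V) | g <- hs])).
  by apply/funext => t /=; rewrite rowE// size_map.
have rc : (fun t => row [seq (g t : V) | g <- hs]) @ F --> row ks.
  apply: rV_cvg => i; rewrite /row mxE.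
  have -> : (fun t => (\row_(i < m) nth 0 [seq (g t : V) | g <- hs] i) 0 i) =
      (fun t => nth 0 [seq (g t : V) | g <- hs] i).
    by apply/funext => t; rewrite mxE.
  exact: Hh.
have pr : (fun t => (p t, row [seq (g t : V) | g <- hs])) @ F --> (f, row ks).
  exact: cvg_pair pf rc.
rewrite E; exact: (cvg_comp _ _ pr C).
Qed.

Lemma smooth_in_cvg1 {T : Type} (F : set_system T) {FF : Filter F} (p h : T -> V) (f k : V) :
  M f -> p @ F --> f -> h @ F --> k ->
  (fun t => gateaux c (p t) (h t)) @ F --> gateaux c f k.
Proof.
move=> Mf pf hk; apply: (@smooth_in_cvg _ F _ p f [:: h] [:: k] Mf pf erefl) => -[|//] _.
exact: hk.
Qed.

Lemma smooth_in_cvg2 {T : Type} (F : set_system T) {FF : Filter F} (p h1 h2 : T -> V) (f k1 k2 : V) :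
  M f -> p @ F --> f -> h1 @ F --> k1 -> h2 @ F --> k2 ->
  (fun t => gateaux_n c [:: h1 t; h2 t] (p t)) @ F --> gateaux_n c [:: k1; k2] f.
Proof.
move=> Mf pf hk1 hk2.
apply: (@smooth_in_cvg _ F _ p f [:: h1; h2] [:: k1; k2] Mf pf erefl) => -[_|[|//] _].
  exact: hk1.
exact: hk2.
Qed.

Lemma gateaux_n_near (a b : V -> R) (hs : seq V) : (forall g, M g -> a g = b g) ->
  forall g, M g -> gateaux_n a hs g = gateaux_n b hs g.
Proof.
elim: hs a b => [|h hs IH] a b ab g Mg; first exact: ab.
by apply: IH => // g' Mg'; have [] := gateaux_near h oM Mg' ab.
Qed.

Lemma smooth_in_gateauxD f h k : M f -> gateaux c f (h + k) = gateaux c f h + gateaux c f k.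
Proof.
move=> Mf; apply: (@gateauxD M c f h k oM (@smooth_in_gderivable [::]) Mf).
by apply: (smooth_in_cvg1 (F := nbhs f)) => //; exact: cst_continuous.
Qed.

Lemma smooth_in_gateauxZ f h (a : R) : M f -> gateaux c f (a *: h) = a * gateaux c f h.
Proof. exact: (@gateauxZ M c f h a (@smooth_in_gderivable [::])). Qed.

Lemma gateaux2_sym f h k : M f -> gateaux_n c [:: h; k] f = gateaux_n c [:: k; h] f.
Proof.
move=> Mf; apply: (@gateaux_sym M c f h k oM Mf (@smooth_in_gderivable [::])
  (@smooth_in_gderivable [:: h]) (@smooth_in_gderivable [:: k])).
  by apply: (smooth_in_cvg2 (F := nbhs f)) => //; exact: cst_continuous.
by apply: (smooth_in_cvg2 (F := nbhs f)) => //; exact: cst_continuous.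
Qed.

(** As [gateaux_n] differentiates along the head of the list first, [gateauxD] gives additivity in
    the last direction; symmetry carries it to the first. *)
Lemma gateaux2Dl f h1 h2 k : M f ->
  gateaux_n c [:: h1 + h2; k] f = gateaux_n c [:: h1; k] f + gateaux_n c [:: h2; k] f.
Proof.
move=> Mf; rewrite !(gateaux2_sym _ k)//.
apply: (@gateauxD M (fun f => gateaux c f k) f h1 h2 oM (@smooth_in_gderivable [:: k]) Mf).
by apply: (smooth_in_cvg2 (F := nbhs f)) => //; exact: cst_continuous.
Qed.

Lemma gateaux2Zl f h k (a : R) : M f ->
  gateaux_n c [:: a *: h; k] f = a * gateaux_n c [:: h; k] f.
Proof.
move=> Mf; rewrite !(gateaux2_sym _ k)//.
exact: (@gateauxZ M (fun f => gateaux c f k) f h a (@smooth_in_gderivable [:: k]) Mf).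
Qed.

End SmoothIn.

End TvsCalculus.

(** * Primitives of closed 1-forms *)

Section LocalPrimitive.
Context {R : realType} {V : tvsType R}.

Lemma primitive_exists (g : R -> R) : continuous g ->
  exists G : R -> R, forall t : R, 0 <= t <= 1 -> is_derive t 1 G (g t).
Proof.
(* Integrating from -1, inside [[-1, 2]], makes 0 and 1 interior points, so that the derivative
   there is two-sided. *)
move=> cg; exists (fun x => \int[lebesgue_measure]_(t in `[-1, x]) g t)%R => t /andP[t0 t1].
have t2 : t < 2 by lra.
have ig : lebesgue_measure.-integrable `[-1, 2] (EFin \o g).
  apply: continuous_compact_integrable; first exact: segment_compact.
  exact: continuous_subspaceT.
have [|dF FE] := @continuous_FTC1_closed R g (-1) t 2 t2 ig _ (cg t); first by lra.
by split; [exact: dF | rewrite -FE derive1E].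
Qed.

Definition clamp (t : R) : R := Num.max 0 (Num.min 1 t).

Lemma clamp_id t : 0 <= t <= 1 -> clamp t = t.
Proof. by move=> /andP[t0 t1]; rewrite /clamp min_r// max_r. Qed.

Lemma clamp_itv t : 0 <= clamp t <= 1.
Proof.
rewrite /clamp le_max lexx /= ge_max ler01 /=.
by rewrite ge_min lexx.
Qed.

Lemma clamp_continuous : continuous clamp.
Proof.
move=> t.
have c0 (x : R) : {for t, continuous (cst x : R -> R)} by exact: cst_continuous.
have ci : {for t, continuous (id : R -> R)} by exact: cvg_id.
have c1 := @continuous_min R R (cst 1) id t (c0 1) ci.
exact: (@continuous_max R R (cst 0) (cst 1 \min id) t (c0 0) c1).
Qed.

Definition segment_convex (U : set V) := forall a b (t : R), U a -> U b -> 0 <= t <= 1 ->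
  U (a + t *: (b - a)).

Variables (M : set V) (w : V -> V -> R).
(** [w] is a 1-form on [M] and [q] its derivative; [q_sym] expresses that [w] is closed. *)
Let q f h k := gateaux (fun f => w f h) f k.
Hypothesis oM : open M.
Hypothesis wD : forall f h k, M f -> w f (h + k) = w f h + w f k.
Hypothesis wZ : forall f h (a : R), M f -> w f (a *: h) = a * w f h.
Hypothesis w_cvg : forall (T : Type) (F : set_system T) (FF : Filter F) (p h : T -> V) f k,
  M f -> p @ F --> f -> h @ F --> k -> (fun t => w (p t) (h t)) @ F --> w f k.
Hypothesis w_der : forall h, gderivable M (fun f => w f h).
Hypothesis q_cvg : forall (T : Type) (F : set_system T) (FF : Filter F) (p h k : T -> V) f h0 k0,
  M f -> p @ F --> f -> h @ F --> h0 -> k @ F --> k0 ->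
  (fun t => q (p t) (h t) (k t)) @ F --> q f h0 k0.
Hypothesis q_sym : forall f h k, M f -> q f h k = q f k h.

(* [clamp] extends the integrand on [0, 1] to a continuous function on the line. *)
Definition seg_form a b (t : R) := w (a + clamp t *: (b - a)) (b - a).

(* The integral of [seg_form a b] over [0, 1], expressed through any primitive so
   that only the mean value theorem is needed (0 if there is no primitive). *)
Definition seg_int a b : R := xget 0 [set l | exists2 G : R -> R,
  forall t : R, 0 <= t <= 1 -> is_derive t 1 G (seg_form a b t) & l = G 1 - G 0].

Section Convex.
Variable U : set V.
Hypotheses (oU : open U) (cU : segment_convex U) (UM : U `<=` M).

Lemma seg_intP a b : U a -> U b -> exists2 G : R -> R,
  forall t : R, 0 <= t <= 1 -> is_derive t 1 G (seg_form a b t) & seg_int a b = G 1 - G 0.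
Proof.
move=> Ua Ub; have [|G HG] := @primitive_exists (seg_form a b).
  move=> t; apply: (w_cvg (F := nbhs t)); last exact: cst_continuous.
    by apply: UM; apply: cU => //; exact: clamp_itv.
  apply: (tvs_cvgD (F := nbhs t)); first exact: cst_continuous.
  by apply: (tvs_cvgZ (F := nbhs t)); [exact: clamp_continuous | exact: cst_continuous].
by apply: (@xgetPex _ 0 [set l | exists2 G : R -> R,
  forall t : R, 0 <= t <= 1 -> is_derive t 1 G (seg_form a b t) & l = G 1 - G 0]);
  exists (G 1 - G 0), G.
Qed.

(** Differentiation under the integral sign, carried out on primitives. At [s = 0] closedness turns
    the [s]-derivative of the integrand into the [t]-derivative of [m], whose increment over
    [[0, 1]] is [w b k]. *)
Lemma seg_int_derive a b k : U a -> U b ->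
  (fun s : R => s^-1 * (seg_int a (b + s *: k) - seg_int a b)) @ 0^' --> w b k.
Proof.
move=> Ua Ub.
pose p (t : R) := a + t *: (b - a).
pose z (s t : R) := p t + (s * t) *: k.
(* [r t s] is the integrand on the segment from [a] to [b + s k], [rho] its derivative in [s], and
   [m] a primitive in [t] of [rho 0]. *)
pose rho (s t : R) := t * q (z s t) (b - a) k + w (z s t) k + s * t * q (z s t) k k.
pose r (t s : R) := w (z s t) (b - a) + s * w (z s t) k.
pose m (t : R) := t * w (p t) k.
have [d d0 Hd] := open_line k oU Ub.
have zE s t : z s t = a + t *: ((b + s *: k) - a).
  by rewrite /z /p -addrA; congr (_ + _); rewrite mulrC -scalerA -scalerDr addrAC.
have zU (s t : R) : `|s| < d -> 0 <= t <= 1 -> U (z s t).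
  by move=> sd t01; rewrite zE; apply: cU => //; exact: Hd.
have z0 t : z 0 t = p t by rewrite /z mul0r scale0r addr0.
have dr (s t : R) : `|s| < d -> 0 <= t <= 1 -> is_derive s 1 (r t) (rho s t).
  move=> sd t01; have zM := UM (zU s t sd t01).
  have zl : (fun s => z s t) = (fun s : R => p t + s *: (t *: k)).
    by apply/funext => x; rewrite /z scalerA.
  have dw h : is_derive s 1 (fun s => w (z s t) h) (t * q (z s t) h k).
    rewrite (_ : (fun s => w (z s t) h) = fun s : R => w (p t + s *: (t *: k)) h); last first.
      by apply/funext => x; rewrite /z scalerA.
    have := @is_derive_gateaux _ _ M (fun f => w f h) (p t) (t *: k) s (@w_der h).
    rewrite scalerA => /(_ zM) /is_derive_eq; apply.
    exact: (@gateauxZ _ _ M (fun f => w f h) (z s t) k t (@w_der h) zM).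
  have := is_deriveD (dw (b - a)) (is_deriveM (is_derive_id s 1) (dw k)).
  move/is_derive_eq; apply; have scE (x y : R) : x *: y = x * y by [].
  by rewrite !scE /rho /=; ring.
have dm (t : R) : 0 <= t <= 1 -> is_derive t 1 m (rho 0 t).
  move=> t01; have pM : M (p t) by rewrite -z0; apply: UM; apply: zU => //; rewrite normr0.
  have dw := @is_derive_gateaux _ _ M (fun f => w f k) a (b - a) t (@w_der k) pM.
  have := is_deriveM (is_derive_id t 1) dw.
  move/is_derive_eq; apply; have scE (x y : R) : x *: y = x * y by [].
  rewrite !scE /rho z0 /= -/(p t) -/(q (p t) k (b - a)) (q_sym k)//; ring.
(* Near-covering compactness of [[0, 1]] makes the continuity of [rho] at [s = 0] uniform in [t]. *)
have unif (e : R) : 0 < e -> \forall s \near (0 : R), forall t : R, 0 <= t <= 1 ->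
    `|rho s t - rho 0 t| <= e.
  move=> e0; have e20 : 0 < e / 2 by rewrite divr_gt0.
  have K01 : compact `[0, 1 : R]%classic by exact: segment_compact.
  have := (compact_near_coveringP _).1 K01 R (nbhs (0 : R))
    (fun s t => `|rho s t - rho 0 t| <= e) (nbhs_filter _).
  have cov (x : R) : `[0, 1]%classic x -> \forall x' \near x & i \near (0 : R), `|rho i x' - rho 0 x'| <= e.
    rewrite /= in_itv /= => x01.
    have zM : M (z 0 x) by apply: UM; apply: zU => //; rewrite normr0.
    have cz : (fun y : R * R => z y.2 y.1) @ nbhs (x, (0 : R)) --> z 0 x.
      apply: tvs_cvgD; last first.
        apply: tvs_cvgZ; last exact: cst_continuous.
        by apply: cvgM; [exact: cvg_snd|exact: cvg_fst].
      apply: tvs_cvgD; first exact: cst_continuous.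
      by apply: tvs_cvgZ; [exact: cvg_fst|exact: cst_continuous].
    have cq h l : (fun y : R * R => q (z y.2 y.1) h l) @ nbhs (x, (0 : R)) --> q (z 0 x) h l.
      by apply: (q_cvg (F := nbhs (x, (0 : R))) _ zM cz); exact: cst_continuous.
    have cw h : (fun y : R * R => w (z y.2 y.1) h) @ nbhs (x, (0 : R)) --> w (z 0 x) h.
      by apply: (w_cvg (F := nbhs (x, (0 : R))) _ zM cz); exact: cst_continuous.
    have c1 : (fun y : R * R => rho y.2 y.1) @ nbhs (x, (0 : R)) --> rho 0 x.
      apply: cvgD; first apply: cvgD => //.
        by apply: cvgM; [exact: cvg_fst|exact: cq].
      apply: cvgM; last exact: cq.
      by apply: cvgM; [exact: cvg_snd|exact: cvg_fst].
    have c2 : (fun y : R * R => rho 0 y.1) @ nbhs (x, (0 : R)) --> rho 0 x.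
      apply: (@cvg_comp _ _ _ (fun y : R * R => (y.1, (0 : R))) (fun y : R * R => rho y.2 y.1)
        _ (nbhs (x, (0 : R)))) => //.
      apply: (@cvg_pair _ _ _ _ (nbhs x) (nbhs (0 : R))); first exact: cvg_fst.
      exact: (@cst_continuous _ _ (0 : R) (x, (0 : R))).
    move: c1 c2 => /cvgrPdist_le /(_ _ e20) c1 /cvgrPdist_le /(_ _ e20) c2.
    have c12 : nbhs (x, (0 : R)) [set y : R * R | `|rho 0 x - rho y.2 y.1| <= e / 2 /\
        `|rho 0 x - rho 0 y.1| <= e / 2] by exact: (filterI c1 c2).
    apply: (@filterS _ (nbhs (x, (0 : R))) _ _ _ _ c12) => -[x' i] /= [H1 H2].
    rewrite distrC in H1; rewrite -(subrKA (rho 0 x)).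
    by apply: le_trans (ler_normD _ _) _; rewrite [leRHS]splitr lerD.
  move=> /(_ cov); apply: filterS => s Hs t t01; apply: Hs.
  by rewrite /= in_itv.
have [G0 dG0 SE0] := seg_intP Ua Ub.
apply/cvgrPdist_le => e e0.
have [d' d'0 Hd'] : exists2 d' : R, 0 < d' & forall s : R, `|s| < d' -> forall t : R, 0 <= t <= 1 ->
    `|rho s t - rho 0 t| <= e.
  have := unif e e0; move=> /nbhs_ballP[d' /= d'0 H]; exists d' => // s sd; apply: H.
  by rewrite -ball_normE /= sub0r normrN.
near=> s.
have s0 : s != 0 by near: s; exact: nbhs_dnbhs_neq.
have : `|s| < Num.min d d' by near: s; apply: dnbhs0_lt; rewrite lt_min d0.
rewrite lt_min => /andP[sd sd'].
have [G dG SE] := seg_intP Ua (Hd s sd).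
(* This mean value theorem in [t] replaces integration over the segment; a second one, in [s] at the
   point [c] found here, reduces the error to [rho (x * s) c - rho 0 c]. *)
have [t t01|c c01 cE] := @MVT01 R (fun t => G t - G0 t - s * m t)
    (fun t => seg_form a (b + s *: k) t - seg_form a b t - s * rho 0 t).
  have dsm : is_derive t 1 (fun t => s * m t) (s * rho 0 t).
    have := is_deriveM (is_derive_cst s t 1) (dm t t01).
    move/is_derive_eq; apply; rewrite scaler0 addr0 /cst; exact: erefl.
  exact: is_deriveB (is_deriveB (dG t t01) (dG0 t t01)) dsm.
have segE s' : `|s'| < d -> seg_form a (b + s' *: k) c = r c s'.
  move=> s'd; rewrite /seg_form clamp_id// -zE /r -wZ; last exact: UM (zU _ _ s'd c01).
  rewrite -wD; last exact: UM (zU _ _ s'd c01).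
  by rewrite addrAC.
have segE0 : seg_form a b c = r c 0.
  by rewrite -segE ?normr0// scale0r addr0.
have [t t01|x x01 xE] := @MVT01 R (fun x => r c (x * s)) (fun x => rho (x * s) c * s).
  have xs : `|t * s| < d.
    move: t01 => /andP[t0 t1]; apply: le_lt_trans sd; rewrite normrM ger0_norm// ler_piMl//.
  have dl : is_derive t 1 (fun x : R => x * s) s.
    have := is_deriveM (is_derive_id t 1) (is_derive_cst s t 1).
    by move/is_derive_eq; apply; rewrite scaler0 add0r /cst -[LHS]/(s * 1) mulr1.
  exact: (@is_derive1_comp _ _ (fun x : R => x * s) _ _ _ (dr _ _ xs c01) dl).
have m0 : m 0 = 0 by rewrite /m mul0r.
have m1 : m 1 = w b k by rewrite /m /p mul1r scale1r addrC subrK.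
have D : seg_int a (b + s *: k) - seg_int a b - s * w b k = s * (rho (x * s) c - rho 0 c).
  move: xE cE; rewrite mul1r mul0r segE// segE0 m0 m1 SE SE0 => xE.
  rewrite mulr0 subr0 xE => cE.
  have -> : G 1 - G 0 - (G0 1 - G0 0) - s * w b k = G 1 - G0 1 - s * w b k - (G 0 - G0 0) by ring.
  by rewrite cE; ring.
have -> : w b k - s^-1 * (seg_int a (b + s *: k) - seg_int a b) =
   - (s^-1 * (seg_int a (b + s *: k) - seg_int a b - s * w b k)) by field.
rewrite D mulKf// normrN; apply: Hd' => //.
move: x01 => /andP[x0 x1]; apply: le_lt_trans sd'; rewrite normrM ger0_norm// ler_piMl//.
Unshelve. all: by end_near. Qed.

Lemma seg_int_gateaux a b k : U a -> U b ->
  derivable (fun s : R => seg_int a (b + s *: k)) 0 1 /\ gateaux (seg_int a) b k = w b k.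
Proof. by move=> Ua Ub; apply/gateaux_cvgP; exact: seg_int_derive. Qed.

(** Along the segment from [b] to [c], [seg_int a] and a primitive of [seg_form b c] have the same
    derivative: a closed form integrates to 0 around a triangle. *)
Lemma seg_int_cocycle a b c : U a -> U b -> U c ->
  seg_int a c - seg_int a b = seg_int b c.
Proof.
move=> Ua Ub Uc; have [G dG ->] := seg_intP Ub Uc.
pose h (t : R) := seg_int a (b + t *: (c - b)) - G t.
have dSa : gderivable U (seg_int a).
  by move=> f k Uf; have [] := seg_int_gateaux k Ua Uf.
have [t t01|t t01] := @MVT01 R h (fun=> 0).
  have Ut : U (b + t *: (c - b)) by exact: cU.
  have dS := @is_derive_gateaux _ _ U (seg_int a) b (c - b) t dSa Ut.
  have := is_deriveB dS (dG t t01); move/is_derive_eq; apply.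
  by rewrite /seg_form clamp_id//; have [_ ->] := seg_int_gateaux (c - b) Ua Ut; rewrite subrr.
rewrite /h scale1r scale0r addr0 (addrC b) subrK => /eqP E.
by move: E; rewrite subr_eq0 => /eqP E; lra.
Qed.

End Convex.
End LocalPrimitive.

(** * Monodromy along continuous paths *)

Section Monodromy.
Context {R : realType} {V : tvsType R}.

(** Supremum argument: near each [t] the property passes between any two points in either order, so
    it reaches the supremum from below and then goes beyond it. *)
Lemma itv_induct (a b : R) (P : R -> Prop) : a <= b ->
  (forall t, a <= t <= b -> exists2 d, 0 < d & forall s s', a <= s <= b -> a <= s' <= b ->
     `|s - t| < d -> `|s' - t| < d -> P s -> P s') ->
  P a -> P b.
Proof.
move=> ab HP Pa; pose E := [set t | a <= t <= b /\ P t].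
have Ea : E a by split => //; rewrite lexx.
have sE : has_sup E by split; [exists a | exists b => t [/andP[]]].
have Eub t : E t -> t <= sup E by move=> Et; apply: ub_le_sup => //; case: sE.
have ac : a <= sup E by exact: Eub.
have cb : sup E <= b by apply: ge_sup; [exists a | move=> t [/andP[]]].
have cab : a <= sup E <= b by rewrite ac.
have [d d0 Hd] := HP _ cab.
have [t Et td] := sup_adherent d0 sE.
have tc : `|t - sup E| < d.
  by rewrite ler0_norm ?subr_le0 ?Eub//; lra.
have [tab Pt] := Et.
have Pc : P (sup E) by apply: (Hd t) => //; rewrite subrr normr0.
have [cltb|] := ltP (sup E) b; last first.
  by move=> bc; have <- : sup E = b by apply/eqP; rewrite eq_le cb.
pose s := Num.min b (sup E + d / 2).
have d20 : 0 < d / 2 by rewrite divr_gt0.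
have cs : sup E < s by rewrite lt_min cltb ltrDl.
have sb : s <= b by rewrite ge_min lexx.
have sd : s <= sup E + d / 2 by rewrite ge_min lexx orbT.
have sab : a <= s <= b by rewrite sb (le_trans ac (ltW cs)).
have : E s.
  split => //; apply: (Hd t) => //.
  by rewrite ger0_norm ?subr_ge0 ?ltW//; lra.
by move=> /Eub; rewrite leNgt cs.
Qed.

Variables (M : set V) (S : V -> V -> R) (good : set V -> Prop).
Hypothesis good_open : forall U, good U -> open U.
Hypothesis good_convex : forall U, good U -> segment_convex U.
Hypothesis good_sub : forall U, good U -> U `<=` M.
Hypothesis good_cover : forall f, M f -> exists2 U, good U & U f.
Hypothesis S_cocycle : forall U a b c, good U -> U a -> U b -> U c -> S a c - S a b = S b c.

Lemma S_diag U a : good U -> U a -> S a a = 0.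
Proof. by move=> gU Ua; rewrite -(S_cocycle gU Ua Ua Ua) subrr. Qed.

Lemma S_opp U a b : good U -> U a -> U b -> S b a = - S a b.
Proof.
by move=> gU Ua Ub; rewrite -(S_cocycle gU Ua Ub Ua) (S_diag gU Ua) sub0r.
Qed.

(* [t |-> (g t, phi t)] is a lift of the path [g] to the covering of [M] that has
   the cocycle [S]. *)
Definition primitive_along (g : R -> V) (phi : R -> R) (a b : R) := forall t, a <= t <= b ->
  exists2 d, 0 < d & forall s, a <= s <= b -> `|s - t| < d -> phi s - phi t = S (g t) (g s).

(** All that [lift_exists] uses of a continuous path in [M]. *)
Definition gpath (g : R -> V) (a b : R) := forall t, a <= t <= b ->
  exists U d, [/\ good U, 0 < d & forall s, a <= s <= b -> `|s - t| < d -> U (g s)].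

Lemma lift_sub g phi a b a' b' : a <= a' -> b' <= b -> primitive_along g phi a b ->
  primitive_along g phi a' b'.
Proof.
move=> aa bb L t /andP[ta tb]; have [|d d0 Hd] := L t; first by lra.
by exists d => // s /andP[sa sb]; apply: Hd; lra.
Qed.

Lemma eq_lift g g' phi a b : (forall t, a <= t <= b -> g t = g' t) ->
  primitive_along g phi a b -> primitive_along g' phi a b.
Proof.
move=> gg L t tab; have [d d0 Hd] := L t tab; exists d => // s sab sd.
by rewrite -!gg//; exact: Hd.
Qed.

Lemma lift_affine g phi a b a' b' (x y : R) :
  (forall t, a' <= t <= b' -> a <= x + y * t <= b) -> primitive_along g phi a b ->
  primitive_along (fun t => g (x + y * t)) (fun t => phi (x + y * t)) a' b'.
Proof.
move=> xy L t tab; have [d d0 Hd] := L _ (xy t tab).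
have y1 : 0 < `|y| + 1 by rewrite ltr_wpDl.
exists (d / (`|y| + 1)); first by rewrite divr_gt0.
move=> s sab sd; apply: Hd; first exact: xy.
have -> : x + y * s - (x + y * t) = y * (s - t) by ring.
rewrite normrM; move: sd; rewrite ltr_pdivlMr//; apply: le_lt_trans.
by rewrite mulrC ler_wpM2l// lerDl.
Qed.

(** Two lifts have the same local increments, so their difference is locally constant. *)
Lemma lift_unique g phi psi a b : a <= b -> primitive_along g phi a b -> primitive_along g psi a b ->
  phi b - phi a = psi b - psi a.
Proof.
move=> ab L1 L2; apply: (@itv_induct a b (fun t => phi t - phi a = psi t - psi a)) => //.
  move=> t tab; have [d1 d10 H1] := L1 t tab; have [d2 d20 H2] := L2 t tab.
  exists (Num.min d1 d2); first by rewrite lt_min d10.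
  move=> s s' sab s'ab; rewrite !lt_min => /andP[sd1 sd2] /andP[s'd1 s'd2] E.
  have := H1 s sab sd1; have := H2 s sab sd2.
  have := H1 s' s'ab s'd1; have := H2 s' s'ab s'd2.
  lra.
by rewrite !subrr.
Qed.

Lemma lift_good U g phi a b : good U -> a <= b -> (forall t, a <= t <= b -> U (g t)) ->
  primitive_along g phi a b -> phi b - phi a = S (g a) (g b).
Proof.
move=> gU ab Ug L.
have aab : a <= a <= b by rewrite lexx.
have bab : a <= b <= b by rewrite lexx andbT.
have L2 : primitive_along g (fun t => S (g a) (g t)) a b.
  move=> t tab; exists 1 => // s sab _; apply: (S_cocycle gU); exact: Ug.
rewrite (lift_unique ab L L2); rewrite (S_diag gU (Ug _ aab)); lra.
Qed.

Lemma lift_good2 U g phi a b s t : good U -> (forall t, a <= t <= b -> U (g t)) ->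
  primitive_along g phi a b -> a <= s <= b -> a <= t <= b -> phi t - phi s = S (g s) (g t).
Proof.
move=> gU Ug L sab tab; have [st|ts] := leP s t.
  move: sab tab => /andP[sa sb] /andP[ta tb]; apply: (lift_good gU st).
    by move=> x /andP[x1 x2]; apply: Ug; lra.
  exact: lift_sub L.
rewrite (S_opp gU (Ug _ tab) (Ug _ sab)).
move: sab tab => /andP[sa sb] /andP[ta tb].
rewrite -(@lift_good U g phi t s gU (ltW ts)) ?opprB//.
  by move=> x /andP[x1 x2]; apply: Ug; lra.
exact: lift_sub L.
Qed.

Lemma lift_exists g a b : a <= b -> gpath g a b -> exists2 phi, primitive_along g phi a b & phi a = 0.
Proof.
move=> ab gp; apply: (@itv_induct a b (fun t => exists2 phi, primitive_along g phi a t & phi a = 0)) => //.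
  move=> t tab; have [U [d [gU d0 Hd]]] := gp t tab; exists d => //.
  move=> s s' sab s'ab sd s'd [phi L phia].
  have [s's|ss'] := leP s' s; first by exists phi => //; exact: lift_sub L.
  move: sab s'ab => /andP[sa sb] /andP[s'a s'b].
  have Ug x : s <= x <= s' -> U (g x).
    move=> /andP[xs xs']; apply: Hd; first by lra.
    by move: sd s'd; rewrite !ltr_norml => /andP[? ?] /andP[? ?]; lra.
  have Ugs : U (g s) by apply: Ug; rewrite lexx ltW.
  (* Past [s] the lift is continued by the local primitive on [U], normalised at [g s]. *)
  pose psi x := if x <= s then phi x else phi s + S (g s) (g x).
  exists psi; last by rewrite /psi sa.
  move=> x /andP[xa xs']; have [xs|xs|xs] := ltgtP x s.
  - have [|d1 d10 H1] := L x; first by lra.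
    exists (Num.min d1 (s - x)); first by rewrite lt_min d10 subr_gt0.
    move=> y /andP[ya ys']; rewrite lt_min => /andP[yd1 yx].
    have ys : y <= s by move: yx; rewrite ltr_norml => /andP[? ?]; lra.
    by rewrite /psi ys (ltW xs); apply: H1 => //; lra.
  - exists (x - s); first by rewrite subr_gt0.
    move=> y /andP[ya ys'] yx.
    have sy : s < y by move: yx; rewrite ltr_norml => /andP[? ?]; lra.
    rewrite /psi !leNgt xs sy /=.
    rewrite -(S_cocycle gU Ugs (Ug x _) (Ug y _)); lra.
  - have [|d1 d10 H1] := L s; first by lra.
    exists d1 => // y /andP[ya ys'] yd; rewrite /psi xs lexx.
    have [ys|ys] := leP y s; first by apply: H1; [lra|rewrite -xs].
    lra.
exists (fun=> 0) => // t /andP[ta tb]; have ta' : t = a by apply/eqP; rewrite eq_le tb.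
exists 1 => // s /andP[sa sb] _; have -> : s = a by apply/eqP; rewrite eq_le sb.
have aab : a <= a <= b by rewrite lexx.
have [U [d [gU d0 Hd]]] := gp a aab.
rewrite ta' subrr (S_diag gU)//; apply: Hd => //; rewrite ?lexx//.
by rewrite subrr normr0.
Qed.

Local Notation I01 := (`[0, 1]%classic : set R).

Lemma path_gpath (g : R -> V) : {within I01, continuous g} -> (forall t, I01 t -> M (g t)) ->
  gpath g 0 1.
Proof.
move=> cg gM t t01; have It : I01 t by rewrite /= in_itv.
have [U gU Ut] := good_cover (gM t It).
have := (subspace_continuousP _ g).1 cg t It.
move=> /(_ U (open_nbhs_nbhs (conj (good_open gU) Ut))).
rewrite /= => /nbhs_ballP[d /= d0 Hd].
exists U, d; split => // s s01 sd; apply: Hd; last by rewrite /= in_itv.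
by rewrite -ball_normE /= distrC.
Qed.

(** The lifts of neighbouring curves differ by the cocycle between their current points. At [t = 1]
    all curves are at [x0], so the final value is locally constant in [s]; for [s = 1] the curve is
    constant and that value is 0. *)
Lemma homotopy_lift (H : R * R -> V) (x0 : V) (phi : R -> R -> R) :
  {within I01 `*` I01, continuous H} -> (forall p, (I01 `*` I01) p -> M (H p)) ->
  (forall t, I01 t -> H (1, t) = x0) ->
  (forall s, I01 s -> H (s, 0) = x0 /\ H (s, 1) = x0) ->
  (forall s, I01 s -> primitive_along (fun t => H (s, t)) (phi s) 0 1 /\ phi s 0 = 0) ->
  phi 0 1 = 0.
Proof.
move=> cH HM H1 H01 Hphi.
have I0 : I01 0 by rewrite /= in_itv /= lexx ler01.
have I1 : I01 1 by rewrite /= in_itv /= lexx ler01.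
have [U0 gU0 Ux0] : exists2 U, good U & U x0.
  by rewrite -(H1 0 I0); apply: good_cover; apply: HM.
have S00 : S x0 x0 = 0 by exact: S_diag gU0 Ux0.
have inI (t : R) : 0 <= t <= 1 -> I01 t by rewrite /= in_itv.
have HU s t : I01 s -> I01 t -> exists U d, [/\ good U, 0 < d & forall s' t', I01 s' -> I01 t' ->
    `|s' - s| < d -> `|t' - t| < d -> U (H (s', t'))].
  move=> Is It; have [U gU Ut] := good_cover (HM (s, t) (conj Is It)).
  have := (subspace_continuousP _ H).1 cH (s, t) (conj Is It).
  move=> /(_ U (open_nbhs_nbhs (conj (good_open gU) Ut))).
  rewrite /= => /nbhs_ballP[d /= d0 Hd].
  exists U, d; split => // s' t' Is' It' sd td; apply: (Hd (s', t')) => //.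
  by split; rewrite /= -ball_normE /= distrC.
have phi11 : phi 1 1 = 0.
  have [L L0] := Hphi 1 I1.
  have := lift_good gU0 ler01 _ L; rewrite L0 subr0 !H1// S00; apply.
  by move=> t /inI It; rewrite H1.
suff : phi 1 1 = phi 0 1 by rewrite phi11.
apply: (@itv_induct 0 1 (fun s => phi s 1 = phi 0 1)) => // s0 /inI Is0.
suff [d d0 Hd] : exists2 d, 0 < d & forall s, I01 s -> `|s - s0| < d -> phi s 1 = phi s0 1.
  by exists d => // s s' /inI Is /inI Is' sd s'd; rewrite (Hd s)// (Hd s').
suff [d d0 Hd] : exists2 d, 0 < d & forall s, I01 s -> `|s - s0| < d ->
    phi s 1 - phi s0 1 = S (H (s0, 1)) (H (s, 1)).
  exists d => // s Is sd; have := Hd s Is sd.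
  by rewrite (H01 s Is).2 (H01 s0 Is0).2 S00 => /eqP; rewrite subr_eq0 => /eqP.
(* The radius is quantified inside the induction statement because it may shrink as [t] advances. *)
apply: (@itv_induct 0 1 (fun t => exists2 d, 0 < d & forall s, I01 s -> `|s - s0| < d ->
    phi s t - phi s0 t = S (H (s0, t)) (H (s, t)))) => //; last first.
  exists 1 => // s Is _; rewrite (H01 s Is).1 (H01 s0 Is0).1 S00.
  by rewrite (Hphi s Is).2 (Hphi s0 Is0).2 subrr.
move=> t /inI It; have [U [d [gU d0 Hd]]] := HU s0 t Is0 It.
exists d => // t1 t2 t1I t2I t1d t2d [d' d'0 Hd'].
exists (Num.min d d'); first by rewrite lt_min d0.
move=> s Is; rewrite lt_min => /andP[sd sd'].
have s0d : `|s0 - s0| < d by rewrite subrr normr0.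
pose a := Num.min t1 t2; pose b := Num.max t1 t2.
have [[a1 a2] [b1 b2]] : (a <= t1 /\ a <= t2) /\ (t1 <= b /\ t2 <= b).
  by rewrite /a /b !ge_min !le_max !lexx !orbT.
have abd (x : R) : a <= x <= b -> 0 <= x <= 1 /\ `|x - t| < d.
  move: t1I t2I t1d t2d; rewrite /a /b !ltr_norml.
  move=> /andP[t10 t11] /andP[t20 t21] /andP[? ?] /andP[? ?] /andP[ax xb].
  by move: ax xb; case: (leP t1 t2) => _ ax xb; rewrite (le_trans _ ax)// (le_trans xb)//=; split; lra.
have Lift x : I01 x -> `|x - s0| < d ->
    phi x t2 - phi x t1 = S (H (x, t1)) (H (x, t2)).
  move=> Ix xd; have [L _] := Hphi x Ix.
  have La : primitive_along (fun t => H (x, t)) (phi x) a b.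
    have aab : a <= a <= b by rewrite lexx (le_trans a1).
    have bab : a <= b <= b by rewrite lexx andbT (le_trans a1).
    have [/andP[? ?] _] := abd a aab; have [/andP[? ?] _] := abd b bab.
    exact: lift_sub L.
  apply: (lift_good2 gU _ La); rewrite ?a1 ?a2 ?b1 ?b2//.
  by move=> y /abd[/inI Iy yd]; apply: Hd.
(* Both vertical sides and all corners of the rectangle between [s0], [s] and [t1], [t2] are mapped
   into [U]; the cocycle identity around it carries the claim from [t1] to [t2]. *)
have E1 := Lift s Is sd; have E2 := Lift s0 Is0 s0d; have E3 := Hd' s Is sd'.
have Ua := Hd s0 t1 Is0 (inI _ t1I) s0d t1d.
have Ub := Hd s0 t2 Is0 (inI _ t2I) s0d t2d.
have Uc := Hd s t1 Is (inI _ t1I) sd t1d.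
have Ue := Hd s t2 Is (inI _ t2I) sd t2d.
have C1 := S_cocycle gU Ua Uc Ue; have C2 := S_cocycle gU Ua Ub Ue.
lra.
Qed.

Hypothesis M_sc : simply_connected M.

Lemma loop_lift g phi : {within I01, continuous g} -> (forall t, I01 t -> M (g t)) ->
  g 0 = g 1 -> primitive_along g phi 0 1 -> phi 1 = phi 0.
Proof.
move=> cg gM g01 L; have [H [cH HM H0 H1 Hs]] := M_sc.2 g cg gM g01.
have I0 : I01 0 by rewrite /= in_itv /= lexx ler01.
have /choice[psi Hpsi] : forall s, exists psi : R -> R, I01 s ->
    primitive_along (fun t => H (s, t)) psi 0 1 /\ psi 0 = 0.
  move=> s; have [Is|Is] := pselect (I01 s); last by exists (fun=> 0).
  have gp : gpath (fun t => H (s, t)) 0 1.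
    apply: path_gpath => [|t It]; last exact: HM.
    apply/subspace_continuousP => t It.
    have cs := (subspace_continuousP _ H).1 cH (s, t) (conj Is It).
    apply: cvg_trans cs => A; rewrite /= => /nbhs_ballP[d /= d0 Hd].
    apply/nbhs_ballP; exists d => // t' td It'; apply: (Hd (s, t')) => //.
    by split => //; exact: ballxx.
  by have [p Lp p0] := lift_exists ler01 gp; exists p.
have := homotopy_lift cH HM H1 Hs Hpsi.
have [Lp p0] := Hpsi 0 I0.
have Lg : primitive_along g (psi 0) 0 1.
  by apply: eq_lift Lp => t t01; apply: H0; rewrite /= in_itv.
have := lift_unique ler01 L Lg; rewrite p0 => E p1; lra.
Qed.

Lemma path_clamp (g : R -> V) : {within I01, continuous g} -> continuous (g \o clamp).
Proof.
move=> cg t; have It : I01 (clamp t) by rewrite /= in_itv /=; exact: clamp_itv.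
have := (subspace_continuousP _ g).1 cg _ It => c.
apply: cvg_comp _ c => A; rewrite /= => HA.
have Hc := @clamp_continuous R t _ HA.
apply: (@filterS _ (nbhs t) _ _ _ _ Hc) => s /=; apply.
by rewrite /= in_itv /=; exact: clamp_itv.
Qed.

(** [F f] is the increment of the lift along a chosen path from [f0] to [f]. The path to [a], the
    segment to [b] and the path to [b] reversed form a loop, whose total increment is 0 by
    [loop_lift]. *)
Lemma global_primitive : exists F : V -> R, forall U a b, good U -> U a -> U b ->
  F b - F a = S a b.
Proof.
have [M0|/set0P[f0 Mf0]] := eqVneq M set0.
  by exists (fun=> 0) => U a b gU /(good_sub gU); rewrite M0.
have /choice[g Hg] : forall f, exists g : R -> V, M f -> [/\ {within I01, continuous g},
    forall t, I01 t -> M (g t), g 0 = f0 & g 1 = f].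
  move=> f; have [Mf|Mf] := pselect (M f); last by exists (fun=> 0).
  by have [g H] := M_sc.1 f0 f Mf0 Mf; exists g.
have /choice[phi Hphi] : forall f, exists phi : R -> R, M f -> primitive_along (g f) phi 0 1 /\ phi 0 = 0.
  move=> f; have [Mf|Mf] := pselect (M f); last by exists (fun=> 0).
  have [cg gM _ _] := Hg f Mf.
  by have [p Lp p0] := lift_exists ler01 (path_gpath cg gM); exists p.
exists (fun f => phi f 1) => U a b gU Ua Ub.
have Ma := good_sub gU Ua; have Mb := good_sub gU Ub.
have [ca aM a0 a1] := Hg a Ma; have [cb bM b0 b1] := Hg b Mb.
have [La pa] := Hphi a Ma; have [Lb pb] := Hphi b Mb.
(* The concatenation over thirds of [[0, 1]], written as one sum: each [clamp] is constant outside
   its own third, so [G] is continuous without gluing. *)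
pose G (t : R) := g a (clamp (3 * t)) + clamp (3 * t - 1) *: (b - a) +
  (g b (clamp (3 - 3 * t)) - b).
have clamp0 (t : R) : t <= 0 -> clamp t = 0.
  by move=> t0; rewrite /clamp max_l// ge_min t0 orbT.
have clamp1 (t : R) : 1 <= t -> clamp t = 1.
  by move=> t1; rewrite /clamp min_l// max_r.
have G1 (t : R) : 0 <= t <= 3^-1 -> G t = g a (0 + 3 * t).
  move=> /andP[t0 t3]; rewrite /G (@clamp0 (3 * t - 1)); last by lra.
  rewrite (@clamp1 (3 - 3 * t)); last by lra.
  by rewrite b1 subrr addr0 scale0r addr0 clamp_id ?add0r//; lra.
have G2 (t : R) : 3^-1 <= t <= 2 / 3 -> G t = a + (3 * t - 1) *: (b - a).
  move=> /andP[t0 t3]; rewrite /G (@clamp1 (3 * t)); last by lra.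
  rewrite (@clamp1 (3 - 3 * t)); last by lra.
  by rewrite b1 subrr addr0 clamp_id ?a1//; lra.
have G3 (t : R) : 2 / 3 <= t <= 1 -> G t = g b (3 + (- 3) * t).
  move=> /andP[t0 t3]; rewrite /G (@clamp1 (3 * t)); last by lra.
  rewrite (@clamp1 (3 * t - 1)); last by lra.
  rewrite a1 scale1r (addrC a) subrK addrC subrK clamp_id; last by lra.
  by congr (g b _); ring.
have cG : continuous G.
  move=> t; apply: (tvs_cvgD (F := nbhs t)).
    apply: (tvs_cvgD (F := nbhs t)).
      apply: (@continuous_comp _ _ _ (fun t : R => 3 * t) (g a \o clamp)).
        by apply: (@cvgM _ _ (nbhs t)); [exact: cst_continuous | exact: cvg_id].
      exact: path_clamp.
    apply: (tvs_cvgZ (F := nbhs t)); last exact: cst_continuous.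
    apply: (@continuous_comp _ _ _ (fun t : R => 3 * t - 1) clamp).
      apply: (@cvgB _ _ _ (nbhs t)); last exact: cst_continuous.
      by apply: (@cvgM _ _ (nbhs t)); [exact: cst_continuous | exact: cvg_id].
    exact: clamp_continuous.
  apply: (tvs_cvgD (F := nbhs t)); last exact: cst_continuous.
  apply: (@continuous_comp _ _ _ (fun t : R => 3 - 3 * t) (g b \o clamp)).
    apply: (@cvgB _ _ _ (nbhs t)); first exact: cst_continuous.
    by apply: (@cvgM _ _ (nbhs t)); [exact: cst_continuous | exact: cvg_id].
  exact: path_clamp.
have cGI : {within I01, continuous G} by exact: continuous_subspaceT.
have third (t : R) : I01 t -> [\/ 0 <= t <= 3^-1, 3^-1 <= t <= 2 / 3 | 2 / 3 <= t <= 1].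
  rewrite /= in_itv /= => /andP[t0 t1]; have [t3|t3] := leP t 3^-1; first by apply: Or31; lra.
  by have [t23|t23] := leP t (2 / 3); [apply: Or32; lra | apply: Or33; lra].
have inI (t : R) : 0 <= t <= 1 -> I01 t by rewrite /= in_itv.
have GU (t : R) : 3^-1 <= t <= 2 / 3 -> U (G t).
  by move=> t13; rewrite G2//; apply: good_convex => //; lra.
have GM t : I01 t -> M (G t).
  move=> /third[t1|t1|t1].
  - by rewrite G1//; apply: aM; apply: inI; lra.
  - by apply: (good_sub gU); exact: GU.
  - by rewrite G3//; apply: bM; apply: inI; lra.
have G01 : G 0 = G 1.
  rewrite G1 ?G3; [|lra|lra].
  rewrite mulr0 addr0 mulr1 subrr a0 b0; exact: erefl.
have [psi Lpsi psi0] := lift_exists ler01 (path_gpath cGI GM).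
have E := loop_lift cGI GM G01 Lpsi.
have E1 : psi 3^-1 - psi 0 = phi a 1.
  have L1 : primitive_along (fun t => g a (0 + 3 * t)) psi 0 3^-1.
    apply: (eq_lift G1); apply: lift_sub Lpsi; lra.
  have L2 : primitive_along (fun t => g a (0 + 3 * t)) (fun t => phi a (0 + 3 * t)) 0 3^-1.
    by apply: lift_affine La => t /andP[t0 t1]; lra.
  rewrite (lift_unique _ L1 L2); last by lra.
  by rewrite !add0r mulr0 pa subr0 mulfV.
have E2 : psi (2 / 3) - psi 3^-1 = S a b.
  have L1 : primitive_along G psi 3^-1 (2 / 3) by apply: lift_sub Lpsi; lra.
  rewrite (lift_good gU _ GU L1); last by lra.
  rewrite !G2; [|lra|lra].
  have -> : 3 * 3^-1 - 1 = 0 :> R by field.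
  have -> : 3 * (2 / 3) - 1 = 1 :> R by field.
  by rewrite scale0r addr0 scale1r (addrC a) subrK.
have E3 : psi 1 - psi (2 / 3) = - phi b 1.
  have L1 : primitive_along (fun t => g b (3 + (- 3) * t)) psi (2 / 3) 1.
    apply: (eq_lift G3); apply: lift_sub Lpsi; lra.
  have L2 : primitive_along (fun t => g b (3 + (- 3) * t)) (fun t => phi b (3 + (- 3) * t)) (2 / 3) 1.
    by apply: lift_affine Lb => t /andP[t0 t1]; lra.
  rewrite (lift_unique _ L1 L2); last by lra.
  have -> : 3 + - 3 * 1 = 0 :> R by ring.
  have -> : 3 + - 3 * (2 / 3) = 1 :> R by field.
  by rewrite pb sub0r.
lra.
Qed.

End Monodromy.

(** * From a flux to a density *)

Section LocalRepresentation.
Context {R : realType} {n d : nat} {X : manifold R n}.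
Variables (v : X -> 'rV[R]_d).
Hypotheses (sv : smooth_map v) (v_inj : injective v) (v_imm : immersion v).

Lemma smooth_map_continuous : continuous v.
Proof.
move=> x; apply/(@cvgrPdist_le _ _ _ (nbhs x)) => e e0.
have H j : \forall y \near x, `|v x 0 j - v y 0 j| <= e.
  have c : {for x, continuous (fun x => v x 0 j)} := @smooth_continuous _ _ _ _ (sv j) x.
  by move: c => /(@cvgrPdist_le _ _ _ (nbhs x)) /(_ e e0).
have := filter_forall (nbhs_filter x) H; apply: filterS => y K.
by apply: rV_norm_le => [|j]; [exact: ltW | rewrite !mxE; exact: K].
Qed.

(** Injectivity of the differential makes the Jacobian [J] row free, so [J *m C = 1] for some [C].
    Multiplying [v] by [C] gives a map of R^n with identity Jacobian at the point, as
    [inverse_function] requires. *)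
Lemma immersion_left_inverse phi x0 : atlas phi -> chart_dom phi x0 ->
  exists C : 'M[R]_(d, n), forall i k,
    'D_(delta_mx 0 i) (fun y => (v (chart_inv phi y) *m C) 0 k) (chart_map phi x0) = (i == k)%:R.
Proof.
move=> aphi Dx0; set y0 := chart_map phi x0.
have Iy0 : chart_img phi y0 by exact: chart_imgP.
have oI := @chart_img_open _ _ _ phi.
pose g := v \o chart_inv phi.
have sg j : smooth_on (chart_img phi) (fun y => g y 0 j) by exact: sv.
pose J : 'M[R]_(n, d) := \matrix_(i, j) 'D_(delta_mx 0 i) (fun y => g y 0 j) y0.
pose L : {linear 'rV[R]_n -> 'rV[R]_d} := mulmxr J.
have [K K0 HK] := mulmx_rV_norm_le J.
have cL : continuous L.
  move=> h; apply/(@cvgrPdist_le _ _ _ (nbhs h)) => e e0.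
  have K1 : 0 < K + 1 by rewrite ltr_wpDl.
  apply/nbhs_ballP; exists (e / (K + 1)); first by rewrite /= divr_gt0.
  move=> k; rewrite -ball_normE /= => hk; rewrite (_ : L h - L k = L (h - k)); last by rewrite linearB.
  apply: le_trans (HK _) _; apply: (@le_trans _ _ ((K + 1) * `|h - k|)).
    by rewrite ler_wpM2r// lerDl.
  by rewrite mulrC -ler_pdivlMr// ltW.
have [|_ dE] := @differentiable_eps R _ _ g L y0 cL.
  move=> e e0.
  have Hj j : \forall h \near (0 : 'rV[R]_n),
      `|g (y0 + h) 0 j - g y0 0 j - \sum_i h 0 i * J i j| <= e * `|h|.
    have [||r r0 Hr] := @C1_expansion _ _ (fun y => g y 0 j) y0 _ e0.
    - move=> l; have : \forall y \near y0, chart_img phi y by apply: open_nbhs_nbhs.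
      by apply: filterS => y Iy; exact: smooth_on_derivable (sg j) Iy.
    - by move=> l; exact: smooth_on_continuous (smooth_on_derive l (sg j)) Iy0.
    apply/nbhs_ballP; exists r => // h; rewrite -ball_normE /= sub0r normrN => hr.
    have := Hr h hr; congr (`|_ - _| <= _); apply: eq_bigr => l _.
    by rewrite mxE.
  have := filter_forall (nbhs_filter (0 : 'rV[R]_n)) Hj.
  move=> /nbhs_ballP[r /= r0 Hr]; exists r => // h hr.
  apply: rV_norm_le => [|j]; first by rewrite mulr_ge0// ltW.
  have := Hr h; rewrite -ball_normE /= sub0r normrN => /(_ hr j).
  by rewrite /L /= !mxE.
have J_free : row_free J.
  rewrite -kermx_eq0; apply/rowV0P => a /sub_kermxP aJ.
  apply: (v_imm aphi Dx0); rewrite -/g -/y0 dE /= aJ mul0mx; exact: erefl.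
have [C JC] := row_freeP J_free.
exists C => i k.
have -> : (fun y => (v (chart_inv phi y) *m C) 0 k) =
    (fun y => \sum_j g y 0 j * C j k) by apply/funext => y; rewrite mxE.
have dj j : is_derive y0 (delta_mx 0 i) (fun y => g y 0 j * C j k) (J i j * C j k).
  have dg := derivableP (smooth_on_derivable (i := i) (sg j) Iy0).
  have := is_deriveM dg (is_derive_cst (C j k) y0 (delta_mx 0 i)).
  move/is_derive_eq; apply; rewrite scaler0 add0r /cst mxE mulrC; exact: erefl.
have -> : (fun y => \sum_j g y 0 j * C j k) = \sum_j (fun y => g y 0 j * C j k).
  by apply/funext => y; rewrite fct_sumE.
have [_ ->] := is_derive_sum dj.
have := congr1 (fun A : 'M[R]_n => A i k) JC.
by rewrite !mxE.
Qed.

(* The bump is a function of [v] itself, so that its product with any smooth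
   function is, on the given compact set, a smooth function of [v]. *)
Lemma local_representation (K : set X) x0 : compact K -> exists r : R, 0 < r /\
  forall phi0 : X -> R, smooth phi0 -> exists2 Phi : 'rV[R]_d -> R, smooth_on setT Phi &
    forall x, K x -> Phi (v x) = cube_bump (v x0) r (v x) * phi0 x.
Proof.
move=> cK; have [phi aphi Dx0] := atlas_cover x0.
set y0 := chart_map phi x0.
have Iy0 : chart_img phi y0 by exact: chart_imgP.
have oI := @chart_img_open _ _ _ phi.
have [C HC] := immersion_left_inverse aphi Dx0.
pose w y := v (chart_inv phi y) *m C.
have smulC m (O : set 'rV[R]_m) (u : 'rV[R]_m -> 'rV[R]_d) k : open O ->
    (forall j, smooth_on O (fun y => u y 0 j)) -> smooth_on O (fun y => (u y *m C) 0 k).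
  move=> oO su; apply: (smooth_on_eq (f := fun y => \sum_j u y 0 j * C j k) oO).
    by move=> y _; rewrite mxE.
  apply: (smooth_on_sum (index_enum _) (P := xpredT) (F := fun j y => u y 0 j * C j k) oO) => j _.
  exact: (smooth_onM oO (su j) (smooth_on_cst _)).
have sw k : smooth_on (chart_img phi) (fun y => w y 0 k).
  by apply: (smulC _ _ (fun y => v (chart_inv phi y)) k oI) => j; exact: sv.
have [N [N' [th [[oN Ny0 NI] [oN' N'w N'th thK sth]]]]] := inverse_function oI sw Iy0 HC.
pose U1 := [set x | chart_dom phi x /\ N (chart_map phi x)].
have oU1 : open U1.
  rewrite openE => x [Dx Nx].
  have N1 : nbhs x (chart_dom phi) by apply: open_nbhs_nbhs; split => //; exact: chart_dom_open.
  have N2 : nbhs x (chart_map phi @^-1` N).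
    by apply: (chart_map_continuous Dx); exact: open_nbhs_nbhs.
  exact: filterI N1 N2.
have cmulC : continuous (fun y : 'rV[R]_d => y *m C).
  move=> y; apply: (smooth_on_continuous_comp (O := setT) _ I) => j.
  by apply: (smulC _ _ id j openT) => i; exact: (smooth_on_coord i (@openT _)).
have [r1 r10 Hr1] : exists2 r1 : R, 0 < r1 & forall y, `|v x0 - y| < r1 -> N' (y *m C).
  have : nbhs (v x0) [set y | N' (y *m C)].
    apply: (cmulC (v x0)); apply: open_nbhs_nbhs; split => //.
    by have := N'w _ Ny0; rewrite /w chart_mapKP.
  move=> /nbhs_ballP[r1 /= r10 H]; exists r1 => // y yr; apply: H.
  by rewrite -ball_normE.
(* Injectivity enters here: on the compact part of [K] outside [U1], the distance to [v x0] has a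
   positive minimum. *)
have [r2 r20 Hr2] : exists2 r2 : R, 0 < r2 & forall x, K x -> ~ U1 x -> r2 <= `|v x - v x0|.
  pose K1 := K `&` ~` U1.
  have cK1 : compact K1 by apply: compact_closedI => //; exact: open_closedC.
  have [/eqP K10|/set0P K10] := boolP (K1 == set0).
    exists 1 => // x Kx Ux; have : K1 x by [].
    by rewrite K10.
  have cn : continuous (fun x => `|v x - v x0|).
    move=> x; apply: (@cvg_norm _ _ _ (nbhs x)).
    by apply: (@cvgB _ _ _ (nbhs x)); [exact: smooth_map_continuous | exact: cst_continuous].
  have [x1 /set_mem [Kx1 Ux1] Hx1] := compact_EVT_min K10 cK1 (continuous_subspaceT cn).
  exists `|v x1 - v x0|; last by move=> x Kx Ux; apply: Hx1; rewrite inE.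
  rewrite normr_gt0 subr_eq0; apply/eqP => /v_inj x10.
  by apply: Ux1; rewrite x10; split.
(* [r <= r2] kills the bump at the points of [K] outside [U1], where [Phi] need not represent
   [phi0]. [r < r1] makes the open sets on which [th] is meaningful and on which the bump vanishes
   cover R^d, so [Phi] is smooth everywhere. *)
pose r := Num.min (r1 / 2) r2.
have r0 : 0 < r by rewrite lt_min r20 divr_gt0.
exists r; split => // phi0 sphi0.
pose Phi y := cube_bump (v x0) r y * phi0 (chart_inv phi (th (y *m C))).
exists Phi; last first.
  move=> x Kx; have [[Dx Nx]|Ux] := pselect (U1 x).
    rewrite /Phi -[v x]/(v x) -{2}(chart_mapKP Dx) -/(w (chart_map phi x)) thK//.
    by rewrite chart_mapKP.
  rewrite /Phi cube_bump_eq0 ?mul0r//.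
  by apply: le_trans (Hr2 x Kx Ux); rewrite ge_min lexx orbT.
pose A := [set y : 'rV[R]_d | N' (y *m C)].
have oA : open A by exact: ((continuousP _).1 cmulC _ oN').
apply: smooth_on_local => y _; have [yr|yr] := ltP `|v x0 - y| r1.
  exists A; split; first exact: Hr1.
  apply: (smooth_onM oA).
    by apply: smooth_on_subset (@smooth_cube_bump _ _ (v x0) r).
  have s1 : smooth_on N (phi0 \o chart_inv phi) by exact: smooth_on_subset NI (sphi0 phi aphi).
  have sC j : smooth_on A (fun y => (y *m C) 0 j).
    by apply: (smulC _ _ id j oA) => i; exact: smooth_on_coord.
  have s2 j : smooth_on A (fun y => th (y *m C) 0 j).
    exact: (smooth_on_comp (u := fun y => y *m C) oA oN' (fun _ H => H) sC (sth j)).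
  exact: (smooth_on_comp (u := fun y => th (y *m C)) oA oN (fun z Az => (N'th _ Az).1) s2 s1).
pose D := [set y : 'rV[R]_d | r < `|v x0 - y|].
have cn : continuous (fun y : 'rV[R]_d => `|v x0 - y|).
  move=> z; apply: (@cvg_norm _ _ _ (nbhs z)).
  by apply: (@cvgB _ _ _ (nbhs z)); [exact: cst_continuous | exact: cvg_id].
have oD : open D by exact: ((continuousP _).1 cn _ (@open_gt R r)).
exists D; split.
  rewrite /D /=; apply: lt_le_trans yr.
  by apply: (@le_lt_trans _ _ (r1 / 2)); [rewrite ge_min lexx | lra].
apply: (smooth_on_eq (f := fun=> 0) oD); last exact: smooth_on_cst.
by move=> z Dz; rewrite /Phi cube_bump_eq0 ?mul0r// distrC ltW.
Qed.

End LocalRepresentation.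

(** * Multipliers that commute with the bilinear form *)

Section Commutation.
Context {R : realType} {n d : nat} {X : manifold R n}.
Local Notation V := (test_fun X).
Variables (v : X -> 'rV[R]_d) (B : V -> V -> R).
Hypotheses (sv : smooth_map v) (v_inj : injective v) (v_imm : immersion v).
Hypothesis B_sym : forall h k, B h k = B k h.
Hypothesis BD : forall h1 h2 k, B (h1 + h2) k = B h1 k + B h2 k.
Hypothesis BZ : forall (a : R) h k, B (a *: h) k = a * B h k.
Hypothesis B_cont : forall k (e : R), 0 < e ->
  exists2 W : set V, test_nbhd0 W & forall h, W h -> `|B h k| < e.
Hypothesis B_v : forall j h k, B (smul (sv j) h) k = B h (smul (sv j) k).

Let BDr h k1 k2 : B h (k1 + k2) = B h k1 + B h k2.
Proof. by rewrite B_sym BD !(B_sym h). Qed.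

Let BZr (a : R) h k : B h (a *: k) = a * B h k.
Proof. by rewrite B_sym BZ (B_sym h). Qed.

Section OnCompact.
Variable K : set X.
Hypothesis cK : compact K.

(* Supports are confined to [K] so that only values of [p] on [K] matter. *)
Definition commutes (p : X -> R) := forall (sp : smooth p) (h k : V),
  tsupport h `<=` K -> tsupport k `<=` K -> B (smul sp h) k = B h (smul sp k).

Lemma commutes_ext p q : smooth p -> commutes p -> (forall x, K x -> p x = q x) -> commutes q.
Proof.
move=> sp cp pq sq h k hK kK.
have E (l : V) : tsupport l `<=` K -> smul sq l = smul sp l.
  move=> lK; apply: test_ext => x; rewrite -[LHS]/(q x * l x) -[RHS]/(p x * l x).
  have [Kx|NK] := pselect (K x); first by rewrite pq.
  by rewrite (@test_supp _ _ _ l) ?mulr0// => /lK.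
by rewrite !E//; exact: cp.
Qed.

Lemma commutes_cst (a : R) : commutes (fun=> a).
Proof.
move=> sp h k _ _.
have E (l : V) : smul sp l = a *: l by apply: test_ext.
by rewrite !E BZ BZr.
Qed.

Lemma commutesD p q : smooth p -> smooth q -> commutes p -> commutes q ->
  commutes (fun x => p x + q x).
Proof.
move=> sp sq cp cq spq h k hK kK.
have E (l : V) : smul spq l = smul sp l + smul sq l.
  by apply: test_ext => x; exact: mulrDl.
by rewrite !E BD BDr cp// cq.
Qed.

Lemma commutesM p q : smooth p -> smooth q -> commutes p -> commutes q ->
  commutes (fun x => p x * q x).
Proof.
move=> sp sq cp cq spq h k hK kK.
have E (l : V) : smul spq l = smul sp (smul sq l).
  by apply: test_ext => x; rewrite -[LHS]/(p x * q x * l x) -[RHS]/(p x * (q x * l x)) mulrA.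
have E' (l : V) : smul spq l = smul sq (smul sp l).
  by apply: test_ext => x; rewrite -[LHS]/(p x * q x * l x) -[RHS]/(q x * (p x * l x)); ring.
rewrite E E' cp//; last exact: subset_trans (@tsupport_smul _ _ _ _ sq h) hK.
by rewrite cq//; exact: subset_trans (@tsupport_smul _ _ _ _ sp k) kK.
Qed.

Lemma commutes_v j : commutes (fun x => v x 0 j).
Proof.
move=> sp h k _ _.
have E (l : V) : smul sp l = smul (sv j) l by apply: test_ext.
by rewrite !E B_v.
Qed.

Lemma commutes_bern (u : X -> 'rV[R]_d) (su : smooth_map u) (k : 'I_d) M
    (F : nat -> 'rV[R]_d -> R) : commutes (fun x => u x 0 k) ->
  (forall i, smooth_on setT (F i)) -> (forall i, commutes (F i \o u)) ->
  commutes ((fun x => bern M (fun i => F i x) (x 0 k)) \o u).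
Proof.
move=> cu; elim: M F => [|M IH] F sF cF; first exact: (cF 0%N).
have sb (F' : nat -> 'rV[R]_d -> R) : (forall i, smooth_on setT (F' i)) ->
    smooth ((fun x => bern M (fun i => F' i x) (x 0 k)) \o u).
  by move=> sF'; exact: (smooth_comp su (smooth_bern k M sF')).
have s1 : smooth (fun x => 1 + (-1) * u x 0 k).
  exact: (smoothD (smooth_cst 1) (smoothM (smooth_cst (-1)) (su k))).
have c1 : commutes (fun x => 1 + (-1) * u x 0 k).
  apply: commutesD; [exact: smooth_cst|exact: (smoothM (smooth_cst (-1)) (su k))
    |exact: commutes_cst|].
  apply: commutesM; [exact: smooth_cst|exact: su|exact: commutes_cst|exact: cu].
have cA := commutesM s1 (sb F sF) c1 (IH F sF cF).
have sF' i := sF i.+1; have cF' i := cF i.+1.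
have cB := commutesM (su k) (sb _ sF') cu (IH _ sF' cF').
have cAB := commutesD (smoothM s1 (sb F sF)) (smoothM (su k) (sb _ sF')) cA cB.
apply: (commutes_ext _ cAB).
  exact: (smoothD (smoothM s1 (sb F sF)) (smoothM (su k) (sb _ sF'))).
by move=> x _ /=; rewrite mulN1r.
Qed.

Lemma commutes_limit (u : X -> 'rV[R]_d) (su : smooth_map u) Phi :
  (forall x, K x -> unit_cube (u x)) -> smooth_on setT Phi ->
  (forall m (e : R), 0 < e -> exists2 Psi, smooth_on setT Psi /\ commutes (Psi \o u) &
     pbound m (@unit_cube R d) (fun y => Phi y - Psi y) e) ->
  commutes (Phi \o u).
Proof.
move=> uK sP approx sp h k hK kK; apply/eqP; rewrite -subr_eq0 -normr_le0.
apply/ler_addgt0Pr => e e0; rewrite add0r.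
have e20 : 0 < e / 2 by rewrite divr_gt0.
(* Continuity of [B] is only separate: [k] and [h] each give a neighbourhood, and the approximation
   must have the larger of the two orders. *)
have [W1 NW1 HW1] := B_cont k e20; have [W2 NW2 HW2] := B_cont h e20.
have [m1 [e1 [e10 H1]]] := test_nbhd0_mul_small su NW1 (fun x hx => uK x (hK x hx)).
have [m2 [e2 [e20' H2]]] := test_nbhd0_mul_small su NW2 (fun x kx => uK x (kK x kx)).
have me0 : 0 < Num.min e1 e2 by rewrite lt_min e10.
have [Psi [sPsi cPsi] bd] := approx (maxn m1 m2) _ me0.
have sD : smooth_on setT (fun y => Phi y - Psi y) by exact: smooth_onB openT sP sPsi.
have sPu := smooth_comp su sPsi.
have E (l : V) : smul sp l = smul sPu l + smul (smooth_comp su sD) l.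
  apply: test_ext => x; rewrite -[LHS]/(Phi (u x) * l x).
  by rewrite -[RHS]/(Psi (u x) * l x + (Phi (u x) - Psi (u x)) * l x); ring.
rewrite !E BD BDr (cPsi sPu h k hK kK) opprD addrACA subrr add0r.
have K1 : `|B (smul (smooth_comp su sD) h) k| < e / 2.
  by apply/HW1/H1; apply: pboundW bd; rewrite ?leq_maxl// ge_min lexx.
have K2 : `|B h (smul (smooth_comp su sD) k)| < e / 2.
  by rewrite B_sym; apply/HW2/H2; apply: pboundW bd; rewrite ?leq_maxr// ge_min lexx orbT.
apply: le_trans (ler_normB _ _) _; rewrite [leRHS]splitr; apply: lerD; exact: ltW.
Qed.

(* By induction on the number [l] of leading coordinates on which [Phi] depends:
   a Bernstein polynomial in coordinate [l] has coefficients that depend on the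
   first [l] coordinates only. *)
Lemma commutes_of_map (u : X -> 'rV[R]_d) (su : smooth_map u) :
  (forall x, K x -> unit_cube (u x)) -> (forall j, commutes (fun x => u x 0 j)) ->
  forall Phi, smooth_on setT Phi -> commutes (Phi \o u).
Proof.
move=> uK cu.
suff H l : (l <= d)%N -> forall Phi, smooth_on setT Phi ->
    (forall y z : 'rV[R]_d, (forall i : 'I_d, (i < l)%N -> y 0 i = z 0 i) -> Phi y = Phi z) ->
    commutes (Phi \o u).
  move=> Phi sP; apply: (H d) => // y z yz; congr Phi; apply/rowP => i; exact: yz.
elim: l => [_|l IH ld] Phi sP dep.
  have E x : K x -> cst (Phi 0) x = (Phi \o u) x by move=> _; exact: dep.
  apply: (commutes_ext (p := cst (Phi 0)) _ _ E); [exact: smooth_cst|exact: commutes_cst].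
apply: commutes_limit => // m e e0.
pose k := Ordinal ld.
have [N HN] := bernstein_approx k m sP e0.
exists (bernstein k N N Phi); last exact: HN.
split; first exact: (smooth_bernstein k N N sP).
pose F i (x : 'rV[R]_d) := Phi (setc k x (i%:R / N%:R)).
have sF i : smooth_on setT (F i) by exact: smooth_setc.
apply: (@commutes_bern u su k N F (cu k) sF) => i.
apply: (IH (ltnW ld) _ (sF i)).
move=> y z yz; apply: dep => j; rewrite ltnS leq_eqVlt !mxE.
have [->//|jk] := eqVneq j k.
by rewrite -[_ == l]/(j == k) (negPf jk) /=; exact: yz.
Qed.

Lemma commutes_comp_v Phi : smooth_on setT Phi -> commutes (Phi \o v).
Proof.
move=> sP.
have cv : {within K, continuous v}.
  by apply: continuous_subspaceT; exact: smooth_map_continuous.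
have [rho rho0 Hrho] : exists2 rho : R, 0 < rho & forall x, K x -> `|v x| <= rho.
  have /compact_bounded[b [_ Hb]] := continuous_compact cv cK.
  exists (`|b| + 1); first by rewrite ltr_wpDl.
  move=> x Kx; apply: (Hb (`|b| + 1)); last by exists x.
  by rewrite (le_lt_trans (ler_norm b))// ltrDl.
pose u x : 'rV[R]_d := \row_j (2^-1 + (2 * rho)^-1 * v x 0 j).
have suj j : smooth (fun x => 2^-1 + (2 * rho)^-1 * v x 0 j).
  exact: smoothD (smooth_cst _) (smoothM (smooth_cst _) (sv j)).
have uE j : (fun x => u x 0 j) = (fun x => 2^-1 + (2 * rho)^-1 * v x 0 j).
  by apply/funext => x; rewrite mxE.
have su : smooth_map u by move=> j; rewrite uE.
have cu j : commutes (fun x => u x 0 j).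
  rewrite uE; apply: commutesD; [exact: smooth_cst|exact: smoothM (smooth_cst _) (sv j)
    |exact: commutes_cst|].
  by apply: commutesM; [exact: smooth_cst|exact: sv|exact: commutes_cst|exact: commutes_v].
have uK x : K x -> unit_cube (u x).
  move=> Kx j; rewrite mxE; have := le_trans (rV_coord_le (v x) j) (Hrho x Kx).
  rewrite ler_norml => /andP[l1 l2].
  have i0 : 0 < (2 * rho)^-1 by rewrite invr_gt0 mulr_gt0.
  have E : (2 * rho)^-1 * rho = 2^-1 by field; rewrite gt_eqF.
  have := ler_wpM2l (ltW i0) l1; have := ler_wpM2l (ltW i0) l2.
  rewrite mulrN E; lra.
pose T (y : 'rV[R]_d) : 'rV[R]_d := \row_j (2 * rho * y 0 j - rho).
have sT j : smooth_on setT (fun y => T y 0 j).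
  apply: (smooth_on_eq (f := fun y => 2 * rho * y 0 j - rho) openT).
    by move=> y _; rewrite mxE.
  apply: (smooth_onB openT _ (smooth_on_cst _)).
  exact: (smooth_onM openT (smooth_on_cst _) (smooth_on_coord j (@openT _))).
have sPT : smooth_on setT (Phi \o T).
  exact: (smooth_on_comp (u := T) openT openT (fun _ _ => I) sT sP).
have -> : Phi \o v = (Phi \o T) \o u.
  apply/funext => x /=; congr Phi; apply/rowP => j; rewrite !mxE; field.
  by rewrite gt_eqF.
exact: commutes_of_map.
Qed.

(** Asking that all smooth multiples of [b] commute allows division: such [b] are closed under sums,
    [local_representation] gives one that is positive at any given point, and once [b > 0] on [K]
    with [r b = 1] there, [p] agrees on [K] with the multiple [b (r p)]. *)
Lemma commutes_smooth p : smooth p -> commutes p.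
Proof.
move=> sp.
pose P (b : X -> R) := smooth b /\ (forall x, 0 <= b x) /\
  forall q, smooth q -> commutes (fun x => b x * q x).
have [||||x0 _|b [sb [b0 cb]] bK] := @compact_pos R X P K cK.
- split; first exact: smooth_cst.
  split=> // q sq sp' h k hK kK; have E (l : V) : smul sp' l = 0.
    by apply: test_ext => x; rewrite -[LHS]/(0 * q x * l x) !mul0r.
  rewrite !E; have B0 (l : V) : B 0 l = 0 by rewrite -(scale0r (0 : V)) BZ mul0r.
  by rewrite (B_sym h) !B0.
- move=> b1 b2 [s1 [p1 c1]] [s2 [p2 c2]]; split; first exact: smoothD.
  split=> [x|q sq]; first by rewrite addr_ge0.
  have := commutesD (smoothM s1 sq) (smoothM s2 sq) (c1 q sq) (c2 q sq).
  move=> c12; apply: (commutes_ext _ c12) => [|x _]; last by rewrite mulrDl.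
  exact: smoothD (smoothM s1 sq) (smoothM s2 sq).
- by move=> b x [_ []].
- by move=> b [sb _]; exact: smooth_continuous.
- have [r [r0 Hr]] := local_representation sv v_inj v_imm x0 cK.
  exists (cube_bump (v x0) r \o v); last by rewrite /= cube_bump_gt0// subrr normr0.
  split; first exact: smooth_comp sv (@smooth_cube_bump _ _ (v x0) r).
  split=> [x|q sq]; first exact: cube_bump_ge0.
  have [Phi sPhi PhiE] := Hr q sq.
  exact: (commutes_ext (smooth_comp sv sPhi) (commutes_comp_v sPhi) PhiE).
have [r sr rb] := smooth_inverse_on cK sb bK.
have sq := smoothM sr sp.
apply: (commutes_ext (smoothM sb sq) (cb _ sq)) => x Kx /=.
by rewrite mulrA (mulrC (b x)) rb// mul1r.
Qed.

End OnCompact.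

Lemma bilinear_commutes p (sp : smooth p) (h k : V) : B (smul sp h) k = B h (smul sp k).
Proof.
have cK : compact (tsupport h `|` tsupport k).
  by apply: compactU; exact: test_compact.
by apply: (commutes_smooth cK sp) => x; [left|right].
Qed.

Lemma bilinear_factor : exists l : dual V, forall h k, B h k = pairing l (tmul h k).
Proof.
have /choice[chi Hchi] : forall g : V, exists chi : V, forall x, tsupport g x -> chi x = 1.
  by move=> g; exact: test_cutoff (@test_compact _ _ _ g).
have Hsmul (a : V) (g : V) : (forall x, tsupport g x -> a x = 1) -> smul (test_smooth a) g = g.
  move=> ag; apply: test_ext => x; rewrite -[LHS]/(a x * g x).
  have [gx|gx] := pselect (tsupport g x); first by rewrite ag// mul1r.
  by rewrite (test_supp gx) mulr0.
(* Cutoffs move through [B]: [B a g = B a (b g) = B (b a) g = B b (a g) = B b g]. *)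
have indep (a b : V) (g : V) : (forall x, tsupport g x -> a x = 1) ->
    (forall x, tsupport g x -> b x = 1) -> B a g = B b g.
  move=> ag bg; rewrite -{1}(Hsmul b g bg) -bilinear_commutes.
  have -> : smul (test_smooth b) a = smul (test_smooth a) b.
    by apply: test_ext => x; exact: mulrC.
  by rewrite bilinear_commutes Hsmul.
pose A (g : V) : R^o := B (chi g) g.
have AE (a g : V) : (forall x, tsupport g x -> a x = 1) -> A g = B a g.
  by move=> ag; apply: indep => //; exact: Hchi.
have Alin : linear A.
  move=> t g h.
  (* A cutoff equal to 1 on both supports computes [A] at [g], at [h] and at their combination,
     where linearity of [B] in its second argument applies. *)
  have cK : compact (tsupport g `|` tsupport h).
    by apply: compactU; exact: test_compact.
  have [a Ha] := test_cutoff cK.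
  have sub : tsupport (t *: g + h) `<=` tsupport g `|` tsupport h.
    rewrite /tsupport -closureU; apply: closureS => x /= gh.
    have [gx|] := eqVneq (g x) 0; last by left.
    right; move: gh; rewrite -[X in X != 0]/(t * g x + h x) gx mulr0 add0r; exact.
  rewrite (AE a g) ?(AE a h) ?(AE a (t *: g + h)).
  - by rewrite BDr BZr.
  - by move=> x /sub; exact: Ha.
  - by move=> x hx; apply: Ha; right.
  - by move=> x gx; apply: Ha; left.
pose l : {linear V -> R^o} := HB.pack A (GRing.isLinear.Build _ _ _ _ A Alin).
have cl : continuous l.
  apply: linear_test_continuous => e e0; split=> [a b f g fe ge ab|K cK].
    have {}fe : `|A f| < e := fe; have {}ge : `|A g| < e := ge.
    suff : `|A (a *: f + b *: g)| < e by [].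
    have -> : A (a *: f + b *: g) = a * A f + b * A g.
      by rewrite Alin; congr (_ + _); exact: (linearZ_LR l b g).
    apply: le_lt_trans (ler_normD _ _) _; rewrite !normrM.
    have M0 : Num.max `|A f| `|A g| < e by rewrite gt_max fe ge.
    apply: le_lt_trans M0.
    apply: (@le_trans _ _ ((`|a| + `|b|) * Num.max `|A f| `|A g|)).
      by rewrite mulrDl; apply: lerD; apply: ler_wpM2l; rewrite // le_max lexx ?orbT.
    by rewrite ler_piMl// le_max normr_ge0.
  (* The neighbourhood condition concerns functions supported in a fixed [K]; there a single cutoff
     [a] gives [A f = B f a], so separate continuity of [B] suffices. *)
  have [a Ha] := test_cutoff cK.
  have [W NW HW] := B_cont a e0.
  apply: nbhd0_onS (NW.2 K cK) _ => f fK Wf.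
  suff : `|A f| < e by [].
  have -> : A f = B f a by rewrite B_sym; apply: AE => x /fK; exact: Ha.
  exact: HW.
exists (exist _ l cl) => h k.
rewrite /pairing /= -[LHS]/(B h k).
(* The cutoff of [h] also serves for [h k]; moving [h] back to the first argument leaves
   [B (h chi) k = B h k]. *)
rewrite -[RHS]/(A (tmul h k)) (AE (chi h)); last first.
  by move=> x hx; apply: Hchi; apply: closureS hx => y /=; apply: contra_neq => hy;
    rewrite -[LHS]/(h y * k y) hy mul0r.
rewrite /tmul -bilinear_commutes; congr B.
apply: test_ext => x; rewrite -[RHS]/(h x * chi h x).
have [hx|hx] := pselect (tsupport h x); first by rewrite Hchi// mulr1.
by rewrite (test_supp hx) mul0r.
Qed.

End Commutation.

(** * From a density to a flux *)

Section FluxOfFactor.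
Context {R : realType} {V : tvsType R}.
Variables (M : set V) (c : V -> R) (T : V -> V).
Hypotheses (oM : open M) (M_sc : simply_connected M) (sc : smooth_in M c).
Hypothesis TD : forall h k, T (h + k) = T h + T k.
Hypothesis TZ : forall (a : R) h, T (a *: h) = a *: T h.
Hypothesis T_cont : continuous T.
Hypothesis T_sym : forall f h k, M f -> gateaux_n c [:: T h; k] f = gateaux_n c [:: T k; h] f.

Lemma locally_segment_convex (f : V) (A : set V) : nbhs f A ->
  exists U : set V, [/\ open U, segment_convex U, U f & U `<=` A].
Proof.
move=> Af; have [B cB bB] := @locally_convex R V.
have [U [BU Uf] UA] := bB.2 f A Af.
exists U; split=> //; first exact: bB.1.
move=> a b t Ua Ub t01; have cU := cB U (mem_set BU).
have [t0 t1] := andP t01.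
have := cU b a (Itv01 t0 t1) (mem_set Ub) (mem_set Ua); move/set_mem.
congr U; rewrite /conv /= /unstable.onem scalerBl scale1r scalerBr.
by rewrite addrCA.
Qed.

Let w f h := gateaux c f (T h).

Let w_cvg (S : Type) (F : set_system S) (FF : Filter F) (p h : S -> V) f k :
  M f -> p @ F --> f -> h @ F --> k -> (fun t => w (p t) (h t)) @ F --> w f k.
Proof.
move=> Mf pf hk; apply: (smooth_in_cvg1 sc Mf pf).
exact: (cvg_comp _ _ hk (@T_cont k)).
Qed.

Section SmoothPrimitive.
Variable F : V -> R.
Hypothesis dF : gderivable M F.
Hypothesis FE : forall f h, M f -> gateaux F f h = w f h.

(** [smooth_in] includes continuity of [F] itself. By the mean value theorem an increment of [F] is
    [w] at an intermediate point in the direction [g - f], and [w] is jointly continuous with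
    [w f 0 = 0]. *)
Lemma primitive_continuous f : M f -> {for f, continuous F}.
Proof.
move=> Mf; apply/(@cvgrPdist_le _ _ _ (nbhs f)) => e e0.
have w0 : w f 0 = 0.
  by rewrite /w -(scale0r (0 : V)) TZ (smooth_in_gateauxZ sc)// mul0r.
have C : (fun q : V * V => w q.1 q.2) @ nbhs (f, (0 : V)) --> w f 0.
  by apply: w_cvg => //; [exact: cvg_fst | exact: cvg_snd].
move: C => /cvgrPdist_le /(_ e e0); rewrite w0 => -[[A B] /= [Af B0] AB].
have [U [oU cU Uf UA]] := locally_segment_convex (filterI Af (open_nbhs_nbhs (conj oM Mf))).
have NB : nbhs f [set g | B (g - f)].
  have cs : (fun g : V => g + - f) @ nbhs f --> f - f.
    by apply: (tvs_cvgD (F := nbhs f)); [exact: cvg_id | exact: cst_continuous].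
  by apply: cs; rewrite subrr.
have NUB := @filterI _ _ (nbhs_filter f) _ _ (open_nbhs_nbhs (conj oU Uf)) NB.
apply: (@filterS _ _ _ _ _ _ NUB) => g [Ug Bg].
have Ut (t : R) : 0 <= t <= 1 -> U (f + t *: (g - f)) by move=> t01; exact: cU.
have [t t01|t t01] := @gateaux_MVT _ _ M F f (g - f) dF; first by have [] := UA _ (Ut t t01).
have [Aft Mft] := UA _ (Ut t t01).
rewrite (addrC f) subrK FE// => E; rewrite distrC E -normrN -sub0r.
exact: (AB (f + t *: (g - f), g - f) (conj Aft Bg)).
Qed.

Let gateaux_nE h hs f : M f -> gateaux_n F (h :: hs) f = gateaux_n c (T h :: hs) f.
Proof.
move=> Mf; apply: (@gateaux_n_near _ _ M oM (fun f => gateaux F f h) (fun f => gateaux c f (T h))) => //.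
by move=> g Mg; exact: FE.
Qed.

(** From order 1 on, a derivative of [F] on [M] is the derivative of [c] of the same order with [T]
    applied to the first direction; order 0 is [primitive_continuous]. *)
Lemma smooth_in_primitive : smooth_in M F.
Proof.
move=> [|k]; split.
- by move=> hs f h Mf; rewrite tuple0; exact: dF.
- move=> p Mp; have -> : (fun q : V * 'rV[V]_0 => gateaux_n F [seq q.2 0 i | i : 'I_0] q.1) = F \o fst.
    by apply/funext => q; rewrite (@size0nil _ [seq q.2 0 i | i : 'I_0]) ?size_image ?card_ord.
  apply: (@cvg_comp _ _ _ fst F _ (nbhs p.1)); last exact: (@primitive_continuous p.1 Mp).
  exact: (@cvg_fst _ _ (nbhs p.1) (nbhs p.2)).
- move=> hs f h Mf; rewrite [hs]tuple_eta /=.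
  have E g : M g -> gateaux_n c (T (thead hs) :: behead hs) g = gateaux_n F (thead hs :: behead hs) g.
    by move=> Mg; rewrite gateaux_nE.
  have [_] := gateaux_near h oM Mf E; apply.
  exact: (@smooth_in_gderivable _ _ M c sc (T (thead hs) :: behead hs) f h Mf).
- move=> p Mp.
  (* The direction of index 0 is the one differentiated first, so [T] acts on that coordinate
     alone. *)
  pose Tq (q : 'rV[V]_k.+1) : 'rV[V]_k.+1 := \row_i (if i == ord0 then T (q 0 i) else q 0 i).
  pose G := fun q : V * 'rV[V]_k.+1 => gateaux_n c [seq q.2 0 i | i : 'I_k.+1] q.1.
  have GE (q : V * 'rV[V]_k.+1) : M q.1 -> G (q.1, Tq q.2) = gateaux_n F [seq q.2 0 i | i : 'I_k.+1] q.1.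
    have consE (a : 'I_k.+1 -> V) : [seq a i | i : 'I_k.+1] = a ord0 :: [seq a (lift ord0 i) | i : 'I_k].
      by rewrite /image_mem enum_ordSl /= -map_comp.
    move=> Mq; rewrite /G !consE gateaux_nE// [_.2]/= mxE eqxx.
    by congr (gateaux_n c (_ :: _) _); apply: eq_map => i; rewrite mxE.
  have cG : {for (p.1, Tq p.2), continuous G} by have [_] := sc k.+1; exact.
  have cT : (fun q : V * 'rV[V]_k.+1 => (q.1, Tq q.2)) @ nbhs p --> (p.1, Tq p.2).
    apply: (@cvg_pair _ _ _ _ (nbhs p.1) (nbhs (Tq p.2))); first exact: (@cvg_fst _ _ (nbhs p.1) (nbhs p.2)).
    have cs i : (fun q : V * 'rV[V]_k.+1 => q.2 0 i) @ nbhs p --> p.2 0 i.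
      apply: (@cvg_comp _ _ _ snd (fun q : 'rV[V]_k.+1 => q 0 i) _ (nbhs p.2)); last exact: coord_cvg.
      exact: (@cvg_snd _ _ (nbhs p.1) (nbhs p.2)).
    apply: (rV_cvg (F := nbhs p)) => i; rewrite mxE.
    have -> : (fun q : V * 'rV[V]_k.+1 => Tq q.2 0 i) =
        (fun q => if i == ord0 then T (q.2 0 i) else q.2 0 i).
      by apply/funext => q; rewrite mxE.
    case: eqP => _; last exact: cs.
    exact: (cvg_comp _ _ (cs i) (@T_cont _)).
  have E : {near p, (fun q : V * 'rV[V]_k.+1 => G (q.1, Tq q.2)) =1
      (fun q => gateaux_n F [seq q.2 0 i | i : 'I_k.+1] q.1)}.
    have : nbhs p [set q : V * 'rV[V]_k.+1 | M q.1].
      apply: (@cvg_fst _ _ (nbhs p.1) (nbhs p.2)).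
      exact: open_nbhs_nbhs.
    by apply: filterS => q; exact: GE.
  have C := cvg_comp _ _ cT cG.
  rewrite /prop_for /continuous_at -GE//.
  exact: (cvg_trans (near_eq_cvg E) C).
Qed.

End SmoothPrimitive.

(** For [T] the multiplication by [v^j] this is one component of the flux. [T_sym] says that [w] is
    closed, so [seg_int] is a local primitive on each convex open subset of [M], and
    [global_primitive] glues these. *)
Lemma flux_component : exists2 F, smooth_in M F &
  forall f h, M f -> gateaux F f h = gateaux c f (T h).
Proof.
pose good U := [/\ open U, segment_convex U & U `<=` M].
have wD f h k : M f -> w f (h + k) = w f h + w f k.
  by move=> Mf; rewrite /w TD; exact: (smooth_in_gateauxD oM sc _ _ Mf).
have wZ f h (a : R) : M f -> w f (a *: h) = a * w f h.
  by move=> Mf; rewrite /w TZ; exact: (smooth_in_gateauxZ sc _ _ Mf).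
have w_der h : gderivable M (fun f => w f h).
  exact: (@smooth_in_gderivable _ _ M c sc [:: T h]).
have q_cvg (S : Type) (F : set_system S) (FF : Filter F) (p h k : S -> V) f h0 k0 :
    M f -> p @ F --> f -> h @ F --> h0 -> k @ F --> k0 ->
    (fun t => gateaux (fun f => w f (h t)) (p t) (k t)) @ F --> gateaux (fun f => w f h0) f k0.
  move=> Mf pf hh kk; apply: (smooth_in_cvg2 sc Mf pf _ kk).
  exact: (cvg_comp _ _ hh (@T_cont h0)).
have q_sym f h k : M f -> gateaux (fun f => w f h) f k = gateaux (fun f => w f k) f h.
  exact: T_sym.
have SG U a b k : good U -> U a -> U b ->
    derivable (fun s : R => seg_int w a (b + s *: k)) 0 1 /\ gateaux (seg_int w a) b k = w b k.
  by move=> [oU cU UM]; exact: (seg_int_gateaux wD wZ w_cvg w_der q_cvg q_sym oU cU UM).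
have SC U a b e : good U -> U a -> U b -> U e ->
    seg_int w a e - seg_int w a b = seg_int w b e.
  by move=> [oU cU UM]; exact: (seg_int_cocycle wD wZ w_cvg w_der q_cvg q_sym oU cU UM).
have cover f : M f -> exists2 U, good U & U f.
  move=> Mf; have [U [oU cU Uf UM]] := locally_segment_convex (open_nbhs_nbhs (conj oM Mf)).
  by exists U.
have [U gU|U gU|U gU|F HF] := @global_primitive _ _ M (seg_int w) good _ _ _ cover SC M_sc.
- by case: gU.
- by case: gU.
- by case: gU.
have DF f h : M f -> derivable (fun t : R => F (f + t *: h)) 0 1 /\ gateaux F f h = w f h.
  move=> Mf; have [U gU Uf] := cover f Mf; have [oU _ _] := gU.
  have [dS SE] := SG U f f h gU Uf Uf.
  have E g : U g -> F f + seg_int w f g = F g.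
    by move=> Ug; rewrite -(HF U f g gU Uf Ug) addrC subrK.
  have [GE GD] := gateaux_near h oU Uf E.
  split; first by apply: GD; apply: derivableD => //; exact: derivable_cst.
  rewrite -GE -SE !gateauxE; apply: etrans (deriveD _ dS) _; first exact: derivable_cst.
  by rewrite derive_cst add0r.
exists F; last by move=> f h Mf; have [] := DF f h Mf.
by apply: smooth_in_primitive => f h Mf; have [] := DF f h Mf.
Qed.

End FluxOfFactor.

Theorem theorem7 (R : realType) (n d : nat) (Xi : manifold R n)
  (v : Xi -> 'rV[R]_d) (v_smooth : smooth_map v) (v_inj : injective v)
  (v_imm : immersion v)
  (M : set (test_fun Xi)) (M_open : open M) (M_sc : simply_connected M)
  (c : test_fun Xi -> R) (c_smooth : smooth_in M c) :
  possesses_flux v_smooth M c <->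
  exists A : test_fun Xi -> dual (test_fun Xi),
    forall (f h1 h2 : test_fun Xi), M f ->
      gateaux_n c [:: h1; h2] f = pairing (A f) (tmul h1 h2).
Proof.
split=> [[F [sF FE]]|[A HA]]; last first.
  have /choice[F HF] : forall j, exists F, smooth_in M F /\
      forall f h, M f -> gateaux F f h = gateaux c f (smul (v_smooth j) h).
    move=> j; have [||||F sF FE] := @flux_component R (test_fun Xi) M c (smul (v_smooth j)) M_open M_sc c_smooth.
    - move=> h k; apply: test_ext => x.
      by rewrite -[LHS]/(v x 0 j * (h x + k x)) -[RHS]/(v x 0 j * h x + v x 0 j * k x) mulrDr.
    - move=> a h; apply: test_ext => x.
      by rewrite -[LHS]/(v x 0 j * (a * h x)) -[RHS]/(a * (v x 0 j * h x)) mulrCA.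
    - exact: smul_continuous.
    (* Closedness: both sides pair [A f] with the same product [v^j h k]. *)
    - move=> f h k Mf; rewrite !HA//; congr (pairing _ _); apply: test_ext => x.
      rewrite -[LHS]/(v x 0 j * h x * k x) -[RHS]/(v x 0 j * k x * h x).
      by rewrite mulrAC.
    by exists F.
  by exists F; split=> [j|j f h Mf]; have [] := HF j => // _; exact.
have key f : M f -> exists l : dual (test_fun Xi), forall h k, gateaux_n c [:: h; k] f = pairing l (tmul h k).
  move=> Mf.
  apply: (@bilinear_factor R n d Xi v (fun h k => gateaux_n c [:: h; k] f) v_smooth v_inj v_imm).
  - by move=> h k; exact: (gateaux2_sym M_open c_smooth _ _ Mf).
  - by move=> h1 h2 k; exact: (gateaux2Dl M_open c_smooth _ _ _ Mf).
  - by move=> a h k; exact: (gateaux2Zl M_open c_smooth _ _ _ Mf).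
  - move=> k e e0.
    have B0 : gateaux_n c [:: 0; k] f = 0.
      by rewrite -(scale0r (0 : test_fun Xi)) (gateaux2Zl M_open c_smooth _ _ _ Mf) mul0r.
    have C : (fun h => gateaux_n c [:: h; k] f) @ nbhs (0 : test_fun Xi) --> gateaux_n c [:: 0; k] f.
      by apply: (smooth_in_cvg2 (F := nbhs (0 : test_fun Xi)) c_smooth Mf);
        [exact: cst_continuous|exact: cvg_id|exact: cst_continuous].
    move: C => /(@cvgrPdist_lt _ _ _ (nbhs (0 : test_fun Xi))) /(_ e e0).
    move=> /test_nbhs0P[W NW HW]; exists W => // h Wh.
    by rewrite -normrN -sub0r -B0; exact: HW.
  - move=> j h k.
    (* The flux identity is differentiated once more, along [h2]; it holds near [f] because [M] is
       open. *)
    have E h1 h2 : gateaux_n (F j) [:: h1; h2] f = gateaux_n c [:: smul (v_smooth j) h1; h2] f.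
      have [] := @gateaux_near _ _ M (fun f => gateaux (F j) f h1)
        (fun f => gateaux c f (smul (v_smooth j) h1)) f h2 M_open Mf => // g Mg; exact: FE.
    (* With [B] the second derivative of [c]: [B (v^j h) k] is the second derivative of [F j] along
       [h, k], hence along [k, h], which is [B (v^j k) h = B h (v^j k)]. *)
    by rewrite -E (gateaux2_sym M_open (sF j) _ _ Mf) E (gateaux2_sym M_open c_smooth _ _ Mf).
(* [A] is a total function; off [M] the zero functional serves as its value. *)
pose l0 : {linear test_fun Xi -> R^o} := \0.
have cl0 : continuous l0 by exact: cst_continuous.
have /choice[A HA] : forall f, exists l : dual (test_fun Xi),
    M f -> forall h k, gateaux_n c [:: h; k] f = pairing l (tmul h k).
  move=> f; have [Mf|nMf] := pselect (M f); last by exists (exist _ l0 cl0).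
  by have [l Hl] := key f Mf; exists l.
by exists A => f h k Mf; exact: HA.
Qed.
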